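(* Let $M:\mathbb{P}^n\to\mathbb{P}$ be an $n$-variable operator mean and $\sigma$ an operator mean with $\sigma\neq\mathfrak{l}$. For every $A_1,\dots,A_n\in\mathbb{P}$ and any $r\in(0,1]$, $$\|M_{\sigma_r}(A_1,\dots,A_n)\|_\infty^{r-1}M_{\sigma_r}(A_1,\dots,A_n)\le M_\sigma(A_1^r,\dots,A_n^r)\le\lambda_{\min}(M_{\sigma_r}(A_1,\dots,A_n))^{r-1}M_{\sigma_r}(A_1,\dots,A_n),$$ where $\sigma_r$ is the operator mean with the representing function $x\mapsto f_\sigma(x^r)$.
   Context: $\mathcal{H}$ is an infinite-dimensional Hilbert space, $B(\mathcal{H})$ the bounded linear operators on $\mathcal{H}$, $B(\mathcal{H})^+$ the positive (semidefinite) operators, $\mathbb{P}=\mathbb{P}(\mathcal{H})$ the positive invertible operators; $\le$ is the usual order on self-adjoint operators and SOT is the strong operator topology. $A_k\searrow A$ (resp. $A_k\nearrow A$) means that the sequence is decreasing (resp. increasing) and $A_k\to A$ in SOT. For $X\in\mathbb{P}$, $\|X\|_\infty$ is the operator norm and $\lambda_{\min}(X)$ is the minimum of the spectrum of $X$. Operator mean (Kubo–Ando): a map $\sigma:B(\mathcal{H})^+\times B(\mathcal{H})^+\to B(\mathcal{H})^+$ such that (i) $A\le C$, $B\le D$ imply $A\sigma B\le C\sigma D$; (ii) $C(A\sigma B)C\le(CAC)\sigma(CBC)$ for all $C\in B(\mathcal{H})^+$; (iii) $A_k\searrow A$, $B_k\searrow B$ imply $A_k\sigma B_k\searrow A\sigma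 B$; (iv) $I\sigma I=I$. By Kubo–Ando, operator means correspond bijectively to nonnegative operator monotone functions $f_\sigma$ on $(0,\infty)$ with $f_\sigma(1)=1$ (the representing function), via $f_\sigma(x)I=I\sigma(xI)$ and $A\sigma B=A^{1/2}f_\sigma(A^{-1/2}BA^{-1/2})A^{1/2}$ for $A,B\in\mathbb{P}$. The left trivial mean $\mathfrak{l}$ is $A\,\mathfrak{l}\,B=A$. $n$-variable operator mean: a map $M:\mathbb{P}^n\to\mathbb{P}$ such that (I) $A_j\le B_j$ for all $j$ implies $M(A_1,\dots,A_n)\le M(B_1,\dots,B_n)$; (II) $S^*M(A_1,\dots,A_n)S=M(S^*A_1S,\dots,S^*A_nS)$ for every invertible $S\in B(\mathcal{H})$; (III) for $A_j,A_{jk}\in\mathbb{P}$, if either $A_{jk}\searrow A_j$ as $k\to\infty$ for each $j$, or $A_{jk}\nearrow A_j$ as $k\to\infty$ for each $j$, then $M(A_{1k},\dots,A_{nk})\to M(A_1,\dots,A_n)$ in SOT; (IV) $M(I,\dots,I)=I$. Deformed mean: for an $n$-variable operator mean $M$ and an operator mean $\sigma\ne\mathfrak{l}$, $M_\sigma(A_1,\dots,A_n)$ is the unique $X\in\mathbb{P}$ (which exists) with $X=M(X\sigma A_1,\dots,X\sigma A_n)$; $M_\sigma$ is again an $n$-variable operator mean. *)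

(* Defs.v *)
(* MathComp-Analysis.  Complex Hilbert spaces are complete normed modules H over
   R[i] (R : realType) with a positive definite Hermitian form [ip] (linear on
   the left) inducing the norm.  Operators are plain functions H -> H, with the
   pointwise module structure, cut out by predicates; means are total functions
   on them whose values outside B(H)^+ (resp. P(H)) are never constrained or
   used. *)
From HB Require Import structures.
From mathcomp Require Import all_boot all_order all_algebra.
From mathcomp Require Import complex.
From mathcomp Require Import all_classical all_reals all_analysis.

Set Implicit Arguments.
Unset Strict Implicit.
Unset Printing Implicit Defensive.
Import Order.TTheory GRing.Theory Num.Theory.
Import numFieldNormedType.Exports.
Local Open Scope classical_set_scope.
Local Open Scope ring_scope.
Local Open Scope complex_scope.

Section BoundedOperators.
Context {R : realType} {H : completeNormedModType R[i]}.
Implicit Types (T S : H -> H).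

Definition infinite_dimensional (V : lmodType R[i]) : Prop :=
  ~ exists (m : nat) (e : 'I_m -> V), forall x : V,
      exists c : 'I_m -> R[i], x = \sum_(i < m) c i *: e i.

Definition bounded_operator T : Prop :=
  linear T /\ exists c : R, forall x, `|T x| <= c%:C * `|x|.

Definition invertible_operator T : Prop :=
  exists S, [/\ bounded_operator S, T \o S = id & S \o T = id].

Definition spectrum T : set R[i] :=
  [set z | ~ invertible_operator (T - z *: (id : H -> H))].

(* norms in a normed module over R[i] are R[i]-valued (with real values) *)
Definition op_norm T : R :=
  sup [set complex.Re `|T x| | x in [set x : H | `|x| <= 1]].

(* The order of R[i] relates only numbers with equal imaginary parts, so such
   an l exists only if the spectrum is real; junk value 0 otherwise. *)
Definition lambda_min T : R :=
  xget 0 [set l : R | spectrum T l%:C /\ forall z, spectrum T z -> l%:C <= z].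

Definition horner_operator (p : {poly R}) T : H -> H :=
  fun x => \sum_(i < size p) (p`_i)%:C *: iter i T x.

(* S = f(T) in the continuous functional calculus of a self-adjoint T: S is the
   norm limit of p(T) for real polynomials p converging to f uniformly on the
   spectrum of T. *)
Definition functional_calculus (f : R -> R) T S : Prop :=
  bounded_operator S /\
  forall e : R, 0 < e -> exists p : {poly R},
    (forall t : R, spectrum T t%:C -> `|p.[t] - f t| <= e) /\
    op_norm (horner_operator p T - S) <= e.

Definition op_pow T (r : R) : H -> H :=
  xget 0 [set S | functional_calculus (fun t => t `^ r) T S].

Definition sot_cvg (T_ : nat -> H -> H) T : Prop :=
  forall x, T_ k x @[k --> \oo] --> T x.

End BoundedOperators.

Section OperatorMeans.
Context {R : realType} {H : completeNormedModType R[i]}.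
Variable ip : {dot H for Num.conj}.
Implicit Types (A B C D S T X : H -> H).

Definition induces_norm : Prop := forall x : H, `|x| ^+ 2 = ip x x.

Definition adjoint S : H -> H :=
  xget 0 [set T | bounded_operator T /\ forall x y, ip (S x) y = ip x (T y)].

(* On a complex space, 0 <= <Tx, x> for all x forces T to be self-adjoint. *)
Definition positive_operator T : Prop :=
  bounded_operator T /\ forall x, 0 <= ip (T x) x.

Definition pos_invertible T : Prop :=
  positive_operator T /\ invertible_operator T.

Definition op_le A B : Prop := positive_operator (B - A).

Definition decreases_to (A_ : nat -> H -> H) A : Prop :=
  (forall k, op_le (A_ k.+1) (A_ k)) /\ sot_cvg A_ A.

Definition increases_to (A_ : nat -> H -> H) A : Prop :=
  (forall k, op_le (A_ k) (A_ k.+1)) /\ sot_cvg A_ A.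

Record operator_mean (sigma : (H -> H) -> (H -> H) -> (H -> H)) : Prop :=
  OperatorMean {
  mean_positive : forall A B, positive_operator A -> positive_operator B ->
    positive_operator (sigma A B);
  mean_mono : forall A B C D,
    positive_operator A -> positive_operator B ->
    positive_operator C -> positive_operator D ->
    op_le A C -> op_le B D -> op_le (sigma A B) (sigma C D);
  mean_transformer : forall A B C,
    positive_operator A -> positive_operator B -> positive_operator C ->
    op_le (C \o sigma A B \o C) (sigma (C \o A \o C) (C \o B \o C));
  mean_cvg : forall (A_ B_ : nat -> H -> H) A B,
    (forall k, positive_operator (A_ k)) ->
    (forall k, positive_operator (B_ k)) ->
    positive_operator A -> positive_operator B ->
    decreases_to A_ A -> decreases_to B_ B ->
    decreases_to (fun k => sigma (A_ k) (B_ k)) (sigma A B);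
  mean_id : sigma id id = id }.

Definition is_left_trivial (sigma : (H -> H) -> (H -> H) -> (H -> H)) : Prop :=
  forall A B, positive_operator A -> positive_operator B -> sigma A B = A.

(* only the values of f on ]0, +oo[ matter *)
Definition representing_function
    (sigma : (H -> H) -> (H -> H) -> (H -> H)) (f : R -> R) : Prop :=
  forall x : R, 0 < x ->
    sigma id (x%:C *: (id : H -> H)) = (f x)%:C *: (id : H -> H).

Record nvar_operator_mean (n : nat)
    (M : ('I_n -> H -> H) -> (H -> H)) : Prop := NvarOperatorMean {
  nmean_pos_invertible : forall A : 'I_n -> H -> H,
    (forall j, pos_invertible (A j)) -> pos_invertible (M A);
  nmean_mono : forall A B : 'I_n -> H -> H,
    (forall j, pos_invertible (A j)) -> (forall j, pos_invertible (B j)) ->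
    (forall j, op_le (A j) (B j)) -> op_le (M A) (M B);
  nmean_congruence : forall (A : 'I_n -> H -> H) S,
    (forall j, pos_invertible (A j)) ->
    bounded_operator S -> invertible_operator S ->
    adjoint S \o M A \o S = M (fun j => adjoint S \o A j \o S);
  nmean_cvg : forall (A_ : nat -> 'I_n -> H -> H) (A : 'I_n -> H -> H),
    (forall k j, pos_invertible (A_ k j)) -> (forall j, pos_invertible (A j)) ->
    (forall j, decreases_to (fun k => A_ k j) (A j)) \/
    (forall j, increases_to (fun k => A_ k j) (A j)) ->
    sot_cvg (fun k => M (A_ k)) (M A);
  nmean_id : M (fun=> id) = id }.

(* M_sigma(A_1, ..., A_n), the solution X in P(H) of the fixed point equation;
   it exists and is unique when M is an n-variable mean and sigma a mean other
   than the left trivial one. *)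
Definition deformed_mean (n : nat) (M : ('I_n -> H -> H) -> (H -> H))
    (sigma : (H -> H) -> (H -> H) -> (H -> H)) (A : 'I_n -> H -> H) : H -> H :=
  xget 0 [set X | pos_invertible X /\ X = M (fun j => sigma X (A j))].

End OperatorMeans.

(* Main.v *)
(* X := M_{sigma_r}(A) satisfies X = M(X sigma_r A_j), and
   X sigma_r A = X sigma (X #_r A) for the weighted geometric mean #_r, because
   I sigma_r B = f(B^r) = I sigma B^r.  By monotonicity of #_r in its first
   argument, lambda <= X <= mu implies lambda^(1-r) A^r <= X #_r A <=
   mu^(1-r) A^r.  Hence Z := lambda^(r-1) X satisfies M(Z sigma A_j^r) <= Z, and
   the reverse inequality holds for mu^(r-1) X.  Comparison with the fixed point
   Y = M_sigma(A^r) follows since Y |-> M(Y sigma B_j) is monotone and strictly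
   subhomogeneous: if alpha > 1 were minimal with Y <= alpha Z, then
   Y <= beta alpha Z for some beta < 1.  The strictness needs f to be strictly
   increasing; f is concave and u |-> f(1/u) is convex, so a nondecreasing f that
   takes one value twice is constant, and then sigma is left trivial.  Existence
   of the fixed point is the strong limit of the decreasing iteration from a
   large multiple of I. *)
Require Import Defs.
From HB Require Import structures.
From mathcomp Require Import all_boot all_order all_algebra.
From mathcomp Require Import complex.
From mathcomp Require Import all_classical all_reals all_analysis.
From mathcomp Require Import ring lra.

Set Implicit Arguments.
Unset Strict Implicit.
Unset Printing Implicit Defensive.
Import Order.TTheory GRing.Theory Num.Theory.
Import numFieldNormedType.Exports.
Local Open Scope classical_set_scope.
Local Open Scope ring_scope.
Local Open Scope complex_scope.

(** * The algebra of bounded operators *)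

Section RealNorm.
Context {R : realType} {H : completeNormedModType R[i]}.
Implicit Types (x y : H).

(** The axioms give a mean explicitly only on scalars, through f, so a nonscalar B is treated by
    slices. Spectral projections P cut B into pieces with s P <= B P <= t P; monotonicity and the
    transformer inequality show that [sg 1 B] commutes with P and lies between f(s) and f(t) on its
    range. A form estimate valid on all thin slices holds globally, which yields both the identity
    between the means of sigma_r and sigma and the strict contraction. The convexity properties of f
    come from operators B with two eigenvalues, tested on a line in the plane of two orthonormal
    vectors, which infinite dimension supplies. As X need not commute with A, monotonicity of X #_s
    A in X is propagated from s = 0 and s = 1 through midpoints, where the mean solves a Riccati
    equation, and then extended by norm continuity in s. Strictness has to be uniform: one beta < 1
    must serve a whole compact interval containing the spectrum, and all n operators at once. *)

Definition nr x : R := complex.Re `|x|.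

Lemma nrE x : `|x| = (nr x)%:C.
Proof. by rewrite /nr RRe_real // realE normr_ge0. Qed.

Lemma nr_ge0 x : 0 <= nr x.
Proof. by rewrite -ler0c -nrE. Qed.

Lemma nrD x y : nr (x + y) <= nr x + nr y.
Proof. by rewrite -lecR rmorphD /= -!nrE ler_normD. Qed.

Lemma nrN x : nr (- x) = nr x.
Proof. by rewrite /nr normrN. Qed.

Lemma nr_distC x y : nr (x - y) = nr (y - x).
Proof. by rewrite -nrN opprB. Qed.

Lemma nr_dist x y z : nr (x - z) <= nr (x - y) + nr (y - z).
Proof. by rewrite (le_trans _ (nrD _ _)) // addrA subrK. Qed.

Lemma nrZ (a : R[i]) x : nr (a *: x) = complex.Re `|a| * nr x.
Proof.
apply: complexI; rewrite rmorphM /= -!nrE normrZ; congr (_ * _).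
Qed.

Lemma nrZr (a : R) x : nr (a%:C *: x) = `|a| * nr x.
Proof. by rewrite nrZ normc_def /= expr0n /= addr0 sqrtr_sqr. Qed.

Lemma nr0 : nr 0 = 0.
Proof. by rewrite /nr normr0. Qed.

Lemma nr_eq0 x : (nr x == 0) = (x == 0).
Proof. by rewrite -(normr_eq0 x) nrE eq_complex /= eqxx andbT. Qed.

Lemma nr_gt0 x : (0 < nr x) = (x != 0).
Proof. by rewrite lt0r nr_ge0 andbT nr_eq0. Qed.

(** The filter form of convergence quantifies over positive elements of R[i]; here the tolerance is
    real, like all norm estimates below. *)
Definition cv (u : nat -> H) (l : H) : Prop :=
  forall e : R, 0 < e -> exists N, forall n, (N <= n)%N -> nr (u n - l) <= e.

Lemma cvP (u : nat -> H) (l : H) : cv u l <-> (u k @[k --> \oo] --> l).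
Proof.
split=> [ul|/cvgrPdist_le ul e e0].
  apply/cvgrPdist_le => e e0.
  have re0 : 0 < complex.Re e by move: e0; rewrite ltcE /= => /andP[].
  have [N uN] := ul _ re0.
  exists N => // n /= /uN; rewrite nr_distC nrE.
  have -> : e = (complex.Re e)%:C by rewrite RRe_real // realE ltW.
  by rewrite lecR.
have e0C : 0 < e%:C :> R[i] by rewrite (ltcR 0).
have [N _ uN] := ul _ e0C; exists N => n /uN /=.
by rewrite nrE lecR nr_distC.
Qed.

Lemma cv_unique (u : nat -> H) (l m : H) : cv u l -> cv u m -> l = m.
Proof. by move=> /cvP ul /cvP um; apply: cvg_unique ul um. Qed.

Lemma cvD (u v : nat -> H) (l m : H) :
  cv u l -> cv v m -> cv (fun n => u n + v n) (l + m).
Proof. by move=> /cvP ul /cvP vm; apply/cvP; exact: cvgD. Qed.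

Lemma cvZ (u : nat -> H) (l : H) (a : R[i]) :
  cv u l -> cv (fun n => a *: u n) (a *: l).
Proof. by move=> /cvP ul; apply/cvP; apply: cvgZ => //; exact: cvg_cst. Qed.

Lemma cv_cst (l : H) : cv (fun=> l) l.
Proof. by apply/cvP; exact: cvg_cst. Qed.

Lemma cauchy_cv (u : nat -> H) :
  (forall e : R, 0 < e -> exists N, forall m n, (N <= m)%N -> (N <= n)%N ->
     nr (u m - u n) <= e) -> exists l, cv u l.
Proof.
move=> uC; suff : cvg (u k @[k --> \oo]) by move=> c; exists (lim (u @ \oo)); apply/cvP.
apply: cauchy_cvg; apply/cauchy_ballP => e e0.
have eE : e = (complex.Re e)%:C by rewrite RRe_real // realE ltW.
have re0 : 0 < complex.Re e / 2.
  by rewrite divr_gt0 //; move: e0; rewrite ltcE /= => /andP[].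
have [N uN] := uC _ re0.
rewrite near_simpl; exists ([set n | N <= n]%N, [set n | N <= n]%N) => /=.
  by split; exists N.
move=> [m n] [/= Nm Nn]; rewrite /= -ball_normE /= nrE eE ltcR.
by rewrite (le_lt_trans (uN _ _ Nm Nn)) // ltr_pdivrMr // mulr_natr mulr2n ltrDl -(ltcR 0) -eE.
Qed.

End RealNorm.

Section BoundedOperatorRing.
Context {R : realType}.

(** Bundling makes the operators a ring and an R[i]-module, so that congruences and inverses can be
    handled by ring rewriting. The means, given on plain functions, are transferred to this type at
    the end. *)
Record bop (H : completeNormedModType R[i]) :=
  Bop { bopf :> H -> H; bopP : bounded_operator bopf }.

Context {H : completeNormedModType R[i]}.
Implicit Types (S T U : bop H).

HB.instance Definition _ := gen_eqMixin (bop H).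
HB.instance Definition _ := gen_choiceMixin (bop H).

Lemma bop_ext S T : (S : H -> H) =1 T -> S = T.
Proof.
case: S T => [s sP] [t tP] /= /funext st; case: _ / st in tP *.
by congr Bop; exact: Prop_irrelevance.
Qed.

Lemma bop_linear T : linear (T : H -> H). Proof. by case: (bopP T). Qed.

HB.instance Definition _ T := GRing.isLinear.Build R[i] H H *:%R (bopf T)
  (bop_linear T).

Lemma nr_bounded (f : H -> H) :
  (exists c : R, forall x, `|f x| <= c%:C * `|x|) <->
  (exists2 c : R, 0 <= c & forall x, nr (f x) <= c * nr x).
Proof.
split=> [[c fcalc]|[c c0 fcalc]]; last first.
  by exists c => x; rewrite !nrE -rmorphM /= lecR.
exists `|c| => // x; have := fcalc x; rewrite !nrE -rmorphM /= lecR => /le_trans.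
by apply; rewrite ler_wpM2r ?nr_ge0 // ler_norm.
Qed.

Lemma bop_bound T : exists2 c : R, 0 <= c & forall x, nr (T x) <= c * nr x.
Proof. by apply/nr_bounded; case: (bopP T). Qed.

Lemma bounded_operatorP (f : H -> H) : linear f ->
  (exists2 c : R, 0 <= c & forall x, nr (f x) <= c * nr x) ->
  bounded_operator f.
Proof. by move=> lf /nr_bounded. Qed.

Lemma bop0_subproof : bounded_operator (fun _ : H => 0 : H).
Proof.
apply: bounded_operatorP => [a x y|]; first by rewrite scaler0 addr0.
by exists 0 => // x; rewrite nr0 mul0r.
Qed.

Lemma bop1_subproof : bounded_operator (id : H -> H).
Proof. by apply: bounded_operatorP => //; exists 1 => // x; rewrite mul1r. Qed.

Lemma bopN_subproof T : bounded_operator (fun x => - T x).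
Proof.
apply: bounded_operatorP => [a x y|].
  by rewrite linearP opprD scalerN.
by have [c c0 Tc] := bop_bound T; exists c => // x; rewrite nrN.
Qed.

Lemma bopD_subproof S T : bounded_operator (fun x => S x + T x).
Proof.
apply: bounded_operatorP => [a x y|].
  by rewrite !linearP scalerDr addrACA.
have [c c0 Tc] := bop_bound T; have [d d0 Sd] := bop_bound S.
exists (d + c) => [|x]; first exact: addr_ge0.
by rewrite (le_trans (nrD _ _)) // mulrDl lerD.
Qed.

Lemma bopM_subproof S T : bounded_operator (fun x => S (T x)).
Proof.
apply: bounded_operatorP => [a x y|]; first by rewrite !linearP.
have [c c0 Tc] := bop_bound T; have [d d0 Sd] := bop_bound S.
exists (d * c) => [|x]; first exact: mulr_ge0.
by rewrite (le_trans (Sd _)) // -mulrA ler_wpM2l.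
Qed.

Lemma bopZ_subproof (a : R[i]) T : bounded_operator (fun x => a *: T x).
Proof.
apply: bounded_operatorP => [b x y|].
  by rewrite linearP scalerDr !scalerA mulrC.
have [c c0 Tc] := bop_bound T.
have a0 : 0 <= complex.Re `|a| by rewrite -ler0c RRe_real // realE normr_ge0.
exists (complex.Re `|a| * c) => [|x]; first exact: mulr_ge0.
by rewrite nrZ -mulrA ler_wpM2l.
Qed.

Definition bop0 := Bop bop0_subproof.
Definition bop1 := Bop bop1_subproof.
Definition bop_opp T := Bop (bopN_subproof T).
Definition bop_add S T := Bop (bopD_subproof S T).
Definition bop_mul S T := Bop (bopM_subproof S T).
Definition bop_scale a T := Bop (bopZ_subproof a T).

Fact bop_addA : associative bop_add.
Proof. by move=> S T U; apply: bop_ext => x /=; rewrite addrA. Qed.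
Fact bop_addC : commutative bop_add.
Proof. by move=> S T; apply: bop_ext => x /=; rewrite addrC. Qed.
Fact bop_add0 : left_id bop0 bop_add.
Proof. by move=> S; apply: bop_ext => x /=; rewrite add0r. Qed.
Fact bop_addN : left_inverse bop0 bop_opp bop_add.
Proof. by move=> S; apply: bop_ext => x /=; rewrite addNr. Qed.

HB.instance Definition _ :=
  GRing.isZmodule.Build (bop H) bop_addA bop_addC bop_add0 bop_addN.

Fact bop_mulA : associative bop_mul.
Proof. by move=> S T U; apply: bop_ext. Qed.
Fact bop_mul1 : left_id bop1 bop_mul.
Proof. by move=> S; apply: bop_ext. Qed.
Fact bop_mulr1 : right_id bop1 bop_mul.
Proof. by move=> S; apply: bop_ext. Qed.
Fact bop_mulDl : left_distributive bop_mul bop_add.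
Proof. by move=> S T U; apply: bop_ext. Qed.
Fact bop_mulDr : right_distributive bop_mul bop_add.
Proof. by move=> S T U; apply: bop_ext => x /=; rewrite linearD. Qed.

HB.instance Definition _ := GRing.Zmodule_isPzRing.Build (bop H)
  bop_mulA bop_mul1 bop_mulr1 bop_mulDl bop_mulDr.

Fact bop_scaleA (a b : R[i]) T :
  bop_scale a (bop_scale b T) = bop_scale (a * b) T.
Proof. by apply: bop_ext => x /=; rewrite scalerA. Qed.
Fact bop_scale1 : left_id 1 bop_scale.
Proof. by move=> T; apply: bop_ext => x /=; rewrite scale1r. Qed.
Fact bop_scaleDr : right_distributive bop_scale +%R.
Proof. by move=> a S T; apply: bop_ext => x /=; rewrite scalerDr. Qed.
Fact bop_scaleDl T : {morph bop_scale^~ T : a b / a + b}.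
Proof. by move=> a b; apply: bop_ext => x /=; rewrite scalerDl. Qed.

HB.instance Definition _ := GRing.Zmodule_isLmodule.Build R[i] (bop H)
  bop_scaleA bop_scale1 bop_scaleDr bop_scaleDl.

Lemma bopD S T x : (S + T) x = S x + T x. Proof. by []. Qed.
Lemma bopN T x : (- T) x = - T x. Proof. by []. Qed.
Lemma bopB S T x : (S - T) x = S x - T x. Proof. by []. Qed.
Lemma bopM S T x : (S * T) x = S (T x). Proof. by []. Qed.
Lemma bopZ a T x : (a *: T) x = a *: T x. Proof. by []. Qed.
Lemma bop1E x : (1 : bop H) x = x. Proof. by []. Qed.
Lemma bop0E x : (0 : bop H) x = 0. Proof. by []. Qed.
Definition bopE := (bopD, bopN, bopM, bopZ, bop1E, bop0E).

Lemma bopX T n x : (T ^+ n) x = iter n T x.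
Proof. by elim: n => [|n IH] //=; rewrite exprS bopM IH. Qed.

Lemma bop_scalerAl (a : R[i]) S T : (a *: S) * T = a *: (S * T).
Proof. exact: bop_ext. Qed.
Lemma bop_scalerAr (a : R[i]) S T : S * (a *: T) = a *: (S * T).
Proof. by apply: bop_ext => x; rewrite !bopE linearZ. Qed.

(** The bound c, uniform in n, passes to the pointwise limit and makes it a bounded operator. *)
Lemma bop_lim (T_ : nat -> bop H) (c : R) :
  (forall n x, nr (T_ n x) <= c * nr x) ->
  (forall x e, 0 < e -> exists N, forall m n, (N <= m)%N -> (N <= n)%N ->
     nr (T_ m x - T_ n x) <= e) ->
  exists T, forall x, cv (fun n => T_ n x) (T x).
Proof.
move=> Tc TC.
have /choice[f fP] : forall x, exists l, cv (fun n => T_ n x) l.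
  by move=> x; apply: cauchy_cv; exact: TC.
have lf : linear f.
  move=> a x y; apply: (cv_unique (fP _)).
  under eq_fun do rewrite linearP.
  by apply: cvD; [apply: cvZ|]; exact: fP.
have bf : bounded_operator f.
  apply: bounded_operatorP lf _; exists `|c| => // x; apply/ler_addgt0Pr => e e0.
  have [N fN] := fP x e e0; have := fN _ (leqnn N).
  have -> : f x = T_ N x - (T_ N x - f x) by rewrite opprB addrC subrK.
  move=> le; rewrite (le_trans (nrD _ _)) // nrN lerD //.
    by rewrite (le_trans (Tc _ _)) // ler_wpM2r ?nr_ge0 ?ler_norm.
  by move: le; rewrite opprB addrCA subrr addr0.
by exists (Bop bf).
Qed.

End BoundedOperatorRing.

Notation "c %:O" := (c%:C *: (1 : bop _)) (at level 2, format "c %:O").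

(** * Uniform approximation by polynomials on an interval *)

Section UniformApproximation.
Context {R : realType}.
Implicit Types (a b e s t : R) (g h : R -> R).

Lemma small_inv (c e : R) : 0 < e -> exists n, c / n.+1%:R <= e.
Proof.
move=> e0; exists (Num.trunc (c / e)); rewrite ler_pdivrMr ?ltr0Sn // mulrC.
by rewrite -ler_pdivrMr // ltW // truncnS_gt.
Qed.

(** Gives powers of 1 - u an explicit decay of order 1/(n u). The induction step is (1 - u)(1 + (n +
    1) u) <= 1 + n u. *)
Lemma bernoulli_inv (u : R) n : 0 <= u <= 1 -> (1 - u) ^+ n * (1 + n%:R * u) <= 1.
Proof.
move=> /andP[u0 u1]; elim: n => [|n IH]; first by rewrite mul1r mul0r addr0.
apply: le_trans IH; rewrite exprSr -mulrA ler_wpM2l ?exprn_ge0 ?subr_ge0 //.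
by rewrite -natr1; have := ler0n R n; nra.
Qed.

(** Takes the place of continuity on [a, b]. The closure properties below reach every function to
    which the calculus is applied: inverses, absolute values, square roots and powers. *)
Definition approximable a b g : Prop := forall e, 0 < e ->
  exists p : {poly R}, forall t, a <= t <= b -> `|p.[t] - g t| <= e.

Lemma apx_eq a b g h : (forall t, a <= t <= b -> g t = h t) ->
  approximable a b g -> approximable a b h.
Proof.
by move=> gh ag e e0; have [p pg] := ag e e0; exists p => t tab; rewrite -gh ?pg.
Qed.

Lemma apx_lim a b g :
  (forall e, 0 < e -> exists2 h, approximable a b h &
     forall t, a <= t <= b -> `|h t - g t| <= e) -> approximable a b g.
Proof.
move=> gh e e0; have e2 : 0 < e / 2 by rewrite divr_gt0.
have [h ah hg] := gh _ e2; have [p ph] := ah _ e2.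
exists p => t tab; rewrite (splitr e) (le_trans (ler_distD (h t) _ _)) //.
by rewrite lerD ?ph ?hg.
Qed.

Lemma apx_poly a b (p : {poly R}) : approximable a b (fun t => p.[t]).
Proof. by move=> e e0; exists p => t _; rewrite subrr normr0 ltW. Qed.

Lemma apx_cst a b c : approximable a b (fun=> c).
Proof. by apply: apx_eq (apx_poly a b c%:P) => t _; rewrite hornerC. Qed.

Lemma apx_id a b : approximable a b id.
Proof. by apply: apx_eq (apx_poly a b 'X) => t _; rewrite hornerX. Qed.

Lemma apxD a b g h : approximable a b g -> approximable a b h -> approximable a b (fun t => g t + h t).
Proof.
move=> ag ah e e0; have e2 : 0 < e / 2 by rewrite divr_gt0.
have [p pg] := ag _ e2; have [q qh] := ah _ e2.
exists (p + q) => t tab; rewrite hornerD opprD addrACA (splitr e).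
by rewrite (le_trans (ler_normD _ _)) // lerD ?pg ?qh.
Qed.

Lemma apx_bounded a b g : approximable a b g ->
  exists2 K, 0 <= K & forall t, a <= t <= b -> `|g t| <= K.
Proof.
move=> ag; have [p pg] := ag 1 ltr01; have [K pK] := poly_itv_bound p a b.
exists (1 + `|K|) => [|t tab]; first by rewrite addr_ge0.
have -> : g t = p.[t] - (p.[t] - g t) by rewrite opprB addrC subrK.
rewrite (le_trans (ler_normB _ _)) // addrC lerD ?pg //.
by rewrite (le_trans (pK _ tab)) // ler_norm.
Qed.

Lemma prod_dist (x y u v d K : R) : 0 <= d -> d <= 1 ->
  `|x - u| <= d -> `|y - v| <= d -> `|u| <= K -> `|v| <= K ->
  `|x * y - u * v| <= d * (2 * K + 1).
Proof.
move=> d0 d1 xu yv uK vK.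
have -> : x * y - u * v = (x - u) * (y - v) + ((x - u) * v + u * (y - v)) by ring.
rewrite (le_trans (ler_normD _ _)) // normrM.
have h1 : `|x - u| * `|y - v| <= d * 1 by rewrite ler_pM // (le_trans yv).
have h2 : `|(x - u) * v| <= d * K by rewrite normrM ler_pM.
have h3 : `|u * (y - v)| <= d * K by rewrite normrM mulrC ler_pM.
have := ler_normD ((x - u) * v) (u * (y - v)); lra.
Qed.

Lemma apxM a b g h : approximable a b g -> approximable a b h -> approximable a b (fun t => g t * h t).
Proof.
move=> ag ah e e0; have [K K0 gK] := apx_bounded ag.
have [L L0 hL] := apx_bounded ah.
have C0 : 0 < 2 * (K + L) + 1 by lra.
pose d := Num.min 1 (e / (2 * (K + L) + 1)).
have d0 : 0 < d by rewrite lt_min ltr01 divr_gt0.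
have [p pg] := ag _ d0; have [q qh] := ah _ d0.
exists (p * q) => t tab; rewrite hornerM.
have gKL : `|g t| <= K + L by rewrite (le_trans (gK _ tab)) // lerDl.
have hKL : `|h t| <= K + L by rewrite (le_trans (hL _ tab)) // lerDr.
have d1 : d <= 1 by rewrite ge_min lexx.
rewrite (le_trans (prod_dist (ltW d0) d1 (pg _ tab) (qh _ tab) gKL hKL)) //.
by rewrite -ler_pdivlMr // ge_min lexx orbT.
Qed.

Lemma apxZ a b g c : approximable a b g -> approximable a b (fun t => c * g t).
Proof. by move=> ag; apply: apxM => //; exact: apx_cst. Qed.

Lemma apxN a b g : approximable a b g -> approximable a b (fun t => - g t).
Proof. by move=> /(apxZ (-1)); apply: apx_eq => t _; rewrite mulN1r. Qed.

Lemma apxB a b g h : approximable a b g -> approximable a b h -> approximable a b (fun t => g t - h t).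
Proof. by move=> ag ah; apply: apxD => //; exact: apxN. Qed.

(* Visser's iteration y <- y + (g - y^2)/2 converges to sqrt g on [0, 1] *)
Lemma apx_sqrt01 a b g : approximable a b g -> (forall t, a <= t <= b -> 0 <= g t <= 1) ->
  approximable a b (fun t => Num.sqrt (g t)).
Proof.
move=> ag g01.
pose y := fix y n t := if n is m.+1 then y m t + (g t - y m t ^+ 2) / 2 else 0.
have ay n : approximable a b (y n).
  elim: n => [|n IH]; first exact: apx_cst.
  apply: (@apx_eq _ _ (fun t => y n t + 2^-1 * (g t - y n t * y n t))) => [t _|].
    by rewrite /= expr2 [2^-1 * _]mulrC.
  by apply: apxD => //; apply: apxZ; apply: apxB => //; apply: apxM.
have yP n t : a <= t <= b -> let s := Num.sqrt (g t) in
    0 <= y n t /\ 0 <= s - y n t <= s * (1 - s / 2) ^+ n.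
  move=> tab s; have /andP[g0 g1] := g01 _ tab.
  have s0 : 0 <= s by exact: sqrtr_ge0.
  have s1 : s <= 1 by rewrite -[1]sqrtr1 ler_sqrt.
  have gE : g t = s ^+ 2 by rewrite sqr_sqrtr.
  elim: n => [|n [y0 /andP[ys IH]]] /=; first by rewrite subr0 expr0 mulr1 lexx s0.
  rewrite gE [_ ^+ n.+1]exprSr mulrA.
  (* The error is multiplied by 1 - (s + y)/2, which lies between 0 and 1 - s/2 because 0 <= y <= s
     <= 1. *)
  have -> : s - (y n t + (s ^+ 2 - y n t ^+ 2) / 2) =
      (s - y n t) * (1 - (s + y n t) / 2) by field.
  move: IH; set w := s * _ => IH; clearbody w; split; first by nra.
  apply/andP; split; first by apply: mulr_ge0 => //; lra.
  by apply: ler_pM => //; lra.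
(* Bernoulli with u = s/2 gives s (1 - s/2)^(n+1) <= 2/(n+1): the factor s makes up for the slow
   contraction near s = 0, so the rate is uniform. *)
apply: apx_lim => e e0; have [n ne] := small_inv 2 e0.
exists (y n.+1) => // t tab; have [_ /andP[h1 h2]] := yP n.+1 _ tab.
rewrite distrC ger0_norm // (le_trans h2) // (le_trans _ ne) //.
rewrite ler_pdivlMr ?ltr0Sn //.
have /andP[g0 g1] := g01 _ tab.
have s0 : 0 <= Num.sqrt (g t) by exact: sqrtr_ge0.
have s1 : Num.sqrt (g t) <= 1 by rewrite -[1]sqrtr1 ler_sqrt.
have u01 : 0 <= Num.sqrt (g t) / 2 <= 1 by apply/andP; split; lra.
have := bernoulli_inv n.+1 u01.
have : 0 <= (1 - Num.sqrt (g t) / 2) ^+ n.+1 by rewrite exprn_ge0 //; lra.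
move: (_ ^+ _) => w w0; nra.
Qed.

Lemma apx_sqrt a b g : approximable a b g -> (forall t, a <= t <= b -> 0 <= g t) ->
  approximable a b (fun t => Num.sqrt (g t)).
Proof.
move=> ag g0; have [K K0 gK] := apx_bounded ag.
have K1 : 0 < K + 1 by rewrite ltr_wpDl.
have h : approximable a b (fun t => Num.sqrt ((K + 1)^-1 * g t)).
  apply: apx_sqrt01 => [|t tab]; first exact: apxZ.
  rewrite mulr_ge0 ?invr_ge0 ?g0 ?(ltW K1) //= mulrC ler_pdivrMr // mul1r.
  by have := gK _ tab; rewrite ger0_norm ?g0 // => /le_trans; apply; rewrite lerDl.
apply: apx_eq (apxZ (Num.sqrt (K + 1)) h) => t tab.
by rewrite -sqrtrM ?(ltW K1) // mulrA divff ?mul1r // gt_eqF.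
Qed.

Lemma apx_abs a b g : approximable a b g -> approximable a b (fun t => `|g t|).
Proof.
move=> ag; apply: (@apx_eq _ _ (fun t => Num.sqrt (g t * g t))) => [t _|].
  by rewrite -expr2 sqrtr_sqr.
by apply: apx_sqrt => [|t _]; [exact: apxM|rewrite -expr2 sqr_ge0].
Qed.

(** The partial sums of the Neumann series, y <- 1/L + (1 - g/L) y with L >= g, miss 1/g by (1 -
    g/L)^n / g; Bernoulli with g/L >= d/L makes this uniformly small. *)
Lemma apx_inv a b g d : 0 < d -> approximable a b g -> (forall t, a <= t <= b -> d <= g t) ->
  approximable a b (fun t => (g t)^-1).
Proof.
move=> d0 ag dg; have [K K0 gK] := apx_bounded ag.
have L0 : 0 < K + d by rewrite ltr_wpDl.
pose L := K + d; have L0' : 0 < L by [].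
pose y := fix y n t := if n is m.+1 then L^-1 + (1 - L^-1 * g t) * y m t else 0.
have ay n : approximable a b (y n).
  elim: n => [|n IH]; first exact: apx_cst.
  apply: apxD; first exact: apx_cst.
  by apply: apxM => //; apply: apxB; [exact: apx_cst|exact: apxZ].
have yP n t : a <= t <= b -> (g t)^-1 - y n t = (1 - g t / L) ^+ n / g t.
  move=> tab; have g0 := lt_le_trans d0 (dg _ tab).
  elim: n => [|n IH] /=; first by rewrite subr0 mul1r.
  have -> : y n t = (g t)^-1 - (1 - g t / L) ^+ n / g t by rewrite -IH; ring.
  by rewrite exprS; field; rewrite !gt_eqF.
apply: apx_lim => e e0; have [n ne] := small_inv (L / d / d) e0.
exists (y n.+1) => // t tab; have g0 := lt_le_trans d0 (dg _ tab).
have gL : g t <= L.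
  have := gK _ tab; rewrite ger0_norm ?(ltW g0) // => /le_trans; apply.
  by rewrite lerDl ltW.
have u01 : 0 <= g t / L <= 1.
  by rewrite divr_ge0 ?(ltW g0) ?(ltW L0) //= ler_pdivrMr ?mul1r.
have := bernoulli_inv n.+1 u01; have : 0 <= (1 - g t / L) ^+ n.+1.
  by rewrite exprn_ge0 // subr_ge0; case/andP: u01.
rewrite distrC yP //; move: (_ ^+ _) => w w0 wP.
rewrite ger0_norm ?divr_ge0 ?(ltW g0) // (le_trans _ ne) //.
have du : d / L <= g t / L by rewrite ler_pM2r ?invr_gt0 // dg.
have wd : w * (n.+1%:R * (d / L)) <= 1.
  apply: le_trans wP; apply: ler_wpM2l => //.
  have : n.+1%:R * (d / L) <= n.+1%:R * (g t / L) by rewrite ler_wpM2l.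
  lra.
have {}wd : w <= L / d / n.+1%:R.
  rewrite ler_pdivlMr ?ltr0Sn // ler_pdivlMr // -[leRHS]mul1r -ler_pdivrMr //.
  by apply: le_trans wd; rewrite le_eqVlt -!mulrA eqxx.
rewrite [leRHS]mulrAC; apply: ler_pM => //; first by rewrite invr_ge0 ltW.
by rewrite lef_pV2 ?posrE // dg.
Qed.

(* Bisection: every s is a limit of points reached from 0 and 1 by midpoints. *)
Lemma midpoint_ind (Q : R -> Prop) : Q 0 -> Q 1 ->
  (forall u v, 0 <= u <= 1 -> 0 <= v <= 1 -> Q u -> Q v -> Q ((u + v) / 2)) ->
  (forall s, 0 <= s <= 1 ->
     (forall e, 0 < e -> exists u, [/\ 0 <= u <= 1, `|u - s| <= e & Q u]) -> Q s) ->
  forall s, 0 <= s <= 1 -> Q s.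
Proof.
move=> Q0 Q1 Qm Qc s s01; apply: Qc => // e e0.
(* The invariant (v - u)(n + 1) <= 1 is weaker than halving at each step but matches [small_inv]
   directly. *)
have bis n : exists u v, [/\ 0 <= u <= 1, 0 <= v <= 1, u <= s <= v,
    (v - u) * n.+1%:R <= 1 & Q u /\ Q v].
  elim: n => [|n [u [v [u01 v01 /andP[us sv] uv [Qu Qv]]]]].
    by exists 0, 1; split; rewrite ?ler01 ?lexx //; lra.
  have m01 : 0 <= (u + v) / 2 <= 1.
    by move: u01 v01 => /andP[? ?] /andP[? ?]; apply/andP; split; lra.
  have half : (v - u) / 2 * n.+2%:R <= 1.
    have : (v - u) * n.+2%:R <= 2 * ((v - u) * n.+1%:R).
      rewrite mulrCA ler_wpM2l ?subr_ge0 ?(le_trans us) //.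
      by rewrite -natrM ler_nat mul2n -addnn addSn ltnS leq_addl.
    move=> h; have -> : (v - u) / 2 * n.+2%:R = ((v - u) * n.+2%:R) / 2 by field.
    lra.
  have [sm|ms] := leP s ((u + v) / 2).
    exists u, ((u + v) / 2); split; rewrite ?us //; last by split=> //; apply: Qm.
    by apply: le_trans half; rewrite ler_wpM2r // ; lra.
  exists ((u + v) / 2), v; split; rewrite ?sv ?(ltW ms) //.
    by apply: le_trans half; rewrite ler_wpM2r //; lra.
  by split=> //; apply: Qm.
have [n ne] := small_inv 1 e0; have [u [v [u01 v01 /andP[us sv] uv [Qu Qv]]]] := bis n.
exists u; split=> //; rewrite distrC ger0_norm ?subr_ge0 //.
apply: le_trans ne; rewrite ler_pdivlMr ?ltr0Sn //; apply: le_trans uv.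
by rewrite ler_wpM2r // lerB.
Qed.

Lemma expR_dist1 (y : R) : `|y| <= 2^-1 -> `|expR y - 1| <= 2 * `|y|.
Proof.
move=> y2; have h1 := expR_ge1Dx y; have h2 := expR_ge1Dx (- `|y|).
have h3 : expR y <= expR `|y| by rewrite ler_expR ler_norm.
have h4 : expR `|y| * expR (- `|y|) = 1 by rewrite -expRD subrr expR0.
have h5 := expR_gt0 `|y|; have h6 := normr_ge0 y; have h7 := ler_norm (- y).
have h8 : expR `|y| <= 1 + 2 * `|y| by rewrite normrN in h7; nra.
by rewrite normrN in h7; rewrite ler_norml; apply/andP; split; lra.
Qed.

Lemma powR_exponent_continuous a b s e : 0 < a -> 0 <= s <= 1 -> 0 < e ->
  exists2 d, 0 < d & forall u t, `|u - s| <= d -> a <= t <= b ->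
    `|t `^ u - t `^ s| <= e.
Proof.
move=> a0 /andP[s0 s1] e0; pose L := `|ln a| + `|ln b| + 1.
have L0 : 0 < L by rewrite /L ltr_wpDl // addr_ge0.
have E0 := expR_gt0 L.
pose d := Num.min (2^-1 / L) (e / (2 * L * expR L)).
have d0 : 0 < d by rewrite lt_min !divr_gt0 // !mulr_gt0.
exists d => // u t us /andP[at' tb].
have t0 := lt_le_trans a0 at'; have b0 := lt_le_trans t0 tb.
have tL : `|ln t| <= L.
  have l1 : ln a <= ln t by rewrite ler_ln ?posrE.
  have l2 : ln t <= ln b by rewrite ler_ln ?posrE.
  have := ler_norm (ln b); have := ler_norm (- ln a); rewrite normrN /L ler_norml.
  have := normr_ge0 (ln a); have := normr_ge0 (ln b).
  by move=> *; apply/andP; split; lra.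
have -> : t `^ u - t `^ s = t `^ s * (expR ((u - s) * ln t) - 1).
  have us' : s + (u - s) = u by ring.
  by rewrite /powR gt_eqF // mulrBr mulr1 -expRD -mulrDl us'.
rewrite normrM ger0_norm ?powR_ge0 //.
have h1 : t `^ s <= expR L.
  rewrite /powR gt_eqF // ler_expR (le_trans (ler_norm _)) // normrM.
  by rewrite ger0_norm // -[leRHS]mul1r ler_pM.
have h2 : `|(u - s) * ln t| <= d * L by rewrite normrM ler_pM.
have dL : d * L <= 2^-1 by rewrite -ler_pdivlMr // ge_min lexx.
have h3 := expR_dist1 (le_trans h2 dL).
have h4 : d * (2 * L * expR L) <= e by rewrite -ler_pdivlMr ?mulr_gt0 // ge_min lexx orbT.
apply: le_trans h4; rewrite mulrC; apply: (@le_trans _ _ (2 * (d * L) * expR L)).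
  by apply: ler_pM => //; [exact: powR_ge0|lra].
by rewrite le_eqVlt; apply/orP; left; apply/eqP; ring.
Qed.

Lemma powR_midpoint t u v : 0 < t ->
  t `^ ((u + v) / 2) * t `^ ((u + v) / 2) = t `^ u * t `^ v.
Proof.
move=> t0; have tD x y : t `^ (x + y) = t `^ x * t `^ y.
  by rewrite powRD // (gt_eqF t0) implybT.
by rewrite -!tD -splitr.
Qed.

(** Exponents 0 and 1 are polynomial, t^((u+v)/2) is the square root of t^u t^v, and t^s is a
    uniform limit in the exponent: exactly the cases of [midpoint_ind]. *)
Lemma apx_powR a b s : 0 < a -> 0 <= s <= 1 -> approximable a b (fun t => t `^ s).
Proof.
move=> a0; move: s; apply: midpoint_ind.
- by apply: apx_eq (apx_cst a b 1) => t _; rewrite powRr0.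
- apply: apx_eq (apx_id a b) => t /andP[at' _].
  by rewrite powRr1 // ltW // (lt_le_trans a0).
- move=> u v u01 v01 au av.
  have h := apx_sqrt (apxM au av) (fun t _ => mulr_ge0 (powR_ge0 t u) (powR_ge0 t v)).
  apply: apx_eq h => t /andP[at' _].
  rewrite -powR_midpoint ?(lt_le_trans a0) // -expr2 sqrtr_sqr ger0_norm //.
  exact: powR_ge0.
- move=> s s01 h; apply: apx_lim => e e0.
  have [d d0 dP] := powR_exponent_continuous b a0 s01 e0.
  by have [u [u01 us au]] := h d d0; exists (fun t => t `^ u) => // t; exact: dP.
Qed.

End UniformApproximation.

(** * Order and self-adjointness *)

Section Hilbert.
Context {R : realType} {H : completeNormedModType R[i]}.
Context (ip : {dot H for Num.conj}) (ip_norm : induces_norm ip).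
Implicit Types (x y z : H) (S T U : bop H).

(** A real inner product with the same norm, which keeps order estimates inside R. Imaginary parts
    are recovered by multiplying an argument by i. *)
Definition rip x y : R := complex.Re (ip x y).

Lemma ReD (a b : R[i]) : complex.Re (a + b) = complex.Re a + complex.Re b.
Proof. by case: a; case: b. Qed.

Lemma ReM_real (a : R) (b : R[i]) : complex.Re (a%:C * b) = a * complex.Re b.
Proof. by case: b => c d /=; rewrite mul0r subr0. Qed.

Lemma ripDl x y z : rip (x + y) z = rip x z + rip y z.
Proof. by rewrite /rip linearDl ReD. Qed.

Lemma ripZl (a : R) x y : rip (a%:C *: x) y = a * rip x y.
Proof. by rewrite /rip linearZl_LR ReM_real. Qed.

Lemma ipC x y : ip x y = (ip y x)^*%C.
Proof. by rewrite hermC expr0 mul1r. Qed.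

Lemma ripC x y : rip x y = rip y x.
Proof. by rewrite /rip ipC; case: (ip y x). Qed.

Lemma ripDr x y z : rip x (y + z) = rip x y + rip x z.
Proof. by rewrite ripC ripDl !(ripC x). Qed.

Lemma ripZr (a : R) x y : rip x (a%:C *: y) = a * rip x y.
Proof. by rewrite ripC ripZl ripC. Qed.

Lemma ripNl x y : rip (- x) y = - rip x y.
Proof. by rewrite -scaleN1r -(rmorphN1 (real_complex R)) ripZl mulN1r. Qed.

Lemma ripNr x y : rip x (- y) = - rip x y.
Proof. by rewrite ripC ripNl ripC. Qed.

Lemma ripBl x y z : rip (x - y) z = rip x z - rip y z.
Proof. by rewrite ripDl ripNl. Qed.

Lemma ripBr x y z : rip x (y - z) = rip x y - rip x z.
Proof. by rewrite ripDr ripNr. Qed.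

Lemma rip0l x : rip 0 x = 0.
Proof. by rewrite -(subrr x) ripBl subrr. Qed.

Lemma rip0r x : rip x 0 = 0.
Proof. by rewrite ripC rip0l. Qed.

Lemma rip_iZl x y : rip ('i%C *: x) y = - complex.Im (ip x y).
Proof. by rewrite /rip linearZl_LR /= mulrC ReiNIm. Qed.

Lemma rip_iZr x y : rip x ('i%C *: y) = complex.Im (ip x y).
Proof. by rewrite ripC rip_iZl [ip y x]ipC; case: (ip x y) => a b /=; rewrite opprK. Qed.

Lemma ripxx x : rip x x = nr x ^+ 2.
Proof. by apply: complexI; rewrite rmorphXn /= -nrE ip_norm /rip RRe_real // realE -ip_norm exprn_ge0. Qed.

Definition ripE := (ripDl, ripDr, ripBl, ripBr, ripNl, ripNr, ripZl, ripZr).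

Lemma CauchySchwarz x y : rip x y <= nr x * nr y.
Proof.
have [->|y0] := eqVneq y 0; first by rewrite rip0r nr0 mulr0.
have [->|x0] := eqVneq x 0; first by rewrite rip0l nr0 mul0r.
rewrite -!nr_gt0 in x0 y0.
have : 0 <= rip ((nr y)%:C *: x - (nr x)%:C *: y) ((nr y)%:C *: x - (nr x)%:C *: y).
  by rewrite ripxx sqr_ge0.
rewrite !ripE (ripC y x) !ripxx => h.
have {}h : rip x y * (nr x * nr y) <= (nr x * nr y) * (nr x * nr y).
  by rewrite -subr_ge0 -(pmulr_lge0 _ (ltr0Sn R 1)); apply: le_trans h _; rewrite le_eqVlt; apply/orP; left; apply/eqP; ring.
by rewrite ler_pM2r ?mulr_gt0 in h.
Qed.

(** As T is complex linear, symmetry for the real part, applied also at i x, gives symmetry for [ip]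
    itself. *)
Definition selfadj T : Prop := forall x y, rip (T x) y = rip x (T y).

Definition psd T : Prop := selfadj T /\ forall x, 0 <= rip (T x) x.

Definition ole S T : Prop := psd (T - S).

Lemma saD S T : selfadj S -> selfadj T -> selfadj (S + T).
Proof. by move=> sS sT x y; rewrite !bopE !ripE sS sT. Qed.

Lemma saN T : selfadj T -> selfadj (- T).
Proof. by move=> sT x y; rewrite !bopE !ripE sT. Qed.

Lemma saB S T : selfadj S -> selfadj T -> selfadj (S - T).
Proof. by move=> sS sT; apply: saD => //; apply: saN. Qed.

Lemma saZ (a : R) T : selfadj T -> selfadj (a%:C *: T).
Proof. by move=> sT x y; rewrite !bopE !ripE sT. Qed.

Lemma sa1 : selfadj 1. Proof. by []. Qed.

Lemma sa0 : selfadj 0. Proof. by move=> x y; rewrite !bopE rip0l rip0r. Qed.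

Lemma saO (a : R) : selfadj (a%:O). Proof. exact/saZ/sa1. Qed.

Lemma saM S T : selfadj S -> selfadj T -> S * T = T * S -> selfadj (S * T).
Proof. by move=> sS sT cST x y; rewrite bopE sS sT -bopM cST. Qed.

Lemma saJ S T : selfadj S -> selfadj T -> selfadj (S * T * S).
Proof. by move=> sS sT x y; rewrite !bopE sS sT sS. Qed.

Lemma saX T n : selfadj T -> selfadj (T ^+ n).
Proof.
move=> sT; elim: n => [|n IH]; first exact: sa1.
by rewrite exprS; apply: saM => //; rewrite -exprSr exprS.
Qed.

Lemma saS T : selfadj T -> selfadj (T * T). Proof. by move=> sT; apply: saM. Qed.

Lemma psdD S T : psd S -> psd T -> psd (S + T).
Proof.
move=> [sS pS] [sT pT]; split; first exact: saD.
by move=> x; rewrite bopE ripDl addr_ge0.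
Qed.

Lemma psdZ (a : R) T : 0 <= a -> psd T -> psd (a%:C *: T).
Proof.
move=> a0 [sT pT]; split; first exact: saZ.
by move=> x; rewrite bopE ripZl mulr_ge0.
Qed.

Lemma psdO (a : R) : 0 <= a -> psd a%:O.
Proof. by move=> a0; apply: psdZ => //; split=> // x; rewrite bopE ripxx sqr_ge0. Qed.

Lemma psd1 : psd 1. Proof. by split=> // x; rewrite bopE ripxx sqr_ge0. Qed.

Lemma psd0 : psd 0. Proof. by split=> [|x]; [exact: sa0|rewrite bopE rip0l]. Qed.

Lemma psdJ S T : selfadj S -> psd T -> psd (S * T * S).
Proof. by move=> sS [sT pT]; split=> [|x]; [exact: saJ|rewrite !bopE sS]. Qed.

Lemma psdS T : selfadj T -> psd (T * T).
Proof. by move=> sT; have := psdJ sT psd1; rewrite mulr1. Qed.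

Lemma oleP S T : selfadj S -> selfadj T ->
  ole S T <-> forall x, rip (S x) x <= rip (T x) x.
Proof.
move=> sS sT; split=> [[_ h] x|h]; first by have := h x; rewrite !bopE ripBl subr_ge0.
by split=> [|x]; [exact: saB|rewrite !bopE ripBl subr_ge0].
Qed.

Lemma ole_rip S T : ole S T -> forall x, rip (S x) x <= rip (T x) x.
Proof. by move=> [_ h] x; have := h x; rewrite !bopE ripBl subr_ge0. Qed.

Lemma ole_refl T : ole T T. Proof. by rewrite /ole subrr; exact: psd0. Qed.

Lemma ole_trans S T U : ole S T -> ole T U -> ole S U.
Proof. by move=> st tu; have := psdD st tu; rewrite /ole addrC subrKA. Qed.

Lemma oleD S T S' T' : ole S T -> ole S' T' -> ole (S + S') (T + T').
Proof. by move=> st st'; have := psdD st st'; rewrite /ole opprD addrACA. Qed.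

Lemma oleN S T : ole S T -> ole (- T) (- S).
Proof. by rewrite /ole opprK addrC. Qed.

Lemma oleZ (a : R) S T : 0 <= a -> ole S T -> ole (a%:C *: S) (a%:C *: T).
Proof. by move=> a0; rewrite /ole -scalerBr; exact: psdZ. Qed.

Lemma oleZ2 (a b : R) T : a <= b -> psd T -> ole (a%:C *: T) (b%:C *: T).
Proof. by move=> ab pT; rewrite /ole -scalerBl -rmorphB; apply: psdZ => //; rewrite subr_ge0. Qed.

Lemma oleO (a b : R) : a <= b -> ole a%:O b%:O.
Proof. by move=> ab; apply: oleZ2 => //; exact: psd1. Qed.

Lemma oleJ S T U : selfadj U -> ole S T -> ole (U * S * U) (U * T * U).
Proof. by move=> sU; rewrite /ole -mulrBl -mulrBr; exact: psdJ. Qed.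

Lemma ole0 T : ole 0 T <-> psd T. Proof. by rewrite /ole subr0. Qed.

Lemma ole_psd S T : psd S -> ole S T -> psd T.
Proof. by move=> pS h; have := psdD pS h; rewrite addrC subrK. Qed.

Lemma oleO_sa a T : ole a%:O T -> selfadj T.
Proof. by move=> [h _]; have := saD h (saO a); rewrite subrK. Qed.

Lemma psd_CauchySchwarz T x y : psd T ->
  rip (T x) y ^+ 2 <= rip (T x) x * rip (T y) y.
Proof.
move=> [sT pT].
have h (s : R) : 0 <= rip (T x) x * s ^+ 2 + 2 * rip (T x) y * s + rip (T y) y.
  have := pT (s%:C *: x + y); rewrite linearD linearZ /= !ripE (sT y x) (ripC y).
  by move=> /le_trans; apply; rewrite le_eqVlt; apply/orP; left; apply/eqP; ring.
have := pT x; rewrite le_eqVlt => /orP[/eqP x0|x0].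
  rewrite -x0 mul0r; have [->|b0] := eqVneq (rip (T x) y) 0; first by rewrite expr0n.
  (* With leading coefficient 0 the nonnegative quadratic is affine, and at this s it would take the
     value -1. *)
  have := h (- (rip (T y) y + 1) / (2 * rip (T x) y)); rewrite -x0 mul0r add0r.
  by rewrite mulrC divfK ?mulf_neq0 // opprD addrAC addNr sub0r oppr_ge0 ler10.
have := h (- rip (T x) y / rip (T x) x).
have -> : rip (T x) x * (- rip (T x) y / rip (T x) x) ^+ 2 +
    2 * rip (T x) y * (- rip (T x) y / rip (T x) x) + rip (T y) y =
    (rip (T x) x * rip (T y) y - rip (T x) y ^+ 2) / rip (T x) x.
  by field; rewrite gt_eqF.
by rewrite pmulr_lge0 ?invr_gt0 // subr_ge0.
Qed.

(** Cauchy-Schwarz for the form of T at x and T x. It turns smallness of the form into smallness of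
    the vector T x. *)
Lemma psd_nr T (c : R) : psd T -> (forall x, nr (T x) <= c * nr x) ->
  forall x, nr (T x) ^+ 2 <= c * rip (T x) x.
Proof.
move=> pT Tc x; have [Tx0|Tx0] := eqVneq (T x) 0.
  by rewrite Tx0 nr0 rip0l mulr0 expr0n.
rewrite -nr_gt0 in Tx0.
have := psd_CauchySchwarz x (T x) pT; rewrite ripxx => h.
have h2 : rip (T (T x)) (T x) <= c * nr (T x) ^+ 2.
  by rewrite (le_trans (CauchySchwarz _ _)) // expr2 mulrA ler_wpM2r ?nr_ge0.
have : nr (T x) ^+ 2 * nr (T x) ^+ 2 <= (c * rip (T x) x) * nr (T x) ^+ 2.
  rewrite -expr2 (le_trans h) // [c * _]mulrC -mulrA ler_wpM2l //.
  by case: pT.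
by rewrite ler_pM2r // exprn_gt0.
Qed.

Lemma psd_eq0 T : psd T -> (forall x, rip (T x) x = 0) -> T = 0.
Proof.
move=> pT T0; apply: bop_ext => x; apply/eqP; rewrite -nr_eq0 -sqrf_eq0.
have [c c0 Tc] := bop_bound T; rewrite eq_le sqr_ge0 andbT.
by rewrite (le_trans (psd_nr pT Tc x)) // T0 mulr0.
Qed.

Lemma ole_antisym S T : ole S T -> ole T S -> S = T.
Proof.
move=> st ts; apply/esym/eqP; rewrite -subr_eq0; apply/eqP/(psd_eq0 st) => x.
by apply/eqP; rewrite eq_le (proj2 st) !bopE ripBl subr_le0 (ole_rip ts).
Qed.

(** The norm of a self-adjoint operator is controlled by its form. Polarization at x and the
    multiple y of T x with |y| = |x| gives 4 |x| |T x|, and the parallelogram law bounds it by 4 c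
    |x|^2. *)
Lemma ole_nr T (c : R) : ole (- c)%:O T -> ole T c%:O ->
  forall x, nr (T x) <= c * nr x.
Proof.
move=> h1 h2 x; have sT : selfadj T := oleO_sa h1.
have q y : `|rip (T y) y| <= c * nr y ^+ 2.
  rewrite ler_norml -mulNr.
  have := ole_rip h1 y; have := ole_rip h2 y.
  by rewrite !bopE !ripZl !ripxx => -> ->.
have [->|x0] := eqVneq x 0; first by rewrite linear0 nr0 mulr0.
rewrite -nr_gt0 in x0.
have c0 : 0 <= c.
  by have := le_trans (normr_ge0 _) (q x); rewrite pmulr_lge0 // exprn_gt0.
have [->|Tx0] := eqVneq (T x) 0; first by rewrite nr0 mulr_ge0 // ltW.
rewrite -nr_gt0 in Tx0.
pose y := (nr x / nr (T x))%:C *: T x.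
have ny : nr y = nr x.
  by rewrite nrZr ger0_norm ?divr_ge0 ?nr_ge0 // divfK // gt_eqF.
have Txy : rip (T x) y = nr x * nr (T x).
  by rewrite ripZr ripxx expr2 mulrA divfK // gt_eqF.
have Tyx : rip (T y) x = rip (T x) y by rewrite sT ripC.
clearbody y.
have /ler_normlW h3 := q (x + y).
have := q (x - y); rewrite ler_norml => /andP[h4 _].
have := lerB h3 h4.
have -> : rip (T (x + y)) (x + y) - rip (T (x - y)) (x - y) = 4 * (nr x * nr (T x)).
  by rewrite linearD linearB !ripE Tyx Txy; ring.
rewrite opprK -mulrDr -!ripxx !ripE !ripxx (ripC y x) ny => h5.
have {}h5 : nr x * nr (T x) <= nr x * (c * nr x).
  have h6 : 0 < 4 :> R by [].
  rewrite -(ler_pM2l h6) (le_trans h5) // le_eqVlt; apply/orP; left; apply/eqP.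
  by ring.
by rewrite ler_pM2l in h5.
Qed.

Lemma nr_ole T (c : R) : selfadj T -> (forall x, nr (T x) <= c * nr x) ->
  ole (- c)%:O T /\ ole T c%:O.
Proof.
move=> sT Tc.
have h x : rip (T x) x <= c * nr x ^+ 2.
  by rewrite (le_trans (CauchySchwarz _ _)) // expr2 mulrA ler_wpM2r ?nr_ge0.
have h2 x : - (c * nr x ^+ 2) <= rip (T x) x.
  rewrite lerNl -ripNl (le_trans (CauchySchwarz _ _)) // nrN.
  by rewrite expr2 mulrA ler_wpM2r ?nr_ge0.
split; (apply/oleP => // [|x]; [exact: saO|]);
  by rewrite !bopE ripZl ripxx // mulNr.
Qed.

(** Failure of this bound for T - z says that z is an approximate eigenvalue, the form in which
    spectral values are produced below. *)
Definition bounded_below T : Prop := exists2 c : R, 0 < c & forall x, c * nr x <= nr (T x).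

Lemma bbM S T : bounded_below S -> bounded_below T -> bounded_below (S * T).
Proof.
move=> [c c0 Sc] [d d0 Td]; exists (c * d) => [|x]; first exact: mulr_gt0.
by rewrite -mulrA (le_trans _ (Sc _)) // ler_pM2l.
Qed.

(** By [psd_nr], c^2 |x|^2 <= |T x|^2 <= (d + 1) <T x, x>. *)
Lemma psd_bb T : psd T -> bounded_below T -> exists2 c : R, 0 < c & ole c%:O T.
Proof.
move=> pT [c c0 Tc]; have [d d0 Td] := bop_bound T.
have d1 : 0 < d + 1 by rewrite ltr_wpDl.
have Td1 x : nr (T x) <= (d + 1) * nr x.
  by rewrite (le_trans (Td x)) // ler_wpM2r ?nr_ge0 // lerDl.
exists (c ^+ 2 / (d + 1)) => [|]; first by rewrite divr_gt0 ?exprn_gt0.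
apply/oleP => [||x]; [exact: saO|by case: pT|].
rewrite bopE ripZl ripxx mulrAC ler_pdivrMr // [leRHS]mulrC.
apply: le_trans (psd_nr pT Td1 x); rewrite -exprMn ler_sqr ?nnegrE ?nr_ge0 //.
by rewrite mulr_ge0 ?nr_ge0 // ltW.
Qed.

Lemma oleO_bb T (c : R) : 0 < c -> ole c%:O T -> bounded_below T.
Proof.
move=> c0 cT; exists c => // x; have [->|x0] := eqVneq x 0.
  by rewrite linear0 nr0 mulr0.
rewrite -nr_gt0 in x0; rewrite -(ler_pM2r x0) -mulrA -expr2.
have := ole_rip cT x; rewrite !bopE ripZl ripxx => /le_trans; apply.
exact: CauchySchwarz.
Qed.

Context (H_neq0 : exists x : H, x != 0).

Lemma oleO_le (a b : R) : ole a%:O b%:O -> a <= b.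
Proof.
move=> ab; have [x x0] := H_neq0; have := ole_rip ab x.
by rewrite !bopE !ripZl ripxx ler_pM2r // exprn_gt0 // nr_gt0.
Qed.

(** Take for l the supremum of all scalars below T. If T - l were bounded below, [psd_bb] would give
    T - l >= e > 0 and l could be raised. *)
Lemma sa_lower_bound T : selfadj T ->
  exists l : R, ole l%:O T /\ ~ bounded_below (T - l%:O).
Proof.
move=> sT; pose A := [set c : R | ole c%:O T].
have [c c0 Tc] := bop_bound T; have [h1 h2] := nr_ole sT Tc.
have A0 : A !=set0 by exists (- c).
have Ac : ubound A c by move=> d dT; exact: oleO_le (ole_trans dT h2).
have hA : has_sup A by split => //; exists c.
exists (sup A).
have lT : ole (sup A)%:O T.
  apply/oleP => // [|x]; first exact: saO.
  rewrite bopE ripZl ripxx; have [->|x0] := eqVneq x 0.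
    by rewrite nr0 expr0n /= mulr0 linear0 rip0l.
  have nx : 0 < nr x ^+ 2 by rewrite exprn_gt0 // nr_gt0.
  rewrite -ler_pdivlMr // ge_sup // => d dT; rewrite ler_pdivlMr //.
  by have := ole_rip dT x; rewrite bopE ripZl ripxx.
split=> // /psd_bb[|e e0 he]; first exact: lT.
have : A (e + sup A).
  rewrite /A /= rmorphD scalerDl; have := oleD he (ole_refl (sup A)%:O).
  by rewrite subrK.
move=> /(ub_le_sup (ex_intro _ c Ac)); rewrite gerDr leNgt e0 //.
Qed.

(** * Polynomials of an operator *)

Definition chorner (p : {poly R[i]}) T : bop H := \sum_(i < size p) p`_i *: T ^+ i.

Lemma chorner_widen (p : {poly R[i]}) T n : (size p <= n)%N ->
  chorner p T = \sum_(i < n) p`_i *: T ^+ i.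
Proof.
move=> pn; rewrite /chorner (big_ord_widen n (fun i => p`_i *: T ^+ i)) //.
rewrite big_mkcond /=; apply: eq_bigr => i _; case: ltnP => // ip'.
by rewrite nth_default // scale0r.
Qed.

Lemma chornerD p q T : chorner (p + q) T = chorner p T + chorner q T.
Proof.
pose n := maxn (size p) (size q).
rewrite (@chorner_widen p T n) ?leq_maxl // (@chorner_widen q T n) ?leq_maxr //.
rewrite (@chorner_widen _ T n) ?size_polyD // -big_split /=.
by apply: eq_bigr => i _; rewrite coefD scalerDl.
Qed.

Lemma chornerZ a p T : chorner (a *: p) T = a *: chorner p T.
Proof.
rewrite (@chorner_widen _ T (size p)) ?size_scale_leq // scaler_sumr.
by apply: eq_bigr => i _; rewrite coefZ scalerA.
Qed.

Lemma chornerB p q T : chorner (p - q) T = chorner p T - chorner q T.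
Proof. by rewrite chornerD -scaleN1r chornerZ scaleN1r. Qed.

Lemma chornerC a T : chorner a%:P T = a *: (1 : bop H).
Proof. by rewrite (@chorner_widen _ _ 1) ?size_polyC ?leq_b1 // big_ord1 coefC. Qed.

Lemma pev0 T : chorner 0 T = 0.
Proof. by rewrite /chorner size_poly0 big_ord0. Qed.

Lemma chornerMX p T : chorner (p * 'X) T = chorner p T * T.
Proof.
rewrite (@chorner_widen _ T (size p).+1); last first.
  by have [->|p0] := eqVneq p 0; rewrite ?mul0r ?size_poly0 // size_mulX.
rewrite big_ord_recl coefMX /= scale0r add0r /chorner mulr_suml.
by apply: eq_bigr => i _; rewrite coefMX /= exprSr bop_scalerAl.
Qed.

Lemma chornerM p q T : chorner (p * q) T = chorner p T * chorner q T.
Proof.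
elim/poly_ind: q => [|q c IH]; first by rewrite mulr0 pev0 mulr0.
rewrite mulrDr mulrA [p * c%:P]mulrC mul_polyC !chornerD !chornerMX chornerZ chornerC IH.
by rewrite mulrDr mulrA bop_scalerAr mulr1.
Qed.

Lemma chornerX T : chorner 'X T = T.
Proof. by rewrite -[X in chorner X]mul1r chornerMX chornerC scale1r mul1r. Qed.

(** Half of the spectral mapping theorem: over R[i] q splits into linear factors, and a product of
    operators bounded below is bounded below, so some factor T - z is not. *)
Lemma chorner_root_nbb (q : {poly R[i]}) T : q != 0 -> ~ bounded_below (chorner q T) ->
  exists z : R[i], root q z /\ ~ bounded_below (T - z *: (1 : bop H)).
Proof.
move=> q0; have [r qE] := closed_field_poly_normal q.
rewrite qE chornerZ => nq; apply: contrapT => nz; apply: nq.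
have lq : lead_coef q != 0 by rewrite lead_coef_eq0.
have : bounded_below (chorner (\prod_(z <- r) ('X - z%:P)) T).
  have : forall z : R[i], z \in r -> bounded_below (T - z *: (1 : bop H)).
    move=> z zr; apply: contrapT => nb; apply: nz; exists z; split=> //.
    by rewrite qE rootE hornerZ mulf_eq0 -rootE root_prod_XsubC zr orbT.
  elim: r {qE nz} => [|z r IH] rb.
    by rewrite big_nil chornerC scale1r; exists 1 => // x; rewrite mul1r.
  rewrite big_cons chornerM; apply: bbM.
    by rewrite chornerB chornerX chornerC; apply: rb; rewrite mem_head.
  by apply: IH => t tr; apply: rb; rewrite inE tr orbT.
move=> [c c0 Tc].
have l0 : 0 < complex.Re `|lead_coef q|.
  by rewrite -(ltcR 0) RRe_real ?normr_gt0 // realE normr_ge0.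
exists (complex.Re `|lead_coef q| * c) => [|x]; first exact: mulr_gt0.
by rewrite bopE nrZ -mulrA ler_pM2l.
Qed.

(** For z = a + i b the cross term between (T - a) x and i b x vanishes, so |(T - z) x|^2 = |(T - a)
    x|^2 + b^2 |x|^2. *)
Lemma sa_nbb_real T (z : R[i]) : selfadj T -> ~ bounded_below (T - z *: (1 : bop H)) ->
  z = (complex.Re z)%:C.
Proof.
move=> sT nb; apply: contrapT => zr; apply: nb.
set a := complex.Re z in zr; pose b := complex.Im z.
have zE : z = a%:C + b%:C * 'i%C by rewrite mulrC -complexE.
have b0 : b != 0 by apply: contra_notN zr => /eqP b0; rewrite zE b0 mul0r addr0.
exists `|b| => [|x]; first by rewrite normr_gt0.
rewrite -ler_sqr ?nnegrE ?mulr_ge0 ?nr_ge0 //.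
have sS : selfadj (T - a%:O) by apply: saB => //; exact: saO.
have -> : (T - z *: (1 : bop H)) x = (T - a%:O) x - b%:C *: ('i%C *: x).
  by rewrite zE !bopE scalerDl opprD scalerA addrA.
move: (T - a%:O) sS => S sS.
have Six : rip (S x) ('i%C *: x) = 0.
  suff : rip (S x) ('i%C *: x) = - rip (S x) ('i%C *: x) by move=> h; lra.
  by rewrite {1}sS linearZ !rip_iZr [ip x _]ipC; case: (ip _ _).
have nix : rip ('i%C *: x) ('i%C *: x) = nr x ^+ 2.
  by rewrite rip_iZr linearZl_LR /= mulrC ImiRe -ripxx.
rewrite -ripxx !ripE (ripC ('i%C *: x)) Six nix ripxx exprMn -normrX.
rewrite ger0_norm ?sqr_ge0 //; have := sqr_ge0 (nr (S x)); lra.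
Qed.

Definition rhorner (p : {poly R}) T := chorner (map_poly (real_complex R) p) T.

Lemma rhornerD p q T : rhorner (p + q) T = rhorner p T + rhorner q T.
Proof. by rewrite /rhorner rmorphD chornerD. Qed.

Lemma rhornerB p q T : rhorner (p - q) T = rhorner p T - rhorner q T.
Proof. by rewrite /rhorner rmorphB chornerB. Qed.

Lemma rhornerM p q T : rhorner (p * q) T = rhorner p T * rhorner q T.
Proof. by rewrite /rhorner rmorphM chornerM. Qed.

Lemma rhornerC a T : rhorner a%:P T = a%:O.
Proof. by rewrite /rhorner map_polyC chornerC. Qed.

Lemma rhornerX T : rhorner 'X T = T.
Proof. by rewrite /rhorner map_polyX chornerX. Qed.

Lemma rhornerE p T : rhorner p T = \sum_(i < size p) (p`_i)%:C *: T ^+ i.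
Proof.
rewrite /rhorner /chorner size_map_poly; apply: eq_bigr => i _.
by rewrite coef_map.
Qed.

Lemma rhorner_sa p T : selfadj T -> selfadj (rhorner p T).
Proof.
move=> sT; rewrite rhornerE; elim/big_ind: _ => [||i _].
- exact: sa0.
- exact: saD.
- exact/saZ/saX.
Qed.

Lemma rhorner_intertwine p T S V : T * V = V * S -> rhorner p T * V = V * rhorner p S.
Proof.
move=> TV; rewrite !rhornerE mulr_sumr mulr_suml; apply: eq_bigr => i _.
rewrite bop_scalerAr bop_scalerAl; congr (_ *: _).
elim: (i : nat) => [|n IH]; rewrite ?mulr1 ?mul1r //.
by rewrite exprSr -mulrA TV mulrA IH -mulrA -exprSr.
Qed.

Lemma horner_operatorE p T : horner_operator p T = rhorner p T.
Proof.
apply/funext => x; rewrite /horner_operator rhornerE.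
transitivity (\sum_(i < size p) ((p`_i)%:C *: T ^+ i) x).
  by apply: eq_bigr => i _; rewrite bopZ bopX.
elim: (index_enum _) => [|i s IH]; first by rewrite !big_nil.
by rewrite !big_cons bopD IH.
Qed.

(** With N = p(T) and -l the best upper bound of N^2, the polynomial p^2 + l is not bounded below at
    T. A root t of it has p(t)^2 = -l, and |N x|^2 = <N^2 x, x> <= -l |x|^2. *)
Lemma rhorner_spectral_bound p T : selfadj T ->
  exists t : R, ~ bounded_below (T - t%:O) /\ forall x, nr (rhorner p T x) <= `|p.[t]| * nr x.
Proof.
move=> sT; pose N := rhorner p T; have sN : selfadj N := rhorner_sa p sT.
have [l [lN nl]] := sa_lower_bound (saN (saS sN)).
have {}nl : ~ bounded_below (rhorner (p ^+ 2 + l%:P) T).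
  apply: contra_not nl => -[c c0 h]; exists c => // x.
  have -> : - (N * N) - l%:O = - rhorner (p ^+ 2 + l%:P) T.
    by rewrite rhornerD rhornerC expr2 rhornerM opprD.
  by rewrite bopN nrN.
have [t [nt pt]] : exists t : R, ~ bounded_below (T - t%:O) /\ p.[t] ^+ 2 = - l.
  (* If p^2 + l is the zero polynomial there is no factorization, but then any approximate
     eigenvalue of T will do. *)
  have [q0|q0] := eqVneq (p ^+ 2 + l%:P) 0.
    have [t [_ nt]] := sa_lower_bound sT; exists t; split => //.
    by apply/eqP; rewrite -addr_eq0 -horner_exp -(hornerC l t) -hornerD q0 horner0.
  have [|z [rz nz]] := chorner_root_nbb _ nl; first by rewrite map_poly_eq0.
  have zE := sa_nbb_real sT nz; rewrite zE in rz nz.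
  exists (complex.Re z); split=> //.
  move: rz; rewrite fmorph_root rootE !hornerE => /eqP/(canRL (addrK _)).
  by rewrite sub0r.
exists t; split=> // x; rewrite -ler_sqr ?nnegrE ?mulr_ge0 ?nr_ge0 //.
rewrite exprMn -normrX ger0_norm ?sqr_ge0 // pt.
have := ole_rip lN x; rewrite !bopE ripZl ripxx ripNl (sN (N x)) ripxx.
by rewrite lerNr mulNr.
Qed.

(** * Continuous functional calculus *)

Lemma le_eps (c d : R) : 0 <= d -> (forall e, 0 < e -> c <= e * d) -> c <= 0.
Proof.
move=> d0 h; have d1 : 0 < d + 1 by rewrite ltr_wpDl.
apply/ler_addgt0Pr => e e0; rewrite add0r.
apply: le_trans (h (e / (d + 1)) (divr_gt0 e0 d1)) _.
by rewrite mulrAC ler_pdivrMr // ler_wpM2l ?(ltW e0) // lerDl.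
Qed.

Lemma nr_eps x (d : R) : 0 <= d -> (forall e, 0 < e -> nr x <= e * d) -> x = 0.
Proof.
by move=> d0 h; apply/eqP; rewrite -nr_eq0 eq_le nr_ge0 (le_eps d0 h).
Qed.

Definition op_itv (a b : R) T : Prop := ole a%:O T /\ ole T b%:O.

Lemma itv_sa a b T : op_itv a b T -> selfadj T.
Proof. by case=> /oleO_sa. Qed.

Lemma itv_le a b T : op_itv a b T -> a <= b.
Proof. by case=> aT Tb; apply: oleO_le; exact: ole_trans aT Tb. Qed.

Lemma itv_nbb a b T (t : R) : op_itv a b T -> ~ bounded_below (T - t%:O) -> a <= t <= b.
Proof.
move=> [aT Tb] nb; apply/andP; split; rewrite leNgt; apply/negP => lt; apply: nb.
  apply: (@oleO_bb _ (a - t)); first by rewrite subr_gt0.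
  by rewrite rmorphB scalerBl; apply: oleD => //; exact: ole_refl.
suff : bounded_below (t%:O - T).
  move=> [c c0 h]; exists c => // x.
  by rewrite -[T - _]opprK opprB bopN nrN.
apply: (@oleO_bb _ (t - b)); first by rewrite subr_gt0.
by rewrite rmorphB scalerBl; apply: oleD; [exact: ole_refl|exact: oleN].
Qed.

Lemma rhorner_itv_bound a b T p (e : R) : op_itv a b T ->
  (forall t, a <= t <= b -> `|p.[t]| <= e) -> forall x, nr (rhorner p T x) <= e * nr x.
Proof.
move=> iT pe x; have [t [nt h]] := rhorner_spectral_bound p (itv_sa iT).
by rewrite (le_trans (h x)) // ler_wpM2r ?nr_ge0 // pe // (itv_nbb iT).
Qed.

(* S = g(T) for a <= T <= b: no spectral theory is needed, since polynomials
   close to g on [a, b] are close at T by [rhorner_spectral_bound]. *)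
Definition is_fcalc a b (g : R -> R) T S : Prop := forall e, 0 < e ->
  exists p : {poly R}, (forall t, a <= t <= b -> `|p.[t] - g t| <= e) /\
    forall x, nr (rhorner p T x - S x) <= e * nr x.

Lemma cv_nr_le (u : nat -> H) (l y : H) (c : R) N : cv u l ->
  (forall n, (N <= n)%N -> nr (u n - y) <= c) -> nr (l - y) <= c.
Proof.
move=> ul uc; apply/ler_addgt0Pr => e e0; have [M uM] := ul e e0.
apply: (le_trans (nr_dist l (u (maxn N M)) y)); rewrite addrC lerD //.
  by apply: uc; rewrite leq_maxl.
by rewrite nr_distC; apply: uM; rewrite leq_maxr.
Qed.

Lemma fcl_exists a b g T : approximable a b g -> op_itv a b T -> exists S, is_fcalc a b g T S.
Proof.
move=> ag iT; have [K K0 gK] := apx_bounded ag.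
have /choice[p pP] : forall n : nat, exists p : {poly R},
    forall t, a <= t <= b -> `|p.[t] - g t| <= n.+1%:R^-1.
  by move=> n; apply: ag; rewrite invr_gt0.
have h m n N x : (N <= m)%N -> (N <= n)%N ->
    nr (rhorner (p m) T x - rhorner (p n) T x) <= 2 / N.+1%:R * nr x.
  move=> Nm Nn; rewrite -bopB -rhornerB; apply: rhorner_itv_bound iT _ _ => t tab.
  rewrite hornerD hornerN.
  have -> : (p m).[t] - (p n).[t] = ((p m).[t] - g t) - ((p n).[t] - g t) by ring.
  rewrite (le_trans (ler_normB _ _)) // [2 / _]mulrC mulr_natr mulr2n.
  by rewrite lerD // (le_trans (pP _ _ tab)) // lef_pV2 ?posrE // ler_nat.
have [S SP] : exists S, forall x, cv (fun n => rhorner (p n) T x) (S x).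
  apply: (@bop_lim _ _ _ (K + 1)) => [n x|x e e0].
    apply: rhorner_itv_bound iT _ x => t tab.
    have -> : (p n).[t] = g t + ((p n).[t] - g t) by ring.
    rewrite (le_trans (ler_normD _ _)) // lerD ?gK //.
    by rewrite (le_trans (pP _ _ tab)) // invf_le1 // ler1n.
  have [N Ne] := small_inv (2 * nr x) e0; exists N => m n Nm Nn.
  by rewrite (le_trans (h _ _ _ _ Nm Nn)) // mulrAC.
exists S => e e0; have [N Ne] := small_inv 2 e0; exists (p N); split=> [t tab|x].
  rewrite (le_trans (pP _ _ tab)) // (le_trans _ Ne) // ler_pdivlMr // mulVf //.
  by rewrite ler1n.
rewrite nr_distC; apply: (cv_nr_le (N := N) (SP x)) => n Nn.
by rewrite (le_trans (h _ _ _ _ Nn (leqnn N))) // ler_wpM2r ?nr_ge0.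
Qed.

(** The polynomials witnessing [is_fcalc] may depend on e; comparison with ever finer ones transfers
    the bound d to an arbitrary approximant. *)
Lemma fcl_dist a b g T S p (d : R) : op_itv a b T -> is_fcalc a b g T S ->
  (forall t, a <= t <= b -> `|p.[t] - g t| <= d) ->
  forall x, nr (rhorner p T x - S x) <= d * nr x.
Proof.
move=> iT gS pd x; rewrite -subr_le0; apply: (@le_eps _ (2 * nr x)) => [|e e0].
  by rewrite mulr_ge0 ?nr_ge0.
have [q [qg qS]] := gS e e0; rewrite lerBlDr.
apply: (le_trans (nr_dist _ (rhorner q T x) _)).
have -> : e * (2 * nr x) + d * nr x = (d + e) * nr x + e * nr x by ring.
apply: lerD => //; rewrite -bopB -rhornerB; apply: rhorner_itv_bound iT _ x => t tab.
rewrite hornerD hornerN.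
have -> : p.[t] - q.[t] = (p.[t] - g t) - (q.[t] - g t) by ring.
by rewrite (le_trans (ler_normB _ _)) // lerD ?pd ?qg.
Qed.

Lemma fcl_unique a b g T S S' : op_itv a b T ->
  is_fcalc a b g T S -> is_fcalc a b g T S' -> S = S'.
Proof.
move=> iT gS gS'; apply: bop_ext => x; apply/eqP; rewrite -subr_eq0; apply/eqP.
apply: (@nr_eps _ (2 * nr x)) => [|e e0]; first by rewrite mulr_ge0 ?nr_ge0.
have [q [qg qS]] := gS e e0; apply: (le_trans (nr_dist _ (rhorner q T x) _)).
have := fcl_dist iT gS' qg x; have := qS x; rewrite nr_distC; lra.
Qed.

(* junk value 0 unless [approximable a b g] and [op_itv a b T] *)
Definition fcalc a b g T : bop H := xget 0 [set S | is_fcalc a b g T S].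

Section FunctionalCalculus.
Variables (a b : R).
Implicit Types (g h : R -> R).

Lemma fcP g T : approximable a b g -> op_itv a b T -> is_fcalc a b g T (fcalc a b g T).
Proof. by move=> ag iT; have [S gS] := fcl_exists ag iT; apply: (xgetPex 0); exists S. Qed.

Lemma fc_eqP g T S : op_itv a b T -> is_fcalc a b g T S -> fcalc a b g T = S.
Proof.
move=> iT gS; apply: (fcl_unique iT _ gS).
by apply: (xgetPex 0); exists S.
Qed.

Lemma fc_eq g h T : approximable a b g -> op_itv a b T -> (forall t, a <= t <= b -> g t = h t) ->
  fcalc a b g T = fcalc a b h T.
Proof.
move=> ag iT gh; apply/esym/fc_eqP => // e e0.
have [p [pg pS]] := fcP ag iT e0; exists p; split=> // t tab.
by rewrite -gh // pg.
Qed.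

Lemma fc_poly p T : op_itv a b T -> fcalc a b (fun t => p.[t]) T = rhorner p T.
Proof.
move=> iT; apply: fc_eqP => // e e0; exists p; split=> [t _|x].
  by rewrite subrr normr0 ltW.
by rewrite subrr nr0 mulr_ge0 ?nr_ge0 // ltW.
Qed.

Lemma fc_cst c T : op_itv a b T -> fcalc a b (fun=> c) T = c%:O.
Proof.
move=> iT; rewrite -(rhornerC c T) -fc_poly //; apply: fc_eq => // [|t _].
  exact: apx_cst.
by rewrite hornerC.
Qed.

Lemma fc_id T : op_itv a b T -> fcalc a b id T = T.
Proof.
move=> iT; rewrite -[RHS]rhornerX -fc_poly //; apply: fc_eq => // [|t _].
  exact: apx_id.
by rewrite hornerX.
Qed.

Lemma fcD g h T : approximable a b g -> approximable a b h -> op_itv a b T ->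
  fcalc a b (fun t => g t + h t) T = fcalc a b g T + fcalc a b h T.
Proof.
move=> ag ah iT; apply: fc_eqP => // e e0.
have e2 : 0 < e / 2 by rewrite divr_gt0.
have [p [pg pS]] := fcP ag iT e2; have [q [qh qS]] := fcP ah iT e2.
exists (p + q); split=> [t tab|x].
  by rewrite hornerD opprD addrACA (splitr e) (le_trans (ler_normD _ _)) // lerD ?pg ?qh.
rewrite rhornerD !bopD opprD addrACA (splitr e) mulrDl (le_trans (nrD _ _)) //.
by rewrite lerD ?pS ?qS.
Qed.

Lemma fcM g h T : approximable a b g -> approximable a b h -> op_itv a b T ->
  fcalc a b (fun t => g t * h t) T = fcalc a b g T * fcalc a b h T.
Proof.
move=> ag ah iT; apply: fc_eqP => // e e0.
have [K K0 gK] := apx_bounded ag; have [L L0 hL] := apx_bounded ah.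
set S := fcalc a b g T; set S' := fcalc a b h T.
have [C C0 SC] := bop_bound S.
(* D collects 2(K+L) + 1 from [prod_dist] for the functions and (L + 1) + C for the operators, where
   C bounds S and L + 1 bounds q(T). *)
pose D := 2 * (K + L) + L + C + 2; have D0 : 0 < D by rewrite /D; lra.
pose d := Num.min 1 (e / D).
have d0 : 0 < d by rewrite lt_min ltr01 divr_gt0.
have d1 : d <= 1 by rewrite ge_min lexx.
have de : d * D <= e by rewrite -ler_pdivlMr // ge_min lexx orbT.
have [p [pg pS]] := fcP ag iT d0; have [q [qh qS]] := fcP ah iT d0.
exists (p * q); split=> [t tab|x].
  have gKL : `|g t| <= K + L by rewrite (le_trans (gK _ tab)) // lerDl.
  have hKL : `|h t| <= K + L by rewrite (le_trans (hL _ tab)) // lerDr.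
  rewrite hornerM (le_trans (prod_dist (ltW d0) d1 (pg _ tab) (qh _ tab) gKL hKL)) //.
  by apply: le_trans de; rewrite ler_pM2l // /D; lra.
rewrite rhornerM !bopM.
have qL : nr (rhorner q T x) <= (L + 1) * nr x.
  apply: rhorner_itv_bound iT _ x => t tab.
  have -> : q.[t] = h t + (q.[t] - h t) by ring.
  by rewrite (le_trans (ler_normD _ _)) // lerD ?hL // (le_trans (qh _ tab)).
apply: (le_trans (nr_dist _ (S (rhorner q T x)) _)).
have h1 := pS (rhorner q T x).
have h2 : nr (S (rhorner q T x) - S (S' x)) <= C * (d * nr x).
  by rewrite -linearB (le_trans (SC _)) // ler_wpM2l // qS.
have h3 : d * nr (rhorner q T x) <= d * ((L + 1) * nr x) by rewrite ler_pM2l.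
have h4 : d * D * nr x <= e * nr x by rewrite ler_wpM2r ?nr_ge0.
have h5 : d * (L + 1) * nr x + C * d * nr x <= d * D * nr x.
  rewrite -mulrDl ler_wpM2r ?nr_ge0 //.
  have -> : d * (L + 1) + C * d = d * (L + 1 + C) by ring.
  by rewrite ler_pM2l // /D; lra.
lra.
Qed.

Lemma fc_dist g T (c d : R) : approximable a b g -> op_itv a b T ->
  (forall t, a <= t <= b -> `|c - g t| <= d) ->
  forall x, nr ((fcalc a b g T - c%:O) x) <= d * nr x.
Proof.
move=> ag iT gd x; rewrite bopB nr_distC -(rhornerC c T).
by apply: (fcl_dist iT (fcP ag iT)) => t tab; rewrite hornerC gd.
Qed.

Lemma fcZ g T (c : R) : approximable a b g -> op_itv a b T ->
  fcalc a b (fun t => c * g t) T = c%:C *: fcalc a b g T.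
Proof.
move=> ag iT; rewrite fcM //; last exact: apx_cst.
by rewrite fc_cst // bop_scalerAl mul1r.
Qed.

Lemma fcB g h T : approximable a b g -> approximable a b h -> op_itv a b T ->
  fcalc a b (fun t => g t - h t) T = fcalc a b g T - fcalc a b h T.
Proof.
move=> ag ah iT; have -> : (fun t => g t - h t) = (fun t => g t + -1 * h t).
  by apply/funext => t; rewrite mulN1r.
rewrite fcD //; last exact: apxZ.
by rewrite fcZ // rmorphN1 scaleN1r.
Qed.

Lemma fc_near g h T (d : R) : approximable a b g -> approximable a b h -> op_itv a b T ->
  (forall t, a <= t <= b -> `|g t - h t| <= d) ->
  forall x, nr (fcalc a b g T x - fcalc a b h T x) <= d * nr x.
Proof.
move=> ag ah iT gh x.
have /(_ 0 d) := @fc_dist (fun t => g t + -1 * h t) T.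
rewrite fcD //; last exact: apxZ.
rewrite fcZ // rmorphN1 scaleN1r rmorph0 scale0r subr0 => /(_ _ iT _ x).
apply=> [|t tab]; first by apply: apxD => //; exact: apxZ.
by rewrite mulN1r sub0r normrN gh.
Qed.

Lemma fc_sa g T : approximable a b g -> op_itv a b T -> selfadj (fcalc a b g T).
Proof.
move=> ag iT x y; apply/eqP; rewrite -subr_eq0 -normr_eq0 eq_le normr_ge0 andbT.
apply: (@le_eps _ (2 * (nr x * nr y))) => [|e e0].
  by rewrite !mulr_ge0 ?nr_ge0.
have [p [_ pS]] := fcP ag iT e0; set S := fcalc a b g T.
have cs u v : `|rip u v| <= nr u * nr v.
  by rewrite ler_norml -lerNl -ripNl (le_trans (CauchySchwarz _ _)) ?nrN //= CauchySchwarz.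
have -> : rip (S x) y - rip x (S y) =
    rip x (rhorner p T y - S y) - rip (rhorner p T x - S x) y.
  by rewrite !ripE (rhorner_sa p (itv_sa iT) x y); ring.
rewrite (le_trans (ler_normB _ _)) //.
have h1 := le_trans (cs x (rhorner p T y - S y)) (ler_wpM2l (nr_ge0 x) (pS y)).
have h2 := le_trans (cs (rhorner p T x - S x) y) (ler_wpM2r (nr_ge0 y) (pS x)).
lra.
Qed.

(** g stays within (d - c)/2 of the midpoint (c + d)/2, hence so does g(T) in norm, and the norm
    bound of a self-adjoint operator is an order bound. *)
Lemma fc_itv g T (c d : R) : approximable a b g -> op_itv a b T ->
  (forall t, a <= t <= b -> c <= g t <= d) -> op_itv c d (fcalc a b g T).
Proof.
move=> ag iT gcd; have sS := fc_sa ag iT.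
have h := @fc_dist g T ((c + d) / 2) ((d - c) / 2) ag iT.
have [|h1 h2] := nr_ole (saB sS (saO ((c + d) / 2))) (h _).
  move=> t tab; have /andP[? ?] := gcd _ tab.
  by rewrite ler_norml; apply/andP; split; lra.
have h3 := oleD h1 (ole_refl ((c + d) / 2)%:O).
have h4 := oleD h2 (ole_refl ((c + d) / 2)%:O).
move: h3 h4; rewrite !subrK -!scalerDl -!rmorphD /=.
have -> : - ((d - c) / 2) + (c + d) / 2 = c by field.
by have -> : (d - c) / 2 + (c + d) / 2 = d by field.
Qed.

Lemma fc_psd g T : approximable a b g -> op_itv a b T ->
  (forall t, a <= t <= b -> 0 <= g t) -> psd (fcalc a b g T).
Proof.
move=> ag iT g0; have [K K0 gK] := apx_bounded ag.
apply/ole0; rewrite -(scale0r (1 : bop H)) -(rmorph0 (real_complex R)).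
have [] // : op_itv 0 K (fcalc a b g T).
by apply: fc_itv => // t tab; rewrite g0 //= (le_trans (ler_norm _)) // gK.
Qed.

(** Holds for polynomials and passes to limits. V may be singular: with a projection for V it
    compares the calculus of B with that of an operator agreeing with B on the range of V. *)
Lemma fc_intertwine g T T' V : approximable a b g -> op_itv a b T -> op_itv a b T' ->
  T * V = V * T' -> fcalc a b g T * V = V * fcalc a b g T'.
Proof.
move=> ag iT iT' TV; apply: bop_ext => x; apply/eqP; rewrite -subr_eq0; apply/eqP.
have [C C0 VC] := bop_bound V.
apply: (@nr_eps _ (2 * (C * nr x))) => [|e e0]; first by rewrite !mulr_ge0 ?nr_ge0.
have [p [pg pS]] := fcP ag iT e0; have pS' := fcl_dist iT' (fcP ag iT') pg.
rewrite !bopM; apply: (le_trans (nr_dist _ (rhorner p T (V x)) _)).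
have h1 := pS (V x); rewrite nr_distC in h1.
have h2 : nr (rhorner p T (V x) - V (fcalc a b g T' x)) <= C * (e * nr x).
  rewrite -bopM (rhorner_intertwine p TV) bopM -linearB (le_trans (VC _)) //.
  by rewrite ler_wpM2l // pS'.
have h3 : e * nr (V x) <= e * (C * nr x) by rewrite ler_pM2l.
lra.
Qed.

Lemma fc_comm g T S : approximable a b g -> op_itv a b T -> T * S = S * T ->
  fcalc a b g T * S = S * fcalc a b g T.
Proof. by move=> ag iT; exact: fc_intertwine. Qed.

End FunctionalCalculus.

(** * Positive invertible operators and weighted geometric means *)

(** Positive invertibility as a positive scalar lower bound, which is stable under sums, congruences
    and limits; [pos_invertibleP] identifies it with the original notion. *)
Definition pinv T : Prop := exists2 c : R, 0 < c & ole c%:O T.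

Lemma pinv_psd T : pinv T -> psd T.
Proof. by move=> [c c0 cT]; apply: ole_psd (psdO (ltW c0)) cT. Qed.

Lemma pinv_sa T : pinv T -> selfadj T.
Proof. by move=> /pinv_psd[]. Qed.

Lemma pinvO (c : R) : 0 < c -> pinv c%:O.
Proof. by move=> c0; exists c => //; exact: ole_refl. Qed.

Lemma pinv1 : pinv 1.
Proof. by have := pinvO ltr01; rewrite scale1r. Qed.

Lemma pinvZ (c : R) T : 0 < c -> pinv T -> pinv (c%:C *: T).
Proof.
move=> c0 [d d0 dT]; exists (c * d) => [|]; first exact: mulr_gt0.
by rewrite rmorphM -scalerA; apply: oleZ => //; exact: ltW.
Qed.

Lemma sa_ubound T : selfadj T -> exists2 K : R, 0 < K & ole T K%:O.
Proof.
move=> sT; have [c c0 Tc] := bop_bound T; have [_ h] := nr_ole sT Tc.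
exists (c + 1); first by rewrite ltr_wpDl.
by apply: ole_trans h _; apply: oleO; rewrite lerDl.
Qed.

Lemma pinv_itv T : pinv T -> exists a b : R, [/\ 0 < a, a <= b & op_itv a b T].
Proof.
move=> pT; have [K K0 TK] := sa_ubound (pinv_sa pT).
case: pT => c c0 cT; exists c, K; split => //.
by apply: oleO_le; exact: ole_trans cT TK.
Qed.

Lemma itv_pinv (a b : R) T : 0 < a -> op_itv a b T -> pinv T.
Proof. by move=> a0 [aT _]; exists a. Qed.

Lemma pinv_inv T : pinv T -> exists S, [/\ pinv S, S * T = 1 & T * S = 1].
Proof.
move=> /pinv_itv[a [b [a0 ab iT]]].
have aV : approximable a b (fun t => t^-1).
  by apply: (@apx_inv _ _ _ id a) => // [|t /andP[]//]; exact: apx_id.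
have h : fcalc a b (fun t => t^-1 * t) T = 1.
  rewrite -[RHS]scale1r -(fc_cst 1 iT); apply: fc_eq => // [|t /andP[at' _]].
    by apply: apxM => //; exact: apx_id.
  by rewrite mulVf // gt_eqF // (lt_le_trans a0).
have ST : fcalc a b (fun t => t^-1) T * T = 1.
  by rewrite -[X in _ * X](fc_id iT) -fcM //; exact: apx_id.
exists (fcalc a b (fun t => t^-1) T); split=> //.
  have b0 := lt_le_trans a0 ab.
  apply: (@itv_pinv b^-1 a^-1); first by rewrite invr_gt0.
  apply: fc_itv => // t /andP[at' tb]; have t0 := lt_le_trans a0 at'.
  by rewrite !lef_pV2 ?posrE // tb.
by rewrite -fc_comm.
Qed.

Lemma inverse_unique S T S' : S * T = 1 -> T * S' = 1 -> S = S'.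
Proof. by move=> ST TS'; rewrite -[S]mulr1 -TS' mulrA ST mul1r. Qed.

Lemma pinv_sqrt T : pinv T ->
  exists S, [/\ pinv S, S * S = T & forall U, T * U = U * T -> S * U = U * S].
Proof.
move=> /pinv_itv[a [b [a0 ab iT]]].
have aS : approximable a b (fun t => Num.sqrt t).
  apply: (apx_sqrt (apx_id a b)) => t /andP[at' _].
  by rewrite (le_trans (ltW a0)).
exists (fcalc a b (fun t => Num.sqrt t) T); split=> [||U TU].
- apply: (@itv_pinv (Num.sqrt a) (Num.sqrt b)); first by rewrite sqrtr_gt0.
  apply: fc_itv => // t /andP[at' tb].
  by rewrite !ler_wsqrtr.
- rewrite -fcM // -[RHS](fc_id iT); apply: fc_eq => // [|t /andP[at' _]].
    exact: apxM.
  by rewrite -expr2 sqr_sqrtr // (le_trans (ltW a0)).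
- exact: fc_comm.
Qed.

Lemma pinvJ S Si T : selfadj S -> Si * S = 1 -> pinv T -> pinv (S * T * S).
Proof.
move=> sS SiS [c c0 cT].
have bbS : bounded_below S.
  have [d d0 Sd] := bop_bound Si; have d1 : 0 < d + 1 by rewrite ltr_wpDl.
  exists (d + 1)^-1 => [|x]; first by rewrite invr_gt0.
  rewrite mulrC ler_pdivrMr // mulrC -[x in nr x <= _]/((1 : bop H) x) -SiS bopM.
  by rewrite (le_trans (Sd _)) // ler_wpM2r ?nr_ge0 // lerDl.
have [d d0 dS] := psd_bb (psdS sS) (bbM bbS bbS).
exists (c * d) => [|]; first exact: mulr_gt0.
apply: ole_trans (oleJ sS cT).
rewrite bop_scalerAr mulr1 bop_scalerAl rmorphM -scalerA.
exact: oleZ (ltW c0) dS.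
Qed.

(** If the bottom l of Q - P were negative, then at an approximate eigenvector x the difference <Q^2
    x, x> - <P^2 x, x> = <(Q - P) x, (Q + P) x> would be close to l <x, (Q + P) x> <= l c |x|^2 <
    0. *)
Lemma sqr_mono (P Q : bop H) : pinv P -> psd Q -> ole (P * P) (Q * Q) -> ole P Q.
Proof.
move=> pP pQ PQ; have sP := pinv_sa pP; have sQ : selfadj Q by case: pQ.
have [l [lD nl]] := sa_lower_bound (saB sQ sP).
have [l0|l0] := leP 0 l.
  apply/(oleP sP sQ) => x; rewrite -subr_ge0 -ripBl -bopB.
  by have := ole_rip lD x; apply: le_trans; rewrite bopZ ripZl ripxx mulr_ge0 // sqr_ge0.
case: pP => c c0 cP; have [K K0 QPK] := bop_bound (Q + P).
have K1 : 0 < K + 1 by rewrite ltr_wpDl.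
(* This threshold makes the error |E x| (K + 1) |x| smaller than - l c |x|^2. *)
exfalso; apply: nl; exists (- l * c / (K + 1)) => [|x].
  by rewrite divr_gt0 // mulr_gt0 // oppr_gt0.
rewrite leNgt; apply/negP => Ex.
set E := Q - P - _ in Ex lD.
have nx : 0 < nr x.
  rewrite lt_neqAle nr_ge0 andbT; apply/negP => /eqP nx.
  by move: Ex; rewrite -nx mulr0 ltNge nr_ge0.
have h1 : 0 <= rip (Q x) (Q x) - rip (P x) (P x).
  have := ole_rip PQ x; rewrite !bopE [rip (Q (Q x)) x]sQ [rip (P (P x)) x]sP.
  by rewrite subr_ge0.
have DE : Q x - P x = E x + l%:C *: x by rewrite /E !bopE subrK.
have h2 : rip (Q x) (Q x) - rip (P x) (P x) = rip (Q x - P x) ((Q + P) x).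
  by rewrite !bopE !ripE (ripC (P x)); ring.
have h3 : rip (E x) ((Q + P) x) <= nr (E x) * (K * nr x).
  by rewrite (le_trans (CauchySchwarz _ _)) // ler_wpM2l ?nr_ge0.
have h4 : c * nr x ^+ 2 <= rip x ((Q + P) x).
  rewrite bopD ripDr (ripC x) (ripC x).
  have := ole_rip cP x; rewrite !bopE ripZl ripxx; have := proj2 pQ x; lra.
have h5 : nr (E x) * (K * nr x) <= nr (E x) * ((K + 1) * nr x).
  by rewrite ler_wpM2l ?nr_ge0 // ler_wpM2r ?nr_ge0 // lerDl.
have h6 : nr (E x) * ((K + 1) * nr x) < - l * c * nr x ^+ 2.
  move: Ex; rewrite -(ltr_pM2r (mulr_gt0 K1 nx)).
  have -> // : - l * c / (K + 1) * nr x * ((K + 1) * nr x) = - l * c * nr x ^+ 2.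
  by field; rewrite gt_eqF.
have h7 : l * rip x ((Q + P) x) <= l * (c * nr x ^+ 2) by rewrite ler_wnM2l // ltW.
by move: h1; rewrite h2 DE ripDl ripZl; lra.
Qed.

(** Congruence by D^-1/2 reduces the claim to W = D^-1/2 C D^-1/2 <= 1, and congruence by W^-1/2
    then gives 1 <= W^-1. *)
Lemma inv_antitone C D Ci Di : pinv C -> pinv D -> ole C D ->
  Ci * C = 1 -> C * Ci = 1 -> Di * D = 1 -> D * Di = 1 -> ole Di Ci.
Proof.
move=> pC pD CD CiC CCi DiD DDi.
have [S [pS SS _]] := pinv_sqrt pD; have [Si [pSi SiS SSi]] := pinv_inv pS.
have sS := pinv_sa pS; have sSi := pinv_sa pSi.
have DiE : Di = Si * Si.
  by apply: (inverse_unique DiD); rewrite -SS mulrA -(mulrA S) SSi mulr1.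
have pW : pinv (Si * C * Si) by exact: pinvJ SSi pC.
have W1 : ole (Si * C * Si) 1.
  have := oleJ sSi CD; suff -> : Si * D * Si = 1 by [].
  by rewrite -SS mulrA SiS mul1r SSi.
have [V [pV VV _]] := pinv_sqrt pW; have [Vi [pVi ViV VVi]] := pinv_inv pV.
have h : ole 1 (Vi * Vi).
  have := oleJ (pinv_sa pVi) W1; rewrite mulr1.
  by rewrite -VV mulrA ViV mul1r VVi.
have CiE : Ci = Si * (Vi * Vi) * Si.
  apply: (inverse_unique CiC).
  have -> : C = S * (Si * C * Si) * S by rewrite !mulrA SSi mul1r -mulrA SiS mulr1.
  rewrite -VV -!mulrA (mulrA S Si) SSi mul1r (mulrA V Vi) VVi mul1r.
  by rewrite (mulrA V Vi) VVi mul1r SSi.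
by rewrite DiE CiE; have := oleJ sSi h; rewrite mulr1.
Qed.

(* P is the geometric mean of C and P C^-1 P, and Q that of D and Q D^-1 Q. *)
Lemma riccati_mono C D Ci Di (P Q : bop H) : pinv C -> pinv D -> ole C D ->
  Ci * C = 1 -> C * Ci = 1 -> Di * D = 1 -> D * Di = 1 ->
  pinv P -> pinv Q -> ole (P * Ci * P) (Q * Di * Q) -> ole P Q.
Proof.
move=> pC pD CD CiC CCi DiD DDi pP pQ PQ.
have DiCi := inv_antitone pC pD CD CiC CCi DiD DDi.
(* P D^-1 P <= P C^-1 P <= Q D^-1 Q. Congruence by D^-1/2 turns both ends into squares, to which
   [sqr_mono] applies. *)
have h := ole_trans (oleJ (pinv_sa pP) DiCi) PQ.
have [S [pS SS _]] := pinv_sqrt pD; have [Si [pSi SiS SSi]] := pinv_inv pS.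
have sS := pinv_sa pS; have sSi := pinv_sa pSi.
have DiE : Di = Si * Si.
  by apply: (inverse_unique DiD); rewrite -SS mulrA -(mulrA S) SSi mulr1.
have sq U : Si * (U * Di * U) * Si = (Si * U * Si) * (Si * U * Si).
  by rewrite DiE !mulrA.
have {}h : ole (Si * P * Si) (Si * Q * Si).
  apply: sqr_mono; [exact: pinvJ SSi pP|exact/pinv_psd/(pinvJ sSi SSi)|].
  by rewrite -!sq; exact: oleJ.
have back U : S * (Si * U * Si) * S = U.
  by rewrite !mulrA SSi mul1r -mulrA SiS mulr1.
by rewrite -(back P) -(back Q); exact: oleJ.
Qed.

(** Abstracts the path of weighted geometric means, with [Pi s] the inverse of [P s]. The midpoint
    clause is the Riccati equation making P((u+v)/2) the geometric mean of P(u) and P(v); it lets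
    two paths be compared from their endpoints alone. *)
Record weighted_mean_family (P Pi : R -> bop H) : Prop := WeightedMeanFamily {
  wm_pinv : forall s, 0 <= s <= 1 -> pinv (P s);
  wm_invl : forall s, 0 <= s <= 1 -> Pi s * P s = 1;
  wm_invr : forall s, 0 <= s <= 1 -> P s * Pi s = 1;
  wm_midpoint : forall u v, 0 <= u <= 1 -> 0 <= v <= 1 ->
    P ((u + v) / 2) * Pi u * P ((u + v) / 2) = P v;
  wm_continuous : forall s e, 0 <= s <= 1 -> 0 < e -> exists2 d, 0 < d &
    forall u, 0 <= u <= 1 -> `|u - s| <= d -> forall x, nr (P u x - P s x) <= e * nr x }.

Lemma rip_le x y : `|rip x y| <= nr x * nr y.
Proof.
by rewrite ler_norml -lerNl -ripNl (le_trans (CauchySchwarz _ _)) ?nrN //= CauchySchwarz.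
Qed.

Lemma weighted_mean_mono P Pi Q Qi :
  weighted_mean_family P Pi -> weighted_mean_family Q Qi ->
  ole (P 0) (Q 0) -> ole (P 1) (Q 1) -> forall s, 0 <= s <= 1 -> ole (P s) (Q s).
Proof.
move=> wP wQ PQ0 PQ1; apply: midpoint_ind => // [u v u01 v01 Pu Pv|s s01 h].
  have m01 : 0 <= (u + v) / 2 <= 1.
    by move: u01 v01 => /andP[? ?] /andP[? ?]; apply/andP; split; lra.
  apply: (riccati_mono (wm_pinv wP u01) (wm_pinv wQ u01) Pu (wm_invl wP u01)
    (wm_invr wP u01) (wm_invl wQ u01) (wm_invr wQ u01)).
  - exact: wm_pinv wP _ m01.
  - exact: wm_pinv wQ _ m01.
  - by rewrite (wm_midpoint wP) // (wm_midpoint wQ).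
apply/oleP => [||x]; [exact/pinv_sa/(wm_pinv wP)|exact/pinv_sa/(wm_pinv wQ)|].
rewrite -subr_le0; apply: (@le_eps _ (2 * (nr x * nr x))) => [|e e0].
  by rewrite !mulr_ge0 ?nr_ge0.
have [d d0 Pd] := wm_continuous wP s01 e0; have [d' d0' Qd] := wm_continuous wQ s01 e0.
have [|u [u01 us PQ]] := h (Num.min d d'); first by rewrite lt_min d0.
move: us; rewrite le_min => /andP[usd usd'].
have hP := Pd _ u01 usd x; have hQ := Qd _ u01 usd' x.
have h1 := le_trans (rip_le (P u x - P s x) x) (ler_wpM2r (nr_ge0 x) hP).
have h2 := le_trans (rip_le (Q u x - Q s x) x) (ler_wpM2r (nr_ge0 x) hQ).
have := ole_rip PQ x; move: h1 h2; rewrite !ripBl !ler_norml.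
by move=> /andP[? ?] /andP[? ?] ?; lra.
Qed.

Lemma powRD_gt0 (t u v : R) : 0 < t -> t `^ (u + v) = t `^ u * t `^ v.
Proof. by move=> t0; rewrite powRD // (gt_eqF t0) implybT. Qed.

Definition bpow (a b : R) T (s : R) : bop H := fcalc a b (fun t => t `^ s) T.

(* For w = 1, S = X^1/2 and B = X^-1/2 A X^-1/2 this is the path of weighted
   geometric means X #_s A; for S = 1 and B = A it is (w 1) #_s A. *)
Lemma bpow_family (a b w : R) S Si B : 0 < a -> 0 < w -> op_itv a b B ->
  selfadj S -> S * Si = 1 -> Si * S = 1 ->
  weighted_mean_family (fun s => S * ((w `^ (1 - s))%:C *: bpow a b B s) * S)
    (fun s => Si * ((w `^ (s - 1))%:C *: fcalc a b (fun t => (t `^ s)^-1) B) * Si).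
Proof.
move=> a0 w0 iB sS SSi SiS.
have ap s : 0 <= s <= 1 -> approximable a b (fun t => t `^ s) by exact: apx_powR.
have ps s : 0 <= s -> forall t, a <= t <= b -> a `^ s <= t `^ s.
  move=> s0 t /andP[at' _]; apply: ge0_ler_powR => //; rewrite nnegrE ?(ltW a0) //.
  by rewrite (le_trans (ltW a0)).
have av s : 0 <= s <= 1 -> approximable a b (fun t => (t `^ s)^-1).
  move=> s01; apply: (apx_inv (d := a `^ s)) => //; first exact: powR_gt0.
    exact: ap.
  by apply: ps; case/andP: s01.
have wV s : (w `^ (s - 1))%:C * (w `^ (1 - s))%:C = 1 :> R[i].
  have h : (s - 1) + (1 - s) = 0 by ring.
  by rewrite -rmorphM -powRD_gt0 // h powRr0.
have wV' s : (w `^ (1 - s))%:C * (w `^ (s - 1))%:C = 1 :> R[i].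
  by rewrite mulrC wV.
have mulI U V : S * U * S * (Si * V * Si) = S * (U * V) * Si.
  by rewrite !mulrA -(mulrA (S * U)) SSi mulr1.
have mulI' U V : Si * V * Si * (S * U * S) = Si * (V * U) * S.
  by rewrite !mulrA -(mulrA (Si * V)) SiS mulr1.
have pw s : 0 <= s <= 1 -> pinv (bpow a b B s).
  move=> s01; apply: (@itv_pinv (a `^ s) (b `^ s)); first exact: powR_gt0.
  apply: fc_itv => //; first exact: ap.
  move=> t tab; have /andP[s0 _] := s01; rewrite ps //=.
  have /andP[at' tb] := tab; have t0 := le_trans (ltW a0) at'.
  by apply: ge0_ler_powR => //; rewrite nnegrE // (le_trans t0).
have inv s : 0 <= s <= 1 -> bpow a b B s * fcalc a b (fun t => (t `^ s)^-1) B = 1.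
  move=> s01; rewrite -fcM //; [|exact: ap|exact: av].
  rewrite -[RHS]scale1r -(fc_cst 1 iB); apply: fc_eq => //.
    by apply: apxM; [exact: ap|exact: av].
  by move=> t /andP[at' _]; rewrite divff // gt_eqF // powR_gt0 // (lt_le_trans a0).
have cm s : 0 <= s <= 1 -> bpow a b B s * fcalc a b (fun t => (t `^ s)^-1) B =
    fcalc a b (fun t => (t `^ s)^-1) B * bpow a b B s.
  move=> s01; apply: fc_comm => //; first exact: ap.
  by apply/esym/fc_comm => //; exact: av.
split=> [s s01|s s01|s s01|u v u01 v01|s e s01 e0].
- by apply: (pinvJ sS SiS); apply: pinvZ; [exact: powR_gt0|exact: pw].
- rewrite mulI' !(bop_scalerAl, bop_scalerAr) scalerA wV scale1r -cm // inv //.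
  by rewrite mulr1 SiS.
- rewrite mulI !(bop_scalerAl, bop_scalerAr) scalerA wV' scale1r inv //.
  by rewrite mulr1 SSi.
- set m := (u + v) / 2.
  have m01 : 0 <= m <= 1.
    by move: u01 v01 => /andP[? ?] /andP[? ?]; rewrite /m; apply/andP; split; lra.
  have mulI2 U V : S * U * Si * (S * V * S) = S * (U * V) * S.
    by rewrite !mulrA -(mulrA (S * U)) SiS mulr1.
  rewrite mulI mulI2; congr (S * _ * S); rewrite -mulrA.
  rewrite !(bop_scalerAl, bop_scalerAr) !scalerA -!rmorphM /=.
  have -> : w `^ (1 - m) * w `^ (u - 1) * w `^ (1 - m) = w `^ (1 - v).
    by rewrite -!powRD_gt0 //; congr (_ `^ _); rewrite /m; field.
  congr (_ *: _); have apm := ap m m01; have avu := av u u01.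
  have avm := apxM avu apm; have h := apxM apm avm.
  rewrite -fcM // -fcM //; apply: fc_eq => // t /andP[at' _].
  have t0 := lt_le_trans a0 at'; rewrite mulrCA powR_midpoint //.
  by rewrite mulKf // gt_eqF // powR_gt0.
- have [c c0 Sc] := bop_bound S; have c1 : 0 < c + 1 by rewrite ltr_wpDl.
  pose eta := e / ((c + 1) * (c + 1)).
  have eta0 : 0 < eta by rewrite divr_gt0 // mulr_gt0.
  (* Since w^(1-v) t^v = w (t/w)^v, continuity in the exponent is used on [a/w, b/w] with tolerance
     eta/w; eta leaves room for the two outer factors S. *)
  have [d d0 dP] := powR_exponent_continuous (b / w) (divr_gt0 a0 w0) s01
    (divr_gt0 eta0 w0).
  exists d => // u u01 us x.
  have Sc1 y : nr (S y) <= (c + 1) * nr y.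
    by rewrite (le_trans (Sc y)) // ler_wpM2r ?nr_ge0 // lerDl.
  have E v : 0 <= v <= 1 -> (w `^ (1 - v))%:C *: bpow a b B v =
      fcalc a b (fun t => w `^ (1 - v) * t `^ v) B.
    by move=> v01; rewrite fcZ //; exact: ap.
  rewrite !E // !bopM -linearB; apply: (le_trans (Sc1 _)).
  have hn : nr (fcalc a b (fun t => w `^ (1 - u) * t `^ u) B (S x) -
                fcalc a b (fun t => w `^ (1 - s) * t `^ s) B (S x)) <= eta * nr (S x).
    apply: fc_near => //; [exact/apxZ/ap|exact/apxZ/ap|move=> t tab].
    have /andP[at' tb] := tab; have t0 := lt_le_trans a0 at'.
    have twE v : w `^ (1 - v) * t `^ v = w * (t / w) `^ v.
      rewrite powRM ?invr_ge0 ?(ltW w0) ?(ltW t0) // powRD_gt0 // powRr1 ?(ltW w0) //.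
      by rewrite -powR_inv1 ?(ltW w0) // -powRrM mulN1r mulrA mulrAC.
    rewrite !twE -mulrBr normrM (ger0_norm (ltW w0)) mulrC -ler_pdivlMr //.
    by apply: dP => //; rewrite !ler_pM2r ?invr_gt0 // at'.
  have h2 : eta * nr (S x) <= eta * ((c + 1) * nr x) by rewrite ler_pM2l.
  apply: le_trans (ler_wpM2l (ltW c1) (le_trans hn h2)) _.
  rewrite le_eqVlt; apply/orP; left; apply/eqP; rewrite /eta; field.
  by rewrite gt_eqF.
Qed.

Lemma bpow_bounds (a b : R) T (s : R) : 0 < a -> 0 <= s <= 1 -> op_itv a b T ->
  op_itv (a `^ s) (b `^ s) (bpow a b T s).
Proof.
move=> a0 s01 iT; apply: fc_itv => //; first exact: apx_powR.
move=> t /andP[at' tb]; have t0 := le_trans (ltW a0) at'.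
have /andP[s0 _] := s01.
by apply/andP; split; apply: ge0_ler_powR => //; rewrite nnegrE ?(ltW a0) ?(le_trans t0 tb).
Qed.

Lemma bpow0 (a b : R) T : op_itv a b T -> bpow a b T 0 = 1.
Proof.
move=> iT; rewrite -[RHS]scale1r -(fc_cst 1 iT); apply: fc_eqP => // e e0.
rewrite fc_cst //; exists 1%:P; split=> [t _|x].
  by rewrite hornerC powRr0 subrr normr0 ltW.
by rewrite rhornerC subrr nr0 mulr_ge0 ?nr_ge0 // ltW.
Qed.

Lemma bpow1 (a b : R) T : 0 < a -> op_itv a b T -> bpow a b T 1 = T.
Proof.
move=> a0 iT; rewrite -[RHS](fc_id iT); apply: fc_eq => //.
  by apply: apx_powR => //; rewrite ler01 lexx.
by move=> t /andP[at' _]; rewrite powRr1 // (le_trans (ltW a0)).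
Qed.

Section WeightedMeanBounds.
Variables (a b a' b' w s : R) (X A S Si : bop H).
Hypotheses (a0 : 0 < a) (a'0 : 0 < a') (w0 : 0 < w) (s01 : 0 <= s <= 1).
Hypotheses (iA : op_itv a' b' A) (sS : selfadj S) (SS : S * S = X).
Hypotheses (SSi : S * Si = 1) (SiS : Si * S = 1) (iB : op_itv a b (Si * A * Si)).

Let one_powR u : 1 `^ u = 1 :> R. Proof. by rewrite /powR oner_eq0 ln1 mulr0 expR0. Qed.

Let famX := bpow_family a0 ltr01 iB sS SSi SiS.
Let famA := bpow_family a'0 w0 iA sa1 (mulr1 1) (mulr1 1).

Let X0 : S * ((1 `^ (1 - 0))%:C *: bpow a b (Si * A * Si) 0) * S = X.
Proof. by rewrite one_powR scale1r bpow0 // mulr1. Qed.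

Let X1 : S * ((1 `^ (1 - 1))%:C *: bpow a b (Si * A * Si) 1) * S = A.
Proof.
by rewrite one_powR scale1r bpow1 // !mulrA SSi mul1r -mulrA SiS mulr1.
Qed.

Let A0 : 1 * ((w `^ (1 - 0))%:C *: bpow a' b' A 0) * 1 = w%:O.
Proof. by rewrite subr0 powRr1 ?(ltW w0) // bpow0 // mulr1 mul1r. Qed.

Let A1 : 1 * ((w `^ (1 - 1))%:C *: bpow a' b' A 1) * 1 = A.
Proof. by rewrite subrr powRr0 scale1r bpow1 // mulr1 mul1r. Qed.

Let Xs : S * ((1 `^ (1 - s))%:C *: bpow a b (Si * A * Si) s) * S =
  S * bpow a b (Si * A * Si) s * S.
Proof. by rewrite one_powR scale1r. Qed.

Let As : 1 * ((w `^ (1 - s))%:C *: bpow a' b' A s) * 1 =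
  (w `^ (1 - s))%:C *: bpow a' b' A s.
Proof. by rewrite mulr1 mul1r. Qed.

Let mono P Pi Q Qi p0 q0 p1 q1 ps qs : weighted_mean_family P Pi ->
  weighted_mean_family Q Qi -> P 0 = p0 -> Q 0 = q0 -> P 1 = p1 -> Q 1 = q1 ->
  P s = ps -> Q s = qs -> ole p0 q0 -> ole p1 q1 -> ole ps qs.
Proof.
by move=> wP wQ <- <- <- <- <- <- ? ?; exact: weighted_mean_mono wP wQ _ _ _ s01.
Qed.

(** The paths w #_s A and X #_s A start at w and X and both end at A. *)
Lemma weighted_mean_ge : ole w%:O X ->
  ole ((w `^ (1 - s))%:C *: bpow a' b' A s) (S * bpow a b (Si * A * Si) s * S).
Proof. by move=> wX; exact: mono famA famX A0 X0 A1 X1 As Xs wX (ole_refl A). Qed.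

Lemma weighted_mean_le : ole X w%:O ->
  ole (S * bpow a b (Si * A * Si) s * S) ((w `^ (1 - s))%:C *: bpow a' b' A s).
Proof. by move=> Xw; exact: mono famX famA X0 A0 X1 A1 Xs As Xw (ole_refl A). Qed.

End WeightedMeanBounds.

(** * Strong limits and spectral projections *)

Lemma rip_cv_ge (u : nat -> H) l y (c : R) : cv u l ->
  (forall n, c <= rip (u n) y) -> c <= rip l y.
Proof.
move=> ul uc; rewrite -subr_le0; apply: (@le_eps _ (nr y)); first exact: nr_ge0.
move=> e e0; have [N uN] := ul e e0.
have := le_trans (rip_le (u N - l) y) (ler_wpM2r (nr_ge0 y) (uN _ (leqnn N))).
by rewrite ripBl ler_norml => /andP[_]; have := uc N; lra.
Qed.

Lemma sot_sa (T_ : nat -> bop H) T : (forall x, cv (fun n => T_ n x) (T x)) ->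
  (forall n, selfadj (T_ n)) -> selfadj T.
Proof.
move=> TT sT x y; apply/eqP; rewrite -subr_eq0 -(ripC (T y)) -normr_eq0.
rewrite eq_le normr_ge0 andbT; apply: (@le_eps _ (nr x + nr y)) => [|e e0].
  by rewrite addr_ge0 ?nr_ge0.
have [N hN] := TT x e e0; have [M hM] := TT y e e0.
have {}hN := hN _ (leq_maxl N M); have {}hM := hM _ (leq_maxr N M).
have h1 := le_trans (rip_le _ y) (ler_wpM2r (nr_ge0 y) hN).
have h2 := le_trans (rip_le _ x) (ler_wpM2r (nr_ge0 x) hM).
have -> : rip (T x) y - rip (T y) x = rip (T_ (maxn N M) y - T y) x -
    rip (T_ (maxn N M) x - T x) y.
  by rewrite !ripBl (sT _ x y) (ripC x); ring.
by rewrite (le_trans (ler_normB _ _)) //; lra.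
Qed.

Lemma sot_ole_ge (T_ : nat -> bop H) S T : (forall x, cv (fun n => T_ n x) (T x)) ->
  selfadj S -> (forall n, selfadj (T_ n)) -> (forall n, ole S (T_ n)) -> ole S T.
Proof.
move=> TT sS sT ST; apply/(oleP sS (sot_sa TT sT)) => x.
by apply: (rip_cv_ge (TT x)) => n; exact: ole_rip.
Qed.

Lemma ole_decr (T_ : nat -> bop H) : (forall n, ole (T_ n.+1) (T_ n)) ->
  forall m n, (m <= n)%N -> ole (T_ n) (T_ m).
Proof.
move=> dT m n /subnKC <-; elim: (n - m)%N => [|k IH]; first by rewrite addn0; exact: ole_refl.
by rewrite addnS; exact: ole_trans (dT _) IH.
Qed.

(** The numbers <T_n x, x> decrease to an infimum, and [psd_nr] applied to the positive differences
    gives |T_k x - T_l x|^2 <= c (<T_k x, x> - <T_l x, x>), so T_n x is Cauchy. *)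
Lemma decreasing_sot_cv (T_ : nat -> bop H) : (forall n, psd (T_ n)) ->
  (forall n, ole (T_ n.+1) (T_ n)) ->
  exists T, psd T /\ forall x, cv (fun n => T_ n x) (T x).
Proof.
move=> pT dT; have [c c0 Tc] := sa_ubound (proj1 (pT 0%N)).
have dT0 := ole_decr dT.
have cT n x : nr (T_ n x) <= c * nr x.
  apply: ole_nr; last exact: ole_trans (dT0 _ _ (leq0n n)) Tc.
  apply: (@ole_trans _ 0); last exact/ole0.
  by rewrite -(scale0r (1 : bop H)) -(rmorph0 (real_complex R)); apply: oleO; lra.
suff [T TT] : exists T, forall x, cv (fun n => T_ n x) (T x).
  exists T; split=> //; apply/ole0; apply: (sot_ole_ge TT sa0) => n.
    by case: (pT n).
  exact/ole0.
apply: (bop_lim cT) => x e e0.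
pose q n := rip (T_ n x) x; pose A := range q.
have A0 : has_inf A.
  split; first by exists (q 0%N), 0%N.
  by exists 0 => _ [n _ <-]; exact: proj2 (pT n) x.
have d0 : 0 < e ^+ 2 / c by rewrite divr_gt0 ?exprn_gt0.
have [_ [N _ <-] qN] := inf_adherent d0 A0.
exists N.
have key k l : (N <= k)%N -> (k <= l)%N -> nr (T_ k x - T_ l x) <= e.
  move=> Nk kl; rewrite -ler_sqr ?nnegrE ?nr_ge0 ?(ltW e0) //.
  have pD : psd (T_ k - T_ l) by exact: dT0.
  have Dc y : nr ((T_ k - T_ l) y) <= c * nr y.
    apply: ole_nr.
      apply: (@ole_trans _ 0); last exact/ole0.
      by rewrite -(scale0r (1 : bop H)) -(rmorph0 (real_complex R)); apply: oleO; lra.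
    apply: (@ole_trans _ (T_ k)); last exact: ole_trans (dT0 _ _ (leq0n k)) Tc.
    by rewrite /ole opprB addrCA subrr addr0.
  rewrite -bopB (le_trans (psd_nr pD Dc x)) // bopB ripBl.
  have h1 : q k <= q N by exact/ole_rip/dT0.
  have h2 : inf A <= q l by apply: ge_inf => //; [case: A0|exists l].
  rewrite -ler_pdivlMl // mulrC; rewrite -/(q k) -/(q l); lra.
move=> m n Nm Nn; case: (leqP m n) => mn; first exact: key.
by rewrite nr_distC; apply: key => //; exact: ltnW.
Qed.

Definition proj (P : bop H) : Prop := selfadj P /\ P * P = P.

Lemma proj_compl P : proj P -> proj (1 - P).
Proof.
move=> [sP PP]; split; first exact: saB.
by rewrite mulrBl mul1r mulrBr mulr1 PP subrr subr0.
Qed.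

Lemma projM P Q : proj P -> proj Q -> P * Q = Q * P -> proj (P * Q).
Proof.
move=> [sP PP] [sQ QQ] PQ; split; first exact: saM.
by rewrite mulrA -(mulrA P) -PQ mulrA PP -mulrA QQ.
Qed.

Lemma proj_psd P : proj P -> psd P.
Proof. by move=> [sP PP]; have := psdS sP; rewrite PP. Qed.

Lemma proj_le1 P : proj P -> ole P 1.
Proof. by move=> /proj_compl/proj_psd. Qed.

Lemma fcX (a b : R) (g : R -> R) T n : approximable a b g -> op_itv a b T ->
  approximable a b (fun t => g t ^+ n) /\ fcalc a b (fun t => g t ^+ n) T = fcalc a b g T ^+ n.
Proof.
move=> ag iT; elim: n => [|n [IH1 IH2]]; first by split; [exact: apx_cst|rewrite fc_cst ?scale1r].
have h : (fun t => g t ^+ n.+1) = (fun t => g t * g t ^+ n).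
  by apply/funext => t; rewrite exprS.
by rewrite h exprS -IH2 -fcM //; split => //; exact: apxM.
Qed.

(* E is the projection onto the kernel of (B - t)_+, obtained as the strong
   limit of the powers of C = 1 - (B - t)_+ / K. *)
Lemma spectral_projection (a b t : R) B : op_itv a b B ->
  exists E, [/\ proj E, forall U, B * U = U * B -> E * U = U * E,
    ole (B * E) (t%:C *: E) & ole (t%:C *: (1 - E)) (B * (1 - E))].
Proof.
move=> iB; have ab := itv_le iB.
have a1 : approximable a b (fun u => u - t) by apply: apxB; [exact: apx_id|exact: apx_cst].
have a2 := apx_abs a1.
have agp : approximable a b (fun u => 2^-1 * (`|u - t| + (u - t))) by exact/apxZ/apxD.
have agn : approximable a b (fun u => 2^-1 * (`|u - t| - (u - t))) by exact/apxZ/apxB.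
set gp := fun u => _ in agp; set gn := fun u => _ in agn.
have gp0 u : 0 <= gp u by rewrite /gp; have := ler_norm (- (u - t)); rewrite normrN; lra.
have gn0 u : 0 <= gn u by rewrite /gn; have := ler_norm (u - t); lra.
have [K K0 gK] := apx_bounded agp; have K1 : 0 < K + 1 by rewrite ltr_wpDl.
pose pos := fcalc a b gp B; pose neg := fcalc a b gn B.
have pn : pos * neg = 0.
  rewrite -fcM // -(scale0r (1 : bop H)) -(rmorph0 (real_complex R)) -(fc_cst 0 iB).
  apply: fc_eq => // [|u _]; first exact: apxM.
  have h : `|u - t| * `|u - t| = (u - t) * (u - t).
    by rewrite -expr2 -normrX ger0_norm ?sqr_ge0.
  rewrite /gp /gn; nra.
have BE : B - t%:O = pos - neg.
  have at' : approximable a b (fun u => u - t) by [].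
  have -> : B - t%:O = fcalc a b (fun u => u - t) B.
    by rewrite fcB ?fc_id ?fc_cst //; [exact: apx_id|exact: apx_cst].
  by rewrite -fcB //; apply: fc_eq => // u _; rewrite /gp /gn; field.
pose g u := 1 + - (K + 1)^-1 * gp u.
have ag : approximable a b g by apply: apxD; [exact: apx_cst|exact: apxZ].
have g01 u : a <= u <= b -> 0 <= g u <= 1.
  move=> uab; have := gK _ uab; rewrite ger0_norm // /g mulNr => h.
  have h1 : (K + 1)^-1 * gp u <= 1 by rewrite mulrC ler_pdivrMr // mul1r; lra.
  have h2 : 0 <= (K + 1)^-1 * gp u by rewrite mulr_ge0 // invr_ge0 ltW.
  by apply/andP; split; lra.
pose C := fcalc a b g B.
have CE : C = 1 - (K + 1)^-1%:C *: pos.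
  rewrite /C fcD //; [|exact: apx_cst|exact: apxZ].
  by rewrite fc_cst // scale1r fcZ // rmorphN scaleNr.
have CXE n : C ^+ n = fcalc a b (fun u => g u ^+ n) B by have [_ ->] := fcX n ag iB.
have aX n : approximable a b (fun u => g u ^+ n) by have [] := fcX n ag iB.
have pC n : psd (C ^+ n).
  by rewrite CXE; apply: fc_psd => // x /g01/andP[g0 _]; rewrite exprn_ge0.
have dC n : ole (C ^+ n.+1) (C ^+ n).
  rewrite /ole exprS -[X in X - _]mul1r -mulrBl.
  have -> : 1 - C = fcalc a b (fun u => 1 + -1 * g u) B.
    rewrite fcD //; [|exact: apx_cst|exact: apxZ].
    by rewrite fc_cst // scale1r fcZ // rmorphN1 scaleN1r.
  have a3 : approximable a b (fun u => 1 + -1 * g u) by apply: apxD; [exact: apx_cst|exact: apxZ].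
  rewrite CXE -fcM //; apply: fc_psd => // [|u /g01/andP[g0 g1]]; first exact: apxM.
  by rewrite mulr_ge0 ?exprn_ge0 //; lra.
have [E [pE EP]] := decreasing_sot_cv pC dC.
have cE U : B * U = U * B -> E * U = U * E.
  move=> BU; have CU := fc_comm ag iB BU.
  apply: bop_ext => x; rewrite !bopM.
  have [c c0 Uc] := bop_bound U; have c1 : 0 < c + 1 by rewrite ltr_wpDl.
  apply: (cv_unique (EP (U x))) => e e0.
  have [N hN] := EP x _ (divr_gt0 e0 c1); exists N => n /hN h.
  have -> : (C ^+ n) (U x) = U ((C ^+ n) x).
    rewrite -!bopM; congr (bopf _ x).
    by elim: n {h} => [|n IH]; rewrite ?mul1r ?mulr1 // exprS -mulrA IH mulrA CU -mulrA.
  rewrite -linearB (le_trans (Uc _)) //.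
  have : (c + 1) * nr ((C ^+ n) x - E x) <= e by rewrite mulrC -ler_pdivlMr.
  by apply: le_trans; rewrite ler_wpM2r ?nr_ge0 // lerDl.
have BC : B * C = C * B by rewrite /C fc_comm.
have CEE : C * E = E.
  apply: bop_ext => x; rewrite bopM -bopM -cE // bopM.
  apply: (cv_unique (EP (C x))) => e e0; have [N hN] := EP x e e0.
  exists N => n Nn; rewrite -bopM -exprSr; apply: hN; exact: leqW.
have CnE n : C ^+ n * E = E.
  by elim: n => [|n IH]; rewrite ?mul1r // exprS -mulrA IH.
have EE : E * E = E.
  apply: bop_ext => x; rewrite bopM; apply: (cv_unique (EP (E x))).
  by move=> e e0; exists 0%N => n _; rewrite -bopM CnE subrr nr0 ltW.
(* C E = E says that E kills the positive part; pos neg = 0 makes C, hence E, fix the negative part.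
   With B - t = pos - neg both slice inequalities follow. *)
have posE : pos * E = 0.
  have : ((K + 1)^-1%:C *: pos) * E = 0.
    have -> : (K + 1)^-1%:C *: pos = 1 - C by rewrite CE opprB addrCA subrr addr0.
    by rewrite mulrBl mul1r CEE subrr.
  rewrite bop_scalerAl => /(congr1 (GRing.scale (K + 1)%:C)).
  by rewrite scalerA -rmorphM mulfV ?gt_eqF // scale1r scaler0.
have Cneg : C * neg = neg by rewrite CE mulrBl mul1r bop_scalerAl pn scaler0 subr0.
have Eneg : E * neg = neg.
  apply: bop_ext => x; rewrite bopM; apply: (cv_unique (EP (neg x))).
  move=> e e0; exists 0%N => n _; rewrite -bopM.
  have -> : C ^+ n * neg = neg.
    by elim: n => [|n IH]; rewrite ?mul1r // exprS -mulrA IH.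
  by rewrite subrr nr0 ltW.
have negE : neg * E = neg by rewrite -cE // /neg fc_comm.
exists E; split=> //; first by split=> //; case: pE.
  rewrite /ole; have -> : t%:C *: E - B * E = neg.
    have -> : t%:C *: E = t%:O * E by rewrite bop_scalerAl mul1r.
    by rewrite -mulrBl -opprB BE mulNr mulrBl posE negE sub0r opprK.
  by apply: fc_psd.
rewrite /ole; have -> : B * (1 - E) - t%:C *: (1 - E) = pos.
  have -> : t%:C *: (1 - E) = t%:O * (1 - E) by rewrite bop_scalerAl mul1r.
  rewrite -mulrBl BE mulrBr mulr1 mulrBl posE negE sub0r opprK subrK //.
by apply: fc_psd.
Qed.

(* Spectral slices s P <= B P <= t P are halved with [spectral_projection] until
   t - s <= d. *)
Lemma slice_ind (a b d : R) B D : op_itv a b B -> 0 < d ->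
  (forall P, proj P -> B * P = P * B -> D * P = P * D) ->
  (forall P s t, proj P -> B * P = P * B -> a <= s -> s <= t -> t <= b -> t - s <= d ->
     ole (s%:C *: P) (B * P) -> ole (B * P) (t%:C *: P) ->
     forall x, 0 <= rip (D (P x)) (P x)) ->
  forall x, 0 <= rip (D x) x.
Proof.
move=> iB d0 cD thin.
have key n : forall P s t, proj P -> B * P = P * B -> a <= s -> s <= t -> t <= b ->
    t - s <= d * 2 ^+ n -> ole (s%:C *: P) (B * P) -> ole (B * P) (t%:C *: P) ->
    forall x, 0 <= rip (D (P x)) (P x).
  elim: n => [|n IH] P s t pP BP as' st tb ts sP Pt x.
    by apply: thin pP BP as' st tb _ sP Pt x; rewrite expr0 mulr1 in ts.
  pose m := (s + t) / 2; have [E [pE cE BEm mBE]] := spectral_projection m iB.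
  have EP := cE _ BP; have BE : B * E = E * B by rewrite cE.
  have [sE EE] := pE; have [sP' PP] := pP; have pE' := proj_compl pE.
  have [sE' EE'] := pE'; have EP' : (1 - E) * P = P * (1 - E).
    by rewrite mulrBl mulrBr EP mul1r mulr1.
  have BE' : B * (1 - E) = (1 - E) * B by rewrite mulrBl mulrBr BE mul1r mulr1.
  have smt : s <= m <= t by rewrite /m; apply/andP; split; lra.
  have /andP[sm mt] := smt.
  have half u v : v - u = (t - s) / 2 -> v - u <= d * 2 ^+ n.
    by move=> ->; rewrite ler_pdivrMr // -mulrA -exprSr.
  have pull F U : proj F -> F * P = P * F -> B * F = F * B ->
      F * (B * P) * F = B * (P * F).
    move=> [_ FF] FP BF.
    by rewrite mulrA -BF -!mulrA (mulrA F P) FP -(mulrA P) FF.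
  have pullZ F (c : R) : proj F -> F * P = P * F ->
      F * (c%:C *: P) * F = c%:C *: (P * F).
    by move=> [_ FF] FP; rewrite bop_scalerAr bop_scalerAl FP -mulrA FF.
  have pullP F : F * P = P * F -> B * F = F * B -> P * (B * F) * P = B * (P * F).
    by move=> FP BF; rewrite mulrA -BP -!mulrA FP (mulrA P P) PP.
  have pullPZ F (c : R) : F * P = P * F -> P * (c%:C *: F) * P = c%:C *: (P * F).
    by move=> FP; rewrite bop_scalerAr bop_scalerAl -mulrA FP mulrA PP.
  have h1 : 0 <= rip (D ((P * E) x)) ((P * E) x).
    apply: (IH _ s m) => //.
    - exact: projM.
    - by rewrite mulrA BP -mulrA BE mulrA.
    - exact: le_trans tb.
    - by apply: half; rewrite /m; field.
    - by have := oleJ sE sP; rewrite pullZ // pull.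
    - by have := oleJ sP' BEm; rewrite pullPZ // pullP.
  have h2 : 0 <= rip (D ((P * (1 - E)) x)) ((P * (1 - E)) x).
    apply: (IH _ m t) => //.
    - exact: projM.
    - by rewrite mulrA BP -mulrA BE' mulrA.
    - exact: le_trans sm.
    - by apply: half; rewrite /m; field.
    - by have := oleJ sP' mBE; rewrite pullPZ // pullP.
    - by have := oleJ sE' Pt; rewrite pullZ // pull.
  have PxE : P x = (P * E) x + (P * (1 - E)) x.
    by rewrite -bopD -mulrDr addrCA subrr addr0 mulr1.
  (* D commutes with F and F G = 0, so the form of D splits over the two halves of the slice. *)
  have cross F G : proj F -> proj G -> B * F = F * B -> B * G = G * B ->
      F * G = 0 -> F * P = P * F -> G * P = P * G ->
      rip (D ((P * F) x)) ((P * G) x) = 0.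
    move=> pF pG BF BG FG FP GP; have [sF FF] := pF.
    have DF := cD F pF BF; rewrite -FP -!bopM mulrA DF -(mulrA F) bopM sF.
    by rewrite -[F _]bopM -GP mulrA FG mul0r bop0E rip0r.
  have EE1 : E * (1 - E) = 0 by rewrite mulrBr mulr1 EE subrr.
  have EE2 : (1 - E) * E = 0 by rewrite mulrBl mul1r EE subrr.
  have c1 := cross E (1 - E) pE pE' BE BE' EE1 EP EP'.
  have c2 := cross (1 - E) E pE' pE BE' BE EE2 EP' EP.
  by rewrite PxE linearD !ripE c1 c2 addr0 add0r addr_ge0.
move=> x; have [n hn] := small_inv (b - a) d0.
have hn2 : b - a <= d * 2 ^+ n.
  rewrite ler_pdivrMr ?ltr0Sn // in hn; apply: le_trans hn _.
  by rewrite ler_pM2l // -natrX ler_nat ltn_expl.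
have [aB Bb] := iB.
have p1 : proj 1 by split=> //; rewrite mulr1.
apply: (key n 1 a b p1); rewrite ?mulr1 ?mul1r //.
exact: itv_le iB.
Qed.

(** * Operator means and their representing functions *)

Record opmean (sg : bop H -> bop H -> bop H) : Prop := Opmean {
  om_psd : forall A B, psd A -> psd B -> psd (sg A B);
  om_mono : forall A B C D, psd A -> psd B -> psd C -> psd D ->
    ole A C -> ole B D -> ole (sg A B) (sg C D);
  om_transf : forall A B C, psd A -> psd B -> psd C ->
    ole (C * sg A B * C) (sg (C * A * C) (C * B * C));
  om_cvg : forall (A_ B_ : nat -> bop H) A B,
    (forall k, psd (A_ k)) -> (forall k, psd (B_ k)) -> psd A -> psd B ->
    (forall k, ole (A_ k.+1) (A_ k)) -> (forall k, ole (B_ k.+1) (B_ k)) ->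
    (forall x, cv (fun k => A_ k x) (A x)) ->
    (forall x, cv (fun k => B_ k x) (B x)) ->
    forall x, cv (fun k => sg (A_ k) (B_ k) x) (sg A B x);
  om_id : sg 1 1 = 1 }.

Definition rep_fun (sg : bop H -> bop H -> bop H) (f : R -> R) : Prop :=
  forall t : R, 0 < t -> sg 1 t%:O = (f t)%:O.

Lemma rip_inj x y : (forall z, rip x z = rip y z) -> x = y.
Proof.
move=> h; apply/eqP; rewrite -subr_eq0 -nr_eq0 -sqrf_eq0 -ripxx ripBl h subrr //.
Qed.

Lemma scalarO (c : R) T : c%:O * T = c%:C *: T.
Proof. by rewrite bop_scalerAl mul1r. Qed.

Lemma scalarOr (c : R) T : T * c%:O = c%:C *: T.
Proof. by rewrite bop_scalerAr mulr1. Qed.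

Lemma scalarO_inj (c d : R) : c%:O = d%:O :> bop H -> c = d.
Proof.
by move=> h; apply/eqP; rewrite eq_le; apply/andP; split;
  apply: oleO_le; rewrite h; exact: ole_refl.
Qed.

(** P T P is self-adjoint, so T P equals its own adjoint P T. *)
Lemma proj_comm P T : proj P -> selfadj T -> T * P = P * T * P -> T * P = P * T.
Proof.
move=> [sP PP] sT TP; rewrite TP; apply: bop_ext => x; apply: rip_inj => y.
transitivity (rip x (T (P y))); last by rewrite !bopM sP sT.
by rewrite -[T (P y)]bopM TP !bopM sP sT sP.
Qed.

Section MeanTheory.
Variable sg : bop H -> bop H -> bop H.
Hypothesis sgM : opmean sg.

(** For invertible C the transformer inequality also applies to C^-1, and conjugating back gives the
    reverse inequality. *)
Lemma om_J A B C Ci : psd A -> psd B -> psd C -> psd Ci -> C * Ci = 1 ->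
  Ci * C = 1 -> sg (C * A * C) (C * B * C) = C * sg A B * C.
Proof.
move=> pA pB pC pCi CCi CiC; apply: ole_antisym; last exact: om_transf.
have sC : selfadj C by case: pC.
have back U : Ci * (C * U * C) * Ci = U.
  by rewrite !mulrA CiC mul1r -mulrA CCi mulr1.
have back' U : C * (Ci * U * Ci) * C = U.
  by rewrite !mulrA CCi mul1r -mulrA CiC mulr1.
have := om_transf sgM (psdJ sC pA) (psdJ sC pB) pCi; rewrite !back => /(oleJ sC).
by rewrite back'.
Qed.

Lemma om_Z (c : R) A B : 0 < c -> psd A -> psd B ->
  sg (c%:C *: A) (c%:C *: B) = c%:C *: sg A B.
Proof.
move=> c0 pA pB; have s0 : 0 < Num.sqrt c by rewrite sqrtr_gt0.
have e U : (Num.sqrt c)%:O * U * (Num.sqrt c)%:O = c%:C *: U.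
  by rewrite scalarO scalarOr scalerA -rmorphM -expr2 sqr_sqrtr // ltW.
rewrite -!e (@om_J _ _ _ (Num.sqrt c)^-1%:O) //.
- exact/psdO/ltW.
- by apply: psdO; rewrite invr_ge0 ltW.
- by rewrite scalarO scalerA -rmorphM mulfV ?gt_eqF // scale1r.
- by rewrite scalarO scalerA -rmorphM mulVf ?gt_eqF // scale1r.
Qed.

Lemma om_scal (c : R) : 0 < c -> sg c%:O c%:O = c%:O.
Proof. by move=> c0; rewrite om_Z ?om_id //; exact: psd1. Qed.

Lemma om_ge (c : R) A B : 0 < c -> ole c%:O A -> ole c%:O B -> ole c%:O (sg A B).
Proof.
move=> c0 cA cB; rewrite -om_scal //; have pc := psdO (ltW c0).
by apply: om_mono => //; [exact: ole_psd cA|exact: ole_psd cB].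
Qed.

Lemma om_le (c : R) A B : 0 < c -> psd A -> psd B -> ole A c%:O -> ole B c%:O ->
  ole (sg A B) c%:O.
Proof.
by move=> c0 pA pB Ac Bc; rewrite -(om_scal c0); apply: om_mono => //; exact/psdO/ltW.
Qed.

Lemma om_pinv A B : pinv A -> pinv B -> pinv (sg A B).
Proof.
move=> [c c0 cA] [d d0 dB]; have m0 : 0 < Num.min c d by rewrite lt_min c0.
exists (Num.min c d) => //; apply: om_ge => //.
  by apply: (ole_trans _ cA); apply: oleO; rewrite ge_min lexx.
by apply: (ole_trans _ dB); apply: oleO; rewrite ge_min lexx orbT.
Qed.

Lemma om_proj_le P B : proj P -> psd B -> B * P = P * B ->
  ole (P * sg 1 B * P) (sg P (B * P)) /\ ole (sg P (B * P)) (sg 1 B).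
Proof.
move=> pP pB BP; have [sP PP] := pP; have pPp := proj_psd pP.
have BPE : P * B * P = B * P by rewrite -BP -mulrA PP.
split.
  by have := om_transf sgM psd1 pB pPp; rewrite mulr1 PP BPE.
have pBP : psd (B * P) by rewrite -BPE; exact: psdJ.
apply: om_mono => //; [exact: psd1|exact: proj_le1|].
(* B - B P = (1 - P) B (1 - P) is positive. *)
have [sP' PP'] := proj_compl pP; have := psdJ sP' pB.
by rewrite mulrBl mul1r -BP -{1}[B]mulr1 -mulrBr -mulrA PP' mulrBr mulr1.
Qed.

(** D = T - P T P, with T = 1 sigma B, is positive by [om_proj_le] and satisfies P D P = 0. Hence D
    P = 0, that is T P = P T P. *)
Lemma om_comm P B : proj P -> psd B -> B * P = P * B ->
  sg 1 B * P = P * sg 1 B.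
Proof.
move=> pP pB BP; have [sP PP] := pP.
have [h1 h2] := om_proj_le pP pB BP; have pD := ole_trans h1 h2.
have sT : selfadj (sg 1 B) by case: (om_psd sgM psd1 pB).
have pD' : psd (sg 1 B - P * sg 1 B * P) by [].
apply: proj_comm => //; apply/eqP; rewrite -subr_eq0; apply/eqP.
have -> : sg 1 B * P - P * sg 1 B * P = (sg 1 B - P * sg 1 B * P) * P.
  by rewrite mulrBl -!mulrA PP.
set D := sg 1 B - _ in pD' *; have [c c0 Dc] := bop_bound D.
apply: bop_ext => x; apply/eqP; rewrite bopM -nr_eq0 -sqrf_eq0.
rewrite eq_le sqr_ge0 andbT (le_trans (psd_nr pD' Dc _)) //.
have -> : rip (D (P x)) (P x) = rip ((P * D * P) x) x by rewrite !bopM sP.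
by rewrite /D mulrBr mulrBl !mulrA PP -(mulrA _ P P) PP subrr bop0E rip0l mulr0.
Qed.

Variable f : R -> R.
Hypothesis sgf : rep_fun sg f.

Lemma rep1 : f 1 = 1.
Proof. by apply: scalarO_inj; rewrite -sgf // scale1r om_id. Qed.

Lemma rep_mono (s t : R) : 0 < s -> s <= t -> f s <= f t.
Proof.
move=> s0 st; apply: oleO_le; have t0 := lt_le_trans s0 st.
rewrite -!sgf //; apply: om_mono => //; try exact: psd1; try exact/psdO/ltW.
  exact: ole_refl.
exact: oleO.
Qed.

Lemma rep_gt0 (t : R) : 0 < t -> 0 < f t.
Proof.
move=> t0; have m0 : 0 < Num.min 1 t by rewrite lt_min ltr01.
apply: lt_le_trans m0 _; apply: oleO_le; rewrite -sgf //.
apply: om_ge; first by rewrite lt_min ltr01.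
  by rewrite -(scale1r (1 : bop H)) -(rmorph1 (real_complex R)) scalerA -rmorphM mulr1;
    apply: oleO; rewrite ge_min lexx.
by apply: oleO; rewrite ge_min lexx orbT.
Qed.

(** f(t)/t is nonincreasing, because 1 sigma t <= (t/s) sigma t = (t/s)(1 sigma s). This serves as a
    modulus of continuity for f. *)
Lemma rep_sub (s t : R) : 0 < s -> s <= t -> f t <= t / s * f s.
Proof.
move=> s0 st; apply: oleO_le; have t0 := lt_le_trans s0 st.
rewrite rmorphM -scalerA -!sgf // -om_Z ?divr_gt0 //; [|exact: psd1|exact/psdO/ltW].
rewrite scalerA -rmorphM divfK ?gt_eqF //; apply: om_mono => //.
- exact: psd1.
- exact/psdO/ltW.
- by apply: psdO; rewrite divr_ge0 ?ltW.
- exact/psdO/ltW.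
- rewrite -[X in ole X _]scale1r -(rmorph1 (real_complex R)); apply: oleO.
  by rewrite ler_pdivlMr // mul1r.
- exact: ole_refl.
Qed.

Lemma projZ_le (c : R) P : proj P -> 0 < c -> ole ((f c)%:C *: P) (sg P (c%:C *: P)).
Proof.
move=> pP c0; have := om_transf sgM psd1 (psdO (ltW c0)) (proj_psd pP).
have [_ PP] := pP.
by rewrite sgf // mulr1 !scalarOr !bop_scalerAl !PP.
Qed.

(** f(s) P <= P sigma (s P) <= P sigma (B P) <= 1 sigma B; compression by P, which commutes with 1
    sigma B, gives the claim. *)
Lemma slice_ge (s : R) P B : proj P -> psd B -> B * P = P * B -> 0 < s ->
  ole (s%:C *: P) (B * P) -> ole ((f s)%:C *: P) (sg 1 B * P).
Proof.
move=> pP pB BP s0 sP; have [sP' PP] := pP; have pPp := proj_psd pP.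
have h1 := projZ_le pP s0; have [_ h2] := om_proj_le pP pB BP.
have psP : psd (s%:C *: P) by exact/psdZ/pPp/ltW.
have h3 : ole (sg P (s%:C *: P)) (sg P (B * P)).
  by apply: om_mono => //; [exact: ole_psd sP|exact: ole_refl].
have := oleJ sP' (ole_trans h1 (ole_trans h3 h2)).
by rewrite bop_scalerAr bop_scalerAl !PP -om_comm // -mulrA PP.
Qed.

Lemma slice_le (t : R) P B : proj P -> psd B -> B * P = P * B -> 0 < t ->
  ole (B * P) (t%:C *: P) -> ole (sg 1 B * P) ((f t)%:C *: P).
Proof.
move=> pP pB BP t0 Pt; have [sP' PP] := pP; have pPp := proj_psd pP.
have [h1 _] := om_proj_le pP pB BP.
have ptP : psd (t%:C *: P) by exact/psdZ/pPp/ltW.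
have pBP : psd (B * P) by have := psdJ sP' pB; rewrite -BP -mulrA PP.
have h2 : ole (sg P (B * P)) (sg P (t%:C *: P)).
  by apply: om_mono => //; exact: ole_refl.
have h3 : ole (sg P (t%:C *: P)) (f t)%:O.
  rewrite -sgf //; apply: om_mono => //; [exact: psd1|exact/psdO/ltW|exact: proj_le1|].
  exact/oleZ/proj_le1/pP/ltW.
have := oleJ sP' (ole_trans h1 (ole_trans h2 h3)).
by rewrite scalarOr bop_scalerAl PP !mulrA PP -om_comm // -!mulrA !PP.
Qed.

Lemma om_bounds (a b : R) B : 0 < a -> op_itv a b B -> op_itv (f a) (f b) (sg 1 B).
Proof.
move=> a0 [aB Bb]; have b0 := lt_le_trans a0 (itv_le (conj aB Bb)).
have pB : psd B := pinv_psd (itv_pinv a0 (conj aB Bb)).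
split; rewrite -sgf //; apply: om_mono => //; try exact: psd1;
  try exact/psdO/ltW; exact: ole_refl.
Qed.

End MeanTheory.

Lemma fc_sub (a b c d : R) g T : a <= c -> d <= b -> approximable a b g -> op_itv a b T ->
  op_itv c d T -> fcalc a b g T = fcalc c d g T.
Proof.
move=> ac db ag iT iT'; apply/esym/fc_eqP => // e e0.
have [p [pg pS]] := fcP ag iT e0; exists p; split=> // t /andP[ct td].
by apply: pg; rewrite (le_trans ac) // (le_trans td).
Qed.

(** B' replaces B by the scalar s off the range of P, so B' >= s holds globally and B'^r >= s^r. The
    relation B' P = P B carries this back to B^r on the range of P. *)
Lemma bpow_slice_ge (a b s r : R) P B : 0 < a -> 0 <= r <= 1 -> op_itv a b B ->
  proj P -> B * P = P * B -> a <= s -> s <= b -> ole (s%:C *: P) (B * P) ->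
  ole ((s `^ r)%:C *: P) (bpow a b B r * P).
Proof.
move=> a0 r01 iB pP BP as' sb sPB; have [sP PP] := pP.
have s0 := lt_le_trans a0 as'.
pose B' := B * P + s%:C *: (1 - P).
have iB' : op_itv s b B'.
  split.
    have := oleD sPB (ole_refl (s%:C *: (1 - P))).
    by rewrite -scalerDr addrCA subrr addr0.
  have := oleJ sP (proj2 iB); rewrite -BP -mulrA PP scalarOr bop_scalerAl PP => h.
  have := oleD h (oleZ2 sb (proj_psd (proj_compl pP))).
  by rewrite -scalerDr addrCA subrr addr0.
have iB'a : op_itv a b B'.
  by split; [apply: ole_trans (proj1 iB'); exact: oleO|exact: proj2 iB'].
have BPB : B' * P = P * B.
  by rewrite mulrDl -mulrA PP bop_scalerAl mulrBl mul1r PP subrr scaler0 addr0.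
have ap : approximable a b (fun t => t `^ r) by exact: apx_powR.
have h1 : bpow a b B' r * P = P * bpow a b B r by exact: fc_intertwine.
have h2 : bpow a b B r * P = P * bpow a b B r by exact: fc_comm.
have [h3 _] := bpow_bounds s0 r01 iB'.
have := oleJ sP h3; rewrite scalarOr bop_scalerAl PP /bpow.
by rewrite -(fc_sub _ _ ap iB'a iB') // -mulrA h1 mulrA PP -h2.
Qed.

Lemma bpow_slice_le (a b t r : R) P B : 0 < a -> 0 <= r <= 1 -> op_itv a b B ->
  proj P -> B * P = P * B -> a <= t -> t <= b -> ole (B * P) (t%:C *: P) ->
  ole (bpow a b B r * P) ((t `^ r)%:C *: P).
Proof.
move=> a0 r01 iB pP BP at' tb PBt; have [sP PP] := pP.
have t0 := lt_le_trans a0 at'.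
pose B' := B * P + t%:C *: (1 - P).
have iB' : op_itv a t B'.
  split; last first.
    have := oleD PBt (ole_refl (t%:C *: (1 - P))).
    by rewrite -scalerDr addrCA subrr addr0.
  have := oleJ sP (proj1 iB); rewrite scalarOr bop_scalerAl PP -BP -mulrA PP => h.
  have := oleD h (oleZ2 at' (proj_psd (proj_compl pP))).
  by rewrite -scalerDr addrCA subrr addr0.
have iB'a : op_itv a b B'.
  by split; [exact: proj1 iB'|apply: ole_trans (proj2 iB') _; exact: oleO].
have BPB : B' * P = P * B.
  by rewrite mulrDl -mulrA PP bop_scalerAl mulrBl mul1r PP subrr scaler0 addr0.
have ap : approximable a b (fun t => t `^ r) by exact: apx_powR.
have h1 : bpow a b B' r * P = P * bpow a b B r by exact: fc_intertwine.
have h2 : bpow a b B r * P = P * bpow a b B r by exact: fc_comm.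
have [_ h3] := bpow_bounds a0 r01 iB'.
have := oleJ sP h3; rewrite scalarOr bop_scalerAl PP /bpow.
by rewrite -(fc_sub _ _ ap iB'a iB') // -mulrA h1 mulrA PP -h2.
Qed.

Lemma commB (S T U : bop H) : S * U = U * S -> T * U = U * T ->
  (S - T) * U = U * (S - T).
Proof. by move=> SU TU; rewrite mulrBl mulrBr SU TU. Qed.

Lemma commD (S T U : bop H) : S * U = U * S -> T * U = U * T ->
  (S + T) * U = U * (S + T).
Proof. by move=> SU TU; rewrite mulrDl mulrDr SU TU. Qed.

(** On a slice s P <= B P <= t P both operators lie between f(s^r) P and f(t^r) P. Thin slices make
    these bounds close, and [slice_ind] transfers the estimate to the whole space. *)
Lemma sg_bpow sg sgr f (a b r : R) B : opmean sg -> opmean sgr ->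
  rep_fun sg f -> rep_fun sgr (fun t => f (t `^ r)) ->
  0 < a -> 0 <= r <= 1 -> op_itv a b B -> sgr 1 B = sg 1 (bpow a b B r).
Proof.
move=> sgM sgrM sgf sgrf a0 r01 iB; have ab := itv_le iB; have b0 := lt_le_trans a0 ab.
have pB : psd B := pinv_psd (itv_pinv a0 iB).
have iBr := bpow_bounds a0 r01 iB.
have pBr : psd (bpow a b B r) := pinv_psd (itv_pinv (powR_gt0 _ a0) iBr).
set T := sg 1 _; set U := sgr 1 B.
have sT : selfadj T by case: (om_psd sgM psd1 pBr).
have sU : selfadj U by case: (om_psd sgrM psd1 pB).
have fb0 : 0 < f (b `^ r) by apply: rep_gt0 sgf _ _ => //; exact: powR_gt0.
have cT P : proj P -> B * P = P * B -> T * P = P * T.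
  move=> pP BP; apply: om_comm => //; apply: fc_comm => //; exact: apx_powR.
have cU P : proj P -> B * P = P * B -> U * P = P * U.
  by move=> pP BP; exact: om_comm.
(* The width e a / f(b^r) is what f(t^r) - f(s^r) <= (t/s - 1) f(s^r) <= (t - s)/a * f(b^r)
   requires; the first inequality uses [rep_sub] and r <= 1. *)
have bound e P s t : 0 < e -> proj P -> B * P = P * B -> a <= s -> s <= t -> t <= b ->
    t - s <= e * a / f (b `^ r) -> ole (s%:C *: P) (B * P) -> ole (B * P) (t%:C *: P) ->
    forall x, `|rip (T (P x)) (P x) - rip (U (P x)) (P x)| <= e * rip (P x) (P x).
  move=> e0 pP BP as' st tb ts sPB PBt x; have s0 := lt_le_trans a0 as'.
  have t0 := lt_le_trans s0 st; have [sP PP] := pP.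
  have BrP : bpow a b B r * P = P * bpow a b B r.
    by apply: fc_comm => //; exact: apx_powR.
  have q V c : ole (c%:C *: P) (V * P) -> c * rip (P x) (P x) <= rip (V (P x)) (P x).
    by move=> /ole_rip/(_ (P x)); rewrite !bopE -!(bopM P P) PP ripZl.
  have q' V c : ole (V * P) (c%:C *: P) -> rip (V (P x)) (P x) <= c * rip (P x) (P x).
    by move=> /ole_rip/(_ (P x)); rewrite !bopE -!(bopM P P) PP ripZl.
  have h1 := q _ _ (slice_ge sgM sgf pP pBr BrP (powR_gt0 r s0)
    (bpow_slice_ge a0 r01 iB pP BP as' (le_trans st tb) sPB)).
  have h2 := q' _ _ (slice_le sgM sgf pP pBr BrP (powR_gt0 r t0)
    (bpow_slice_le a0 r01 iB pP BP (le_trans as' st) tb PBt)).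
  have h3 := q _ _ (slice_ge sgrM sgrf pP pB BP s0 sPB).
  have h4 := q' _ _ (slice_le sgrM sgrf pP pB BP t0 PBt).
  have pp : 0 <= rip (P x) (P x) by rewrite ripxx sqr_ge0.
  have /andP[r0 r1] := r01.
  have str : s `^ r <= t `^ r by apply: ge0_ler_powR => //; rewrite nnegrE ltW.
  have tbr : t `^ r <= b `^ r by apply: ge0_ler_powR => //; rewrite nnegrE ltW.
  have ft : f (t `^ r) - f (s `^ r) <= e.
    have k1 := rep_sub sgM sgf (powR_gt0 r s0) str.
    have k2 : t `^ r / s `^ r <= t / s.
      have ts1 : 1 <= t / s by rewrite ler_pdivlMr // mul1r.
      have := ler_powR ts1 r1; rewrite powRr1 ?divr_ge0 ?(ltW s0) ?(ltW t0) // => h.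
      apply: le_trans h.
      rewrite powRM ?invr_ge0 ?(ltW s0) ?(ltW t0) // -(powR_inv1 (ltW s0)).
      by rewrite -powRrM mulN1r powRN.
    have k3 : f (s `^ r) <= f (b `^ r).
      by apply: (rep_mono sgM sgf); [exact: powR_gt0|exact: le_trans tbr].
    have k4 := rep_gt0 sgM sgf (powR_gt0 r s0).
    have k5 : (t / s - 1) * f (s `^ r) <= (t - s) / a * f (b `^ r).
      have -> : t / s - 1 = (t - s) / s by field; rewrite gt_eqF.
      apply: ler_pM => //; [|exact: ltW|].
        by rewrite divr_ge0 ?subr_ge0 // ltW.
      by rewrite ler_wpM2l ?subr_ge0 // lef_pV2 ?posrE.
    have k6 : (t - s) / a * f (b `^ r) <= e.
      by rewrite -ler_pdivlMr // ler_pdivrMr // mulrAC.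
    have k7 : t `^ r / s `^ r * f (s `^ r) <= t / s * f (s `^ r).
      by rewrite ler_wpM2r // ltW.
    lra.
  have h5 : (f (t `^ r) - f (s `^ r)) * rip (P x) (P x) <= e * rip (P x) (P x).
    by rewrite ler_wpM2r.
  by rewrite ler_norml; apply/andP; split; lra.
have half e : 0 < e -> forall x, `|rip (T x) x - rip (U x) x| <= e * nr x ^+ 2.
  move=> e0 x; have d0 : 0 < e * a / f (b `^ r) by rewrite divr_gt0 // mulr_gt0.
  have cO (P : bop H) : e%:O * P = P * e%:O by rewrite scalarO scalarOr.
  have k1 := slice_ind iB d0 (D := T - U + e%:O).
  have k2 := slice_ind iB d0 (D := U - T + e%:O).
  have {k1} : 0 <= rip ((T - U + e%:O) x) x.
    apply: k1 => [P pP BP|P s t pP BP as' st tb ts sPB PBt y].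
      by apply: commD (commB (cT _ pP BP) (cU _ pP BP)) (cO _).
    have := bound e P s t e0 pP BP as' st tb ts sPB PBt y.
    by rewrite !bopE !ripE ler_norml => /andP[]; lra.
  have {k2} : 0 <= rip ((U - T + e%:O) x) x.
    apply: k2 => [P pP BP|P s t pP BP as' st tb ts sPB PBt y].
      by apply: commD (commB (cU _ pP BP) (cT _ pP BP)) (cO _).
    have := bound e P s t e0 pP BP as' st tb ts sPB PBt y.
    by rewrite !bopE !ripE ler_norml => /andP[]; lra.
  by rewrite !bopE !ripE ripxx ler_norml => ? ?; apply/andP; split; lra.
have TU x : rip (T x) x = rip (U x) x.
  apply/eqP; rewrite -subr_eq0 -normr_eq0 eq_le normr_ge0 andbT.
  by apply: (@le_eps _ (nr x ^+ 2)) => [|e e0]; [exact: sqr_ge0|exact: half].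
apply: ole_antisym; apply/oleP => // x; rewrite TU //.
Qed.

Lemma om_repr sg A B S Si : opmean sg -> pinv A -> pinv B -> pinv S -> pinv Si ->
  S * S = A -> S * Si = 1 -> Si * S = 1 -> sg A B = S * sg 1 (Si * B * Si) * S.
Proof.
move=> sgM pA pB pS pSi SS SSi SiS.
have pB' : psd (Si * B * Si) := psdJ (pinv_sa pSi) (pinv_psd pB).
rewrite -(om_J sgM psd1 pB' (pinv_psd pS) (pinv_psd pSi)) // mulr1 SS.
by rewrite !mulrA SSi mul1r -mulrA SiS mulr1.
Qed.

(** * Strict monotonicity of the representing function *)

Lemma ip_bound x y : complex.Re `|ip x y| <= nr x * nr y.
Proof.
set z := ip x y; set m := complex.Re `|z|.
have mE : `|z| = m%:C by rewrite /m RRe_real // realE normr_ge0.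
have m0 : 0 <= m by rewrite -ler0c -mE.
have [->|mn] := eqVneq m 0; first by rewrite mulr_ge0 ?nr_ge0.
have mp : 0 < m by rewrite lt_def mn.
rewrite -(ler_pM2l mp) mulrA.
have -> : m * nr x = nr (z^*%C *: x) by rewrite nrZ normcJ.
apply: le_trans (CauchySchwarz _ _).
by rewrite /rip linearZl_LR /= -/z [_ * z]mulrC -sqr_normc mE -rmorphXn /= expr2.
Qed.

Lemma rank1_subproof e : bounded_operator (fun x => ip x e *: e).
Proof.
apply: bounded_operatorP => [a x y|].
  by rewrite linearPl /= scalerDl scalerA.
exists (nr e * nr e) => [|x]; first by rewrite mulr_ge0 ?nr_ge0.
by rewrite nrZ mulrAC ler_wpM2r ?nr_ge0 // mulrC ip_bound.
Qed.

Definition rank1 e : bop H := Bop (rank1_subproof e).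

Lemma rank1E e x : rank1 e x = ip x e *: e. Proof. by []. Qed.

Lemma rank1_sa e : selfadj (rank1 e).
Proof.
move=> x y; rewrite !rank1E (ripC x) /rip !linearZl_LR /= (ipC e y) (ipC e x).
by case: (ip x e) => a b; case: (ip y e) => c d /=; ring.
Qed.

Lemma rank1_form e x :
  rip (rank1 e x) x = complex.Re (ip x e) ^+ 2 + complex.Im (ip x e) ^+ 2.
Proof.
rewrite rank1E /rip linearZl_LR /= (ipC e x).
by case: (ip x e) => a b /=; ring.
Qed.

Lemma ipxx x : ip x x = (nr x ^+ 2)%:C.
Proof. by rewrite rmorphXn /= -nrE ip_norm. Qed.

Lemma rank1_proj e : nr e = 1 -> proj (rank1 e).
Proof.
move=> e1; split; first exact: rank1_sa.
apply: bop_ext => x; rewrite bopM !rank1E linearZl_LR /= ipxx e1 expr1n mulr1 //.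
Qed.

Lemma proj_add_orth P Q : proj P -> proj Q -> P * Q = 0 -> Q * P = 0 -> ole Q (1 - P).
Proof.
move=> [sP PP] [sQ QQ] PQ QP; rewrite /ole -addrA -opprD; apply: proj_psd.
apply: proj_compl; split; first exact: saD.
by rewrite mulrDl !mulrDr PP QQ PQ QP addr0 add0r.
Qed.

Section ScalarConvexity.
Variables (sg : bop H -> bop H -> bop H) (f : R -> R).
Hypotheses (sgM : opmean sg) (sgf : rep_fun sg f).
Variables (e1 e2 : H).
Hypotheses (e1n : nr e1 = 1) (e2n : nr e2 = 1) (e12 : ip e1 e2 = 0).

Section TwoLevels.
Variables u v l : R.
Hypotheses (u0 : 0 < u) (v0 : 0 < v) (l01 : 0 <= l <= 1).

(** B has the eigenvalue u on e1 and v on its orthogonal complement, and the unit vector e carries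
    the weights l and 1 - l, so that <B e, e> = l u + (1 - l) v. *)
Let c := Num.sqrt l.
Let s := Num.sqrt (1 - l).
Let e := c%:C *: e1 + s%:C *: e2.
Let P := rank1 e.
Let Q := rank1 e1.
Let B := u%:C *: Q + v%:C *: (1 - Q).

Let cc : c * c = l.
Proof. by case/andP: l01 => l0 _; rewrite -expr2 sqr_sqrtr. Qed.

Let ss : s * s = 1 - l.
Proof. by case/andP: l01 => _ l1; rewrite -expr2 sqr_sqrtr // subr_ge0. Qed.

Let e21 : ip e2 e1 = 0. Proof. by rewrite ipC e12 conjc0. Qed.

Let ip_e x : ip x e = c%:C * ip x e1 + s%:C * ip x e2.
Proof.
rewrite /e linearDr !linearZr_LR /=.
by congr (_ + _); congr (_ * _); rewrite -[LHS]/((_%:C)^*%C) conjc_real.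
Qed.

Let ee1 : ip e e1 = c%:C.
Proof. by rewrite /e linearDl !linearZl_LR /= ipxx e1n e21 expr1n mulr1 mulr0 addr0. Qed.

Let ee2 : ip e e2 = s%:C.
Proof. by rewrite /e linearDl !linearZl_LR /= ipxx e2n e12 expr1n mulr1 mulr0 add0r. Qed.

Let en : nr e = 1.
Proof.
have : ip e e = 1 by rewrite ip_e ee1 ee2 -!rmorphM -rmorphD /= cc ss addrC subrK.
rewrite ipxx => /complexI h; apply/eqP; rewrite -(@eqrXn2 _ 2) ?nr_ge0 //.
by rewrite h expr1n.
Qed.

Let pP : proj P := rank1_proj en.
Let pQ : proj Q := rank1_proj e1n.
Let pQ' : proj (1 - Q) := proj_compl pQ.

Let Pe : P e = e.
Proof. by rewrite rank1E ipxx en expr1n scale1r. Qed.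

Let BQ : B * Q = u%:C *: Q.
Proof.
have [_ QQ] := pQ; rewrite /B mulrDl !bop_scalerAl mulrBl mul1r QQ subrr.
by rewrite scaler0 addr0.
Qed.

Let QB : Q * B = u%:C *: Q.
Proof.
have [_ QQ] := pQ; rewrite /B mulrDr !bop_scalerAr mulrBr mulr1 QQ subrr.
by rewrite scaler0 addr0.
Qed.

Let BQ' : B * (1 - Q) = v%:C *: (1 - Q).
Proof. by rewrite mulrBr mulr1 BQ /B addrC addKr. Qed.

Let Q'B : (1 - Q) * B = v%:C *: (1 - Q).
Proof. by rewrite mulrBl mul1r QB /B addrC addKr. Qed.

Let pB : psd B.
Proof. by apply: psdD; apply: psdZ; rewrite ?(ltW u0) ?(ltW v0) //; exact: proj_psd. Qed.

(** On each eigenspace the slice bounds hold with equal end values and therefore pin down the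
    operator. *)
Let T_eq : sg 1 B = (f u)%:C *: Q + (f v)%:C *: (1 - Q).
Proof.
have TQ : sg 1 B * Q = (f u)%:C *: Q.
  by apply: ole_antisym; [apply: (slice_le sgM sgf)|apply: (slice_ge sgM sgf)];
    rewrite ?BQ ?QB //; exact: ole_refl.
have TQ' : sg 1 B * (1 - Q) = (f v)%:C *: (1 - Q).
  by apply: ole_antisym; [apply: (slice_le sgM sgf)|apply: (slice_ge sgM sgf)];
    rewrite ?BQ' ?Q'B //; exact: ole_refl.
by rewrite -TQ -TQ' -mulrDr addrCA subrr addr0 mulr1.
Qed.

Let form_e (p q : R) :
  rip ((p%:C *: Q + q%:C *: (1 - Q)) e) e = l * p + (1 - l) * q.
Proof.
rewrite bopD !bopZ bopB bop1E ripDl !ripZl ripBl ripxx en expr1n.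
by rewrite /Q rank1_form ee1 /= expr0n addr0 expr2 cc; ring.
Qed.

(* Jensen's inequality, from compressing B to the line spanned by e *)
Lemma rep_concave : l * f u + (1 - l) * f v <= f (l * u + (1 - l) * v).
Proof.
set b := l * u + (1 - l) * v; have /andP[l0 l1] := l01.
have b0 : 0 < b.
  have [l00|ln] := eqVneq l 0; first by rewrite /b l00 mul0r add0r subr0 mul1r.
  have lp : 0 < l by rewrite lt_def ln.
  have : 0 < l * u by rewrite mulr_gt0.
  have : 0 <= (1 - l) * v by rewrite mulr_ge0 ?(ltW v0) // subr_ge0.
  by rewrite /b; lra.
have PBP : P * B * P = b%:C *: P.
  apply: bop_ext => x; rewrite !bopM bopZ [P x]rank1E linearZ linearZ /=.
  rewrite [LHS]scalerA [RHS]scalerA mulrC; congr (_ *: _); congr (_ * _).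
  have -> : u%:C *: (ip e e1 *: e1) + v%:C *: (e - ip e e1 *: e1) =
      (u * c)%:C *: e1 + (v * s)%:C *: e2.
    by rewrite ee1 {1}/e addrAC subrr add0r !scalerA -!rmorphM.
  rewrite linearDl !linearZl_LR /= ![ip _ e]ip_e !ipxx e1n e2n e12 e21 !mulr0.
  rewrite !expr1n addr0 add0r !mulr1 -!rmorphM -rmorphD /=; congr (_%:C).
  by rewrite /b -!mulrA cc ss; ring.
have := om_transf sgM psd1 pB (proj_psd pP); rewrite mulr1 PBP (proj2 pP) => h1.
have h2 : ole (sg P (b%:C *: P)) (f b)%:O.
  rewrite -sgf //; have pPp := proj_psd pP; apply: om_mono => //.
  - exact/psdZ/pPp/ltW.
  - exact: psd1.
  - exact/psdO/ltW.
  - exact: proj_le1.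
  - exact/oleZ/proj_le1/pP/ltW.
have := ole_rip (ole_trans h1 h2) e; have [sP _] := pP.
by rewrite !bopM sP !Pe T_eq form_e bopZ ripZl bop1E ripxx en expr1n mulr1.
Qed.

(* a e e^* <= B as soon as a <B^-1 e, e> <= 1. *)
Lemma rep_harmonic a : 0 < a -> a * (l / u + (1 - l) / v) <= 1 ->
  f a <= l * f u + (1 - l) * f v.
Proof.
move=> a0 al.
have aPB : ole (a%:C *: P) B.
  apply/oleP => [||x].
  - by apply: saZ; case: pP.
  - by case: pB.
  have Q2 : rip (rank1 e2 x) x <= nr x ^+ 2 - rip (Q x) x.
    have p2 : proj (rank1 e2) by exact: rank1_proj.
    have o12 : Q * rank1 e2 = 0.
      by apply: bop_ext => y; rewrite bopM [rank1 e2 y]rank1E linearZ /= e21 scale0r scaler0.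
    have o21 : rank1 e2 * Q = 0.
      by apply: bop_ext => y; rewrite bopM [Q y]rank1E linearZ /= e12 scale0r scaler0.
    by have := ole_rip (proj_add_orth pQ p2 o12 o21) x; rewrite bopB ripBl ripxx.
  rewrite /B bopD !bopZ bopB bop1E ripDl !ripZl ripBl ripxx.
  apply: (@le_trans _ _ (u * rip (Q x) x + v * rip (rank1 e2 x) x)); last first.
    by rewrite lerD2l ler_pM2l.
  rewrite !rank1_form ip_e.
  (* Weighted Cauchy-Schwarz with an explicit square as remainder, used for the real and the
     imaginary parts of the coordinates. *)
  have key p q : a * (c * p + s * q) ^+ 2 <= u * p ^+ 2 + v * q ^+ 2.
    have k1 : (c * p + s * q) ^+ 2 <= (l / u + (1 - l) / v) * (u * p ^+ 2 + v * q ^+ 2).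
      rewrite -ss -cc -subr_ge0.
      have -> : (c * c / u + s * s / v) * (u * p ^+ 2 + v * q ^+ 2) - (c * p + s * q) ^+ 2 =
          (c * v * q - s * u * p) ^+ 2 / (u * v).
        by field; rewrite !gt_eqF.
      by rewrite divr_ge0 ?sqr_ge0 // mulr_ge0 // ltW.
    have k2 : 0 <= u * p ^+ 2 + v * q ^+ 2.
      by rewrite addr_ge0 // mulr_ge0 ?sqr_ge0 // ltW.
    have k3 : a * (c * p + s * q) ^+ 2 <=
        a * ((l / u + (1 - l) / v) * (u * p ^+ 2 + v * q ^+ 2)) by rewrite ler_pM2l.
    apply: le_trans k3 _; rewrite mulrA -[leRHS]mul1r.
    exact: ler_wpM2r.
  case: (ip x e1) => p1 p2; case: (ip x e2) => q1 q2 /=.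
  rewrite !mul0r !subr0 !addr0.
  by have := key p1 q1; have := key p2 q2; lra.
have h1 := projZ_le sgM sgf pP a0.
have pPp := proj_psd pP.
have h2 : ole (sg P (a%:C *: P)) (sg 1 B).
  apply: om_mono => //; [exact/psdZ/pPp/ltW|exact: psd1|exact: proj_le1].
have := ole_rip (ole_trans h1 h2) e.
by rewrite T_eq form_e bopZ ripZl Pe ripxx en expr1n mulr1.
Qed.

End TwoLevels.

(* Concavity of f and convexity of f(1/u) together force f to be constant as
   soon as it takes the same value twice. *)
Lemma rep_strict s t : (exists u v, [/\ 0 < u, 0 < v & f u != f v]) ->
  0 < s -> s < t -> f s < f t.
Proof.
move=> [u [v [u0 v0 fuv]]] s0 st; have t0 := lt_trans s0 st.
rewrite lt_neqAle (rep_mono sgM sgf s0 (ltW st)) andbT; apply: contra_neq fuv => fst.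
suff cst (z : R) : 0 < z -> f z = f s by rewrite !cst.
move=> z0; have [zs|sz] := ltP z s.
  apply/eqP; rewrite eq_le (rep_mono sgM sgf z0 (ltW zs)) /=.
  (* The weight with l/z + (1 - l)/t = 1/s; the harmonic inequality then gives f(s) <= l f(z) + (1 -
     l) f(t), hence f(s) <= f(z). *)
  pose l := (s^-1 - t^-1) / (z^-1 - t^-1).
  have tz : 0 < z^-1 - t^-1 by rewrite subr_gt0 ltf_pV2 ?posrE // (lt_trans zs).
  have ts : 0 < s^-1 - t^-1 by rewrite subr_gt0 ltf_pV2.
  have lp : 0 < l by rewrite divr_gt0.
  have l1 : l <= 1 by rewrite ler_pdivrMr // mul1r lerB // lef_pV2 ?posrE // ltW.
  have := @rep_harmonic z t l z0 t0 _ s s0; rewrite (ltW lp) l1 => /(_ isT).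
  have -> : l / z + (1 - l) / t = s^-1.
    have -> : l / z + (1 - l) / t = l * (z^-1 - t^-1) + t^-1 by ring.
    by rewrite /l divfK ?gt_eqF // subrK.
  rewrite mulfV ?gt_eqF // lexx -fst => /(_ isT) h.
  have {}h : l * f s <= l * f z by lra.
  by rewrite ler_pM2l in h.
have [zt|tz] := leP z t.
  apply/eqP; rewrite eq_le (rep_mono sgM sgf s0 sz) andbT fst.
  by apply: (rep_mono sgM sgf z0).
apply/eqP; rewrite eq_le (rep_mono sgM sgf s0 sz) andbT.
(* Here t = l s + (1 - l) z, and concavity forces f(z) <= f(s). *)
pose l := (z - t) / (z - s).
have zs' : 0 < z - s by rewrite subr_gt0 (lt_trans st).
have l0 : 0 <= l by rewrite divr_ge0 ?subr_ge0 ?(ltW tz) // ltW.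
have l1 : l < 1 by rewrite ltr_pdivrMr // mul1r ltrD2l ltrN2.
have := @rep_concave s z l s0 z0; rewrite l0 (ltW l1) => /(_ isT).
have -> : l * s + (1 - l) * z = t.
  have -> : l * s + (1 - l) * z = z - l * (z - s) by ring.
  by rewrite /l divfK ?gt_eqF // opprB addrCA subrr addr0.
rewrite -fst => h; have {}h : (1 - l) * f z <= (1 - l) * f s by lra.
by rewrite ler_pM2l ?subr_gt0 // in h.
Qed.

(** Concavity between t/g and 2b makes f drop by at least a fixed d from t to t/g. The reference
    point 2b, beyond b, keeps f(2b) - f(b) positive even for t = b. *)
Lemma rep_contract a b g : (exists u v, [/\ 0 < u, 0 < v & f u != f v]) ->
  0 < a -> a <= b -> 1 < g ->
  exists beta, [/\ 0 < beta, beta < 1 &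
    forall t, a <= t <= b -> f (t / g) <= beta * f t].
Proof.
move=> fnc a0 ab g1; have b0 := lt_le_trans a0 ab; have g0 := lt_trans ltr01 g1.
have b2 : b < 2 * b by lra.
have fb0 := rep_gt0 sgM sgf b0; have fb := rep_strict fnc b0 b2.
(* The first factor is the least possible weight of 2b in writing t between t/g and 2b. As f(t) <=
   f(b), subtracting d costs at least the factor 1 - d / f(b); the maximum with 1/2 below keeps beta
   positive. *)
pose d := a * (1 - g^-1) / (2 * b) * (f (2 * b) - f b).
have gV : g^-1 < 1 by rewrite invf_lt1.
have d0 : 0 < d.
  by rewrite mulr_gt0 ?subr_gt0 // divr_gt0 ?mulr_gt0 ?subr_gt0.
exists (Num.max 2^-1 (1 - d / f b)); split.
- by rewrite lt_max invr_gt0 ltr0n.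
- by rewrite gt_max; apply/andP; split; [lra|rewrite ltrBlDr ltrDl divr_gt0].
move=> t /andP[at' tb]; have t0 := lt_le_trans a0 at'.
have tg0 : 0 < t / g by rewrite divr_gt0.
have tgt : t / g < t by rewrite ltr_pdivrMr // ltr_pMr.
have ft0 := rep_gt0 sgM sgf t0; have ftb := rep_mono sgM sgf t0 tb.
pose m := (t - t / g) / (2 * b - t / g).
have bt : 0 < 2 * b - t / g by lra.
have m0 : 0 < m by rewrite divr_gt0 // subr_gt0.
have m1 : m <= 1 by rewrite ler_pdivrMr // mul1r; lra.
have m01 : 0 <= m <= 1 by rewrite (ltW m0).
have b20 : 0 < 2 * b by lra.
have := rep_concave b20 tg0 m01.
have -> : m * (2 * b) + (1 - m) * (t / g) = t.
  have -> : m * (2 * b) + (1 - m) * (t / g) = m * (2 * b - t / g) + t / g by ring.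
  by rewrite /m divfK ?gt_eqF // subrK.
move=> h; have ftg : f (t / g) <= f b.
  by apply: (rep_mono sgM sgf) => //; lra.
have md : a * (1 - g^-1) / (2 * b) <= m.
  have -> : m = t * (1 - g^-1) / (2 * b - t / g) by rewrite /m mulrBr mulr1.
  apply: ler_pM.
  - by rewrite mulr_ge0 ?subr_ge0 // ltW.
  - by rewrite invr_ge0 ltW.
  - by rewrite ler_wpM2r // subr_ge0 ltW.
  - by rewrite lef_pV2 ?posrE //; lra.
have dm : d <= m * (f (2 * b) - f (t / g)).
  apply: ler_pM => //.
  - by rewrite divr_ge0 ?mulr_ge0 ?subr_ge0 // ltW.
  - by rewrite subr_ge0 ltW.
  - by lra.
have h2 : f (t / g) <= f t - d by lra.
have h3 : f t * (d / f b) <= d by rewrite mulrCA ger_pMr // ler_pdivrMr // mul1r.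
apply: (@le_trans _ _ ((1 - d / f b) * f t)); first by lra.
by rewrite ler_wpM2r ?(ltW ft0) // le_max lexx orbT.
Qed.

Lemma om_contract1 a b alpha B : (exists u v, [/\ 0 < u, 0 < v & f u != f v]) ->
  0 < a -> op_itv a b B -> 1 < alpha ->
  exists beta, [/\ 0 < beta, beta < 1 &
    ole (sg 1 (alpha^-1%:C *: B)) (beta%:C *: sg 1 B)].
Proof.
move=> fnc a0 iB al1; have ab := itv_le iB; have al0 := lt_trans ltr01 al1.
(* alpha is split as g g: one factor g yields the contraction, the other absorbs the slice width,
   since t - s <= a (g - 1) gives t/alpha <= s/g. *)
pose g := Num.sqrt alpha.
have gg : g * g = alpha by rewrite -expr2 sqr_sqrtr // ltW.
have g1 : 1 < g by rewrite -[1]sqrtr1 ltr_sqrt.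
have g0 := lt_trans ltr01 g1.
have [beta [be0 be1 fb]] := rep_contract fnc a0 ab g1.
exists beta; split=> //.
have pB : psd B := pinv_psd (itv_pinv a0 iB).
have pB' : psd (alpha^-1%:C *: B) by apply: psdZ => //; rewrite invr_ge0 ltW.
set T := sg 1 B; set T' := sg 1 _.
have sT : selfadj T by case: (om_psd sgM psd1 pB).
have sT' : selfadj T' by case: (om_psd sgM psd1 pB').
have d0 : 0 < a * (g - 1) by rewrite mulr_gt0 // subr_gt0.
split; first by apply: saB => //; exact: saZ.
apply: (slice_ind iB d0) => [P pP BP|P s t pP BP as' st tb ts sPB PBt x].
  apply: commB; last by apply: om_comm => //; rewrite bop_scalerAl bop_scalerAr BP.
  by rewrite bop_scalerAl bop_scalerAr /T om_comm.
have s0 := lt_le_trans a0 as'; have t0 := lt_le_trans s0 st; have [sP PP] := pP.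
have BP' : alpha^-1%:C *: B * P = P * (alpha^-1%:C *: B).
  by rewrite bop_scalerAl bop_scalerAr BP.
have h1 := slice_ge sgM sgf pP pB BP s0 sPB.
have ta0 : 0 < t / alpha by rewrite divr_gt0.
have h2 : ole (T' * P) ((f (t / alpha))%:C *: P).
  apply: (slice_le sgM sgf) => //; rewrite bop_scalerAl mulrC rmorphM -scalerA.
  by apply: oleZ => //; rewrite invr_ge0 ltW.
have := ole_rip h1 (P x); have := ole_rip h2 (P x).
rewrite !bopM !bopZ -!(bopM P P) PP !ripZl bopB ripBl bopZ ripZl => k1 k2.
have pp : 0 <= rip (P x) (P x) by rewrite ripxx sqr_ge0.
have k3 : f (t / alpha) <= beta * f s.
  apply: le_trans (fb s _); last by rewrite as' (le_trans st).
  apply: (rep_mono sgM sgf) => //.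
  rewrite -gg invfM mulrA ler_pM2r ?invr_gt0 // ler_pdivrMr //.
  have : a * (g - 1) <= s * (g - 1) by rewrite ler_wpM2r // subr_ge0 ltW.
  lra.
have k4 := ler_wpM2r pp k3; have k5 := ler_wpM2l (ltW be0) k2.
by rewrite subr_ge0; apply: le_trans k1 _; apply: le_trans k4 _; rewrite -mulrA.
Qed.

(** Homogeneity moves alpha into the second argument as alpha^-1, and congruence by X^1/2 makes the
    first argument 1. *)
Lemma om_contract alpha X A : (exists u v, [/\ 0 < u, 0 < v & f u != f v]) ->
  pinv X -> pinv A -> 1 < alpha ->
  exists beta, [/\ 0 < beta, beta < 1 &
    ole (sg (alpha%:C *: X) A) ((beta * alpha)%:C *: sg X A)].
Proof.
move=> fnc pX pA al1; have al0 := lt_trans ltr01 al1.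
have [S [pS SS _]] := pinv_sqrt pX; have [Si [pSi SiS SSi]] := pinv_inv pS.
have pB : pinv (Si * A * Si) := pinvJ (pinv_sa pSi) SSi pA.
have [a [b [a0 _ iB]]] := pinv_itv pB.
have [beta [be0 be1 h]] := om_contract1 fnc a0 iB al1.
exists beta; split=> //.
have pA' : pinv (alpha^-1%:C *: A) by apply: pinvZ => //; rewrite invr_gt0.
have -> : sg (alpha%:C *: X) A = alpha%:C *: sg X (alpha^-1%:C *: A).
  by rewrite -(om_Z sgM al0 (pinv_psd pX) (pinv_psd pA')) scalerA -rmorphM mulfV ?gt_eqF // scale1r.
rewrite mulrC rmorphM -scalerA; apply: oleZ; first exact: ltW.
rewrite (om_repr sgM pX pA pS pSi SS SSi SiS) (om_repr sgM pX pA' pS pSi SS SSi SiS).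
rewrite bop_scalerAr bop_scalerAl.
by have := oleJ (pinv_sa pS) h; rewrite bop_scalerAr bop_scalerAl.
Qed.

End ScalarConvexity.

(** * Fixed points of the deformed equation *)

Lemma common_small (I : finType) (P : I -> R -> Prop) :
  (forall j, exists2 c, 0 < c & P j c) ->
  (forall j c d, 0 < d -> d <= c -> P j c -> P j d) ->
  exists2 c, 0 < c & forall j, P j c.
Proof.
move=> ex dn; have /choice[c cP] : forall j, exists c, 0 < c /\ P j c.
  by move=> j; have [d d0 Pd] := ex j; exists d.
have m0 : 0 < \big[Num.min/1]_j c j by apply: lt_bigmin => // j _; case: (cP j).
exists (\big[Num.min/1]_j c j) => // j.
by apply: dn (proj2 (cP j)) => //; exact: bigmin_le.
Qed.

Record nmean (n : nat) (M : ('I_n -> bop H) -> bop H) : Prop := Nmean {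
  nm_pinv : forall A, (forall j, pinv (A j)) -> pinv (M A);
  nm_mono : forall A B, (forall j, pinv (A j)) -> (forall j, pinv (B j)) ->
    (forall j, ole (A j) (B j)) -> ole (M A) (M B);
  nm_Z : forall (c : R) A, 0 < c -> (forall j, pinv (A j)) ->
    M (fun j => c%:C *: A j) = c%:C *: M A;
  nm_cvg : forall (A_ : nat -> 'I_n -> bop H) A,
    (forall k j, pinv (A_ k j)) -> (forall j, pinv (A j)) ->
    (forall j k, ole (A_ k.+1 j) (A_ k j)) ->
    (forall j x, cv (fun k => A_ k j x) (A j x)) ->
    forall x, cv (fun k => M (A_ k) x) (M A x);
  nm_id : M (fun=> 1) = 1 }.

(** A constant f equals 1, and [om_bounds] squeezes 1 sigma E between 1 and 1 for invertible E.
    Positive operators that may be singular are reached from above through A + 1/(k+1) and B +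
    1/(k+1). *)
Lemma om_trivial sg f A B : opmean sg -> rep_fun sg f ->
  (forall u v, 0 < u -> 0 < v -> f u = f v) -> psd A -> psd B -> sg A B = A.
Proof.
move=> sgM sgf fcst pA pB.
have f1 u : 0 < u -> f u = 1 by move=> u0; rewrite (fcst _ 1) // (rep1 sgM sgf).
have inv C D : pinv C -> pinv D -> sg C D = C.
  move=> pC pD; have [S [pS SS _]] := pinv_sqrt pC.
  have [Si [pSi SiS SSi]] := pinv_inv pS.
  rewrite (om_repr sgM pC pD pS pSi SS SSi SiS).
  have pE := pinvJ (pinv_sa pSi) SSi pD.
  have [a [b [a0 ab iE]]] := pinv_itv pE.
  have := om_bounds sgM sgf a0 iE; rewrite !f1 // ?(lt_le_trans a0) // => -[h1 h2].
  by rewrite -(ole_antisym h1 h2) scale1r mulr1 SS.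
pose d k := k.+1%:R^-1 : R.
have d0 k : 0 < d k by rewrite invr_gt0.
have pd C k : psd C -> pinv (C + (d k)%:O).
  move=> pC; exists (d k) => //; rewrite -[X in ole X _]add0r.
  by apply: oleD; [exact/ole0|exact: ole_refl].
have dd C k : ole (C + (d k.+1)%:O) (C + (d k)%:O).
  apply: oleD; [exact: ole_refl|apply: oleO].
  by rewrite lef_pV2 ?posrE // ler_nat.
have dc C x : cv (fun k => (C + (d k)%:O) x) (C x).
  move=> e e0; have [N hN] := small_inv (nr x) e0; exists N => k Nk.
  rewrite bopD addrC addKr bopZ nrZr gtr0_norm //; apply: le_trans hN.
  by rewrite mulrC ler_wpM2l ?nr_ge0 // lef_pV2 ?posrE // ler_nat.
apply: bop_ext => x.
have := om_cvg sgM (fun k => pinv_psd (pd A k pA)) (fun k => pinv_psd (pd B k pB))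
  pA pB (dd A) (dd B) (dc A) (dc B) x.
have -> : (fun k => sg (A + (d k)%:O) (B + (d k)%:O) x) = (fun k => (A + (d k)%:O) x).
  by apply/funext => k; rewrite inv //; exact: pd.
by move/cv_unique; apply; exact: dc.
Qed.

Section FixedPoint.
Variables (n : nat) (M : ('I_n -> bop H) -> bop H) (MM : nmean M).
Variables (sg : bop H -> bop H -> bop H) (f : R -> R).
Hypotheses (sgM : opmean sg) (sgf : rep_fun sg f).
Hypothesis fnc : exists u v, [/\ 0 < u, 0 < v & f u != f v].
Hypothesis orth : exists e1 e2, [/\ nr e1 = 1, nr e2 = 1 & ip e1 e2 = 0].
Variable A : 'I_n -> bop H.
Hypothesis pA : forall j, pinv (A j).

Let F X := M (fun j => sg X (A j)).

Lemma nm_scal (c : R) : 0 < c -> M (fun=> c%:O) = c%:O.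
Proof. by move=> c0; rewrite nm_Z ?nm_id // => _; exact: pinv1. Qed.

Let sgA X : pinv X -> forall j, pinv (sg X (A j)).
Proof. by move=> pX j; exact: om_pinv. Qed.

Let F_mono X Y : pinv X -> pinv Y -> ole X Y -> ole (F X) (F Y).
Proof.
move=> pX pY XY; apply: (nm_mono MM) => [||j]; [exact: sgA|exact: sgA|].
by apply: (om_mono sgM) => //; try exact: pinv_psd; exact: ole_refl.
Qed.

Let F_contract alpha X : pinv X -> 1 < alpha -> exists beta,
  [/\ 0 < beta, beta < 1 & ole (F (alpha%:C *: X)) ((beta * alpha)%:C *: F X)].
Proof.
move=> pX al1; have al0 := lt_trans ltr01 al1; have [e1 [e2 [e1n e2n e12]]] := orth.
pose P j d := ole (sg (alpha%:C *: X) (A j)) (((1 - d) * alpha)%:C *: sg X (A j)).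
have [|j c d d0 dc|c c0 cP] := @common_small _ P.
- move=> j; have [beta [b0 b1 h]] := om_contract sgM sgf e1n e2n e12 fnc pX (pA j) al1.
  by exists (1 - beta); rewrite ?subr_gt0 // /P opprB addrCA subrr addr0.
- move=> h; apply: ole_trans h _; apply: oleZ2; last exact/pinv_psd/sgA.
  by rewrite ler_pM2r // lerD2l lerN2.
(* The cap 1/2 keeps the common factor 1 - d positive. *)
pose d := Num.min c 2^-1; have d0 : 0 < d by rewrite lt_min c0 invr_gt0 ltr0n.
have d2 : d <= 2^-1 by rewrite ge_min lexx orbT.
have b0 : 0 < 1 - d by lra.
exists (1 - d); split=> //; first by lra.
have pV j : pinv (((1 - d) * alpha)%:C *: sg X (A j)).
  by apply: pinvZ; [exact: mulr_gt0|exact: sgA].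
rewrite /F -(nm_Z MM) ?mulr_gt0 //; last exact: sgA.
apply: (nm_mono MM) => // [|j]; first by apply: sgA; exact: pinvZ.
apply: ole_trans (cP j) _; apply: oleZ2; last exact/pinv_psd/sgA.
by rewrite ler_pM2r // lerD2l lerN2 ge_min lexx.
Qed.

Lemma fixed_point_compare Z W : pinv Z -> pinv W -> ole Z (F Z) -> ole (F W) W ->
  ole Z W.
Proof.
move=> pZ pW ZF FW.
have [sZ sW] := (pinv_sa pZ, pinv_sa pW).
pose S := [set t : R | ole Z (t%:C *: W)].
have Spos t : S t -> 0 < t.
  move=> tS; case: pZ => c c0 cZ; have [x x0] := H_neq0.
  have := ole_rip (ole_trans cZ tS) x; rewrite !bopZ !ripZl ripxx => h.
  have nx : 0 < nr x ^+ 2 by rewrite exprn_gt0 // nr_gt0.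
  have : 0 < t * rip (W x) x by apply: lt_le_trans h; rewrite mulr_gt0.
  have := proj2 (pinv_psd pW) x; rewrite le_eqVlt => /orP[/eqP<-|W0].
    by rewrite mulr0 ltxx.
  by rewrite pmulr_lgt0.
have S0 : has_inf S.
  split; last by exists 0 => t /Spos/ltW.
  have [K K0 ZK] := sa_ubound sZ; case: (pW) => c c0 cW; exists (K / c).
  apply: ole_trans ZK _; have Kc : 0 <= K / c by rewrite divr_ge0 // ltW.
  have := oleZ Kc cW.
  by rewrite scalerA -rmorphM divfK // gt_eqF.
(* The order is closed under limits of scalars, so the least factor is attained. *)
have SinfS : S (inf S).
  apply/oleP => // [|x]; first exact: saZ.
  rewrite bopZ ripZl -subr_le0; apply: (@le_eps _ (rip (W x) x)).
    exact: proj2 (pinv_psd pW) x.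
  move=> e e0; have [t tS te] := inf_adherent e0 S0.
  have := ole_rip tS x; rewrite bopZ ripZl => h.
  have : t * rip (W x) x <= (inf S + e) * rip (W x) x.
    by rewrite ler_wpM2r ?(ltW te) //; exact: proj2 (pinv_psd pW) x.
  lra.
have i0 := Spos _ SinfS.
have [i1|i1] := leP (inf S) 1.
  apply: ole_trans SinfS _; rewrite -[X in ole _ X]scale1r.
  by apply: oleZ2; [|exact: pinv_psd].
have piW : pinv ((inf S)%:C *: W) by exact: pinvZ.
have [beta [b0 b1 h]] := F_contract pW i1.
have bi0 : 0 <= beta * inf S by rewrite mulr_ge0 // ltW.
have : S (beta * inf S).
  apply: ole_trans ZF _; apply: ole_trans (F_mono pZ piW SinfS) _.
  by apply: ole_trans h _; exact: oleZ.
move=> /(ge_inf (proj2 S0)); rewrite leNgt => /negP[].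
by rewrite gtr_pMl.
Qed.

Lemma common_bounds : exists c K, [/\ 0 < c, 0 < K, c <= K & forall j, op_itv c K (A j)].
Proof.
have [j|j c d d0 dc cA|c c0 cA] := @common_small _ (fun j c => ole c%:O (A j)).
- by case: (pA j) => c c0 cA; exists c.
- by apply: ole_trans cA; exact: oleO.
(* The upper bound is written k^-1 to make the condition downward closed in k, as [common_small]
   demands. *)
have [j|j k d d0 dk|k k0 Ak] := @common_small _ (fun j k => ole (A j) (k^-1)%:O).
- have [K K0 AK] := sa_ubound (pinv_sa (pA j)).
  by exists K^-1; rewrite ?invr_gt0 // invrK.
- move=> h; apply: ole_trans h _; apply: oleO.
  by rewrite lef_pV2 ?posrE // (lt_le_trans d0).
exists c, (Num.max c k^-1); split=> //.
- by rewrite lt_max c0.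
- by rewrite le_max lexx.
- move=> j; split; first exact: cA.
  by apply: ole_trans (Ak j) _; apply: oleO; rewrite le_max lexx orbT.
Qed.

Lemma fixed_point_exists : exists X, pinv X /\ X = F X.
Proof.
have [c [K [c0 K0 cK iA]]] := common_bounds.
pose X_ k := iter k F K%:O.
(* M and sigma both fix scalars, so F preserves the order interval from c to K; the lower bound c
   keeps the strong limit invertible. *)
have XP k : ole c%:O (X_ k) /\ ole (X_ k) K%:O.
  elim: k => [|k [IH1 IH2]]; first by split; [exact: oleO|exact: ole_refl].
  have pX : pinv (X_ k) by exists c.
  split; rewrite -[X_ k.+1]/(F (X_ k)).
    rewrite -(nm_scal c0); apply: (nm_mono MM) => [j||j]; [exact: pinvO|exact: sgA|].
    by apply: om_ge => //; case: (iA j).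
  rewrite -(nm_scal K0); apply: (nm_mono MM) => [|j|j]; [exact: sgA|exact: pinvO|].
  apply: om_le => //; [exact: pinv_psd|exact/pinv_psd/pA|by case: (iA j)].
have pX k : pinv (X_ k) by exists c => //; case: (XP k).
have dX k : ole (X_ k.+1) (X_ k).
  elim: k => [|k IH]; first by case: (XP 1%N).
  exact: (F_mono (pX k.+1) (pX k) IH).
have [X [_ XX]] := decreasing_sot_cv (fun k => pinv_psd (pX k)) dX.
have cX : ole c%:O X.
  apply: (sot_ole_ge XX) => [|k|k]; [exact: saO|exact/pinv_sa|by case: (XP k)].
have pX' : pinv X by exists c.
exists X; split=> //; apply: bop_ext => x.
have h : cv (fun k => F (X_ k) x) (F X x).
  apply: (nm_cvg MM) => [k|j|j k|j y]; [exact: sgA|exact: sgA| |].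
    by apply: (om_mono sgM) => //; try exact: pinv_psd; exact: ole_refl.
  exact: (om_cvg sgM (fun k => pinv_psd (pX k)) (fun=> pinv_psd (pA j))
    (pinv_psd pX') (pinv_psd (pA j)) dX (fun=> ole_refl _) XX (fun=> cv_cst _) y).
apply: cv_unique h => e e0; have [N hN] := XX x e e0.
by exists N => k Nk; apply: (hN k.+1); exact: leqW.
Qed.

End FixedPoint.

(** * Comparison of the two deformed means *)

Section MainInequality.
Variables (n : nat) (M : ('I_n -> bop H) -> bop H) (MM : nmean M).
Variables (sg sgr : bop H -> bop H -> bop H) (f : R -> R) (r : R).
Hypotheses (sgM : opmean sg) (sgrM : opmean sgr) (sgf : rep_fun sg f).
Hypothesis sgrf : rep_fun sgr (fun t => f (t `^ r)).
Hypothesis fnc : exists u v, [/\ 0 < u, 0 < v & f u != f v].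
Hypothesis orth : exists e1 e2, [/\ nr e1 = 1, nr e2 = 1 & ip e1 e2 = 0].
Hypothesis r01 : 0 <= r <= 1.
Variables (c K : R) (A : 'I_n -> bop H).
Hypotheses (c0 : 0 < c) (iA : forall j, op_itv c K (A j)).
Variables X Y : bop H.
Hypotheses (pX : pinv X) (pY : pinv Y).
Hypothesis XE : X = M (fun j => sgr X (A j)).
Hypothesis YE : Y = M (fun j => sg Y (bpow c K (A j) r)).

Let pAr j : pinv (bpow c K (A j) r).
Proof. exact: itv_pinv (powR_gt0 r c0) (bpow_bounds c0 r01 (iA j)). Qed.

Let pA j : pinv (A j). Proof. exact: itv_pinv c0 (iA j). Qed.

Let sgrE j : exists S Si a b, [/\ [/\ pinv S, pinv Si, S * S = X, S * Si = 1 & Si * S = 1],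
  0 < a, op_itv a b (Si * A j * Si) &
  sgr X (A j) = sg X (S * bpow a b (Si * A j * Si) r * S)].
Proof.
have [S [pS SS _]] := pinv_sqrt pX; have [Si [pSi SiS SSi]] := pinv_inv pS.
have pB := pinvJ (pinv_sa pSi) SSi (pA j).
have [a [b [a0 ab iB]]] := pinv_itv pB.
exists S, Si, a, b; split=> //.
have pBr := itv_pinv (powR_gt0 r a0) (bpow_bounds a0 r01 iB).
have pSB := pinvJ (pinv_sa pS) SiS pBr.
rewrite (om_repr sgrM pX (pA j) pS pSi SS SSi SiS) (sg_bpow sgM sgrM sgf sgrf a0 r01 iB).
rewrite (om_repr sgM pX pSB pS pSi SS SSi SiS); congr (S * sg 1 _ * S).
by move: (bpow _ _ _ _) => V; rewrite !mulrA SiS mul1r -mulrA SSi mulr1.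
Qed.

(** By homogeneity, scaling X by w^(r-1) amounts to replacing A^r by w #_r A = w^(1-r) A^r, the
    operator that the weighted mean bounds compare with X #_r A. *)
Let scale_sg (w : R) j : 0 < w ->
  sg ((w `^ (r - 1))%:C *: X) (bpow c K (A j) r) =
  (w `^ (r - 1))%:C *: sg X ((w `^ (1 - r))%:C *: bpow c K (A j) r).
Proof.
move=> w0; rewrite -(om_Z sgM) ?powR_gt0 //; [|exact: pinv_psd|].
  rewrite scalerA -rmorphM -powRD_gt0 //.
  have -> : r - 1 + (1 - r) = 0 by ring.
  by rewrite powRr0 scale1r.
by apply: psdZ; [exact: powR_ge0|exact: pinv_psd].
Qed.

Let ZE (w : R) : 0 < w ->
  (w `^ (r - 1))%:C *: X = M (fun j => (w `^ (r - 1))%:C *: sgr X (A j)).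
Proof. by move=> w0; rewrite (nm_Z MM) ?powR_gt0 -?XE // => j; exact: om_pinv. Qed.

Let pwX (w : R) : 0 < w -> pinv ((w `^ (r - 1))%:C *: X).
Proof. by move=> w0; apply: pinvZ => //; exact: powR_gt0. Qed.

Let pwA (w : R) j : 0 < w -> pinv ((w `^ (1 - r))%:C *: bpow c K (A j) r).
Proof. by move=> w0; apply: pinvZ => //; exact: powR_gt0. Qed.

Lemma deformed_mean_le (w : R) : 0 < w -> ole w%:O X -> ole Y ((w `^ (r - 1))%:C *: X).
Proof.
move=> w0 wX; apply: (fixed_point_compare MM sgM sgf fnc orth pAr) => //.
- exact: pwX.
- by rewrite -YE; exact: ole_refl.
rewrite [X in ole _ X]ZE //; apply: (nm_mono MM) => [j|j|j].
- by apply: om_pinv => //; exact: pwX.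
- by apply: pinvZ; [exact: powR_gt0|exact: om_pinv].
rewrite scale_sg //; apply: oleZ; first exact: powR_ge0.
have [S [Si [a [b [[pS pSi SS SSi SiS] a0 iB ->]]]]] := sgrE j.
have h := weighted_mean_ge a0 c0 w0 r01 (iA j) (pinv_sa pS) SS SSi SiS iB wX.
apply: (om_mono sgM) => //; [exact: pinv_psd|exact/pinv_psd/pwA|exact: pinv_psd| |].
  exact: ole_psd (pinv_psd (pwA j w0)) h.
exact: ole_refl.
Qed.

Lemma deformed_mean_ge (w : R) : 0 < w -> ole X w%:O -> ole ((w `^ (r - 1))%:C *: X) Y.
Proof.
move=> w0 Xw; apply: (fixed_point_compare MM sgM sgf fnc orth pAr) => //.
- exact: pwX.
- rewrite [X in ole X _]ZE //; apply: (nm_mono MM) => [j|j|j].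
  + by apply: pinvZ; [exact: powR_gt0|exact: om_pinv].
  + by apply: om_pinv => //; exact: pwX.
  rewrite scale_sg //; apply: oleZ; first exact: powR_ge0.
  have [S [Si [a [b [[pS pSi SS SSi SiS] a0 iB ->]]]]] := sgrE j.
  have h := weighted_mean_le a0 c0 w0 r01 (iA j) (pinv_sa pS) SS SSi SiS iB Xw.
  have pB := pinvJ (pinv_sa pS) SiS (itv_pinv (powR_gt0 r a0) (bpow_bounds a0 r01 iB)).
  apply: (om_mono sgM) => //; [exact: pinv_psd|exact: pinv_psd|exact: pinv_psd| |].
    exact/pinv_psd/pwA.
  exact: ole_refl.
- by rewrite -YE; exact: ole_refl.
Qed.

End MainInequality.

(** * Transfer to operators as plain functions *)

(** The value 0 is a default for unbounded maps; the lifting lemmas show that it never occurs at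
    admissible arguments of the means. *)
Definition tobop (g : H -> H) : bop H :=
  if pselect (bounded_operator g) is left gP then Bop gP else 0.

Lemma tobopK g : bounded_operator g -> (tobop g : H -> H) = g.
Proof. by rewrite /tobop; case: pselect. Qed.

Lemma bopK T : tobop T = T.
Proof. by apply: bop_ext => x; rewrite tobopK //; exact: bopP. Qed.

Lemma bopf_inj S T : (S : H -> H) = T -> S = T.
Proof. by move=> ST; apply: bop_ext => x; rewrite ST. Qed.

Lemma bopfB S T : (S - T : bop H) = (S : H -> H) - (T : H -> H) :> (H -> H).
Proof. by apply/funext. Qed.

Lemma bopfZ (z : R[i]) T : (z *: T : bop H) = z *: (T : H -> H) :> (H -> H).
Proof. by apply/funext. Qed.

Lemma bopfO (z : R[i]) : (z *: (1 : bop H) : bop H) = z *: (id : H -> H) :> (H -> H).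
Proof. by apply/funext. Qed.

(** Complex nonnegativity includes that <T x, x> is real. Polarization turns this into symmetry of
    imaginary parts, and replacing x by i x into symmetry of real parts. *)
Lemma positive_operatorP T : positive_operator ip T <-> psd T.
Proof.
split=> [[_ pT]|[sT pT]]; last first.
  split=> [|x]; first exact: bopP.
  rewrite lecE /= [X in _ && X]pT andbT; apply/eqP.
  rewrite -rip_iZr; suff : rip (T x) ('i%C *: x) = - rip (T x) ('i%C *: x).
    by move=> h; lra.
  by rewrite {1}sT linearZ !rip_iZr [ip x _]ipC; case: (ip _ _).
have im x : complex.Im (ip (T x) x) = 0.
  by have := pT x; rewrite lecE => /andP[/eqP].
have imD (z w : R[i]) : complex.Im (z + w) = complex.Im z + complex.Im w.
  by case: z; case: w.
have pol x y : complex.Im (ip (T x) y) = complex.Im (ip x (T y)).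
  have Txy : T (x + y) = T x + T y by rewrite raddfD.
  have := im (x + y); rewrite Txy linearDl !linearDr /= !imD !im add0r addr0.
  by rewrite [ip (T y) x]ipC => /eqP; rewrite addr_eq0 => /eqP ->;
    case: (ip x (T y)) => a b /=; rewrite opprK.
split=> [x y|x]; last by have := pT x; rewrite lecE => /andP[].
have h := pol ('i%C *: x) y.
rewrite linearZ !linearZl_LR /= in h.
move: h; rewrite /rip; case: (ip (T x) y) => a b; case: (ip x (T y)) => c d /=.
by rewrite !mul0r !mul1r !add0r.
Qed.

Lemma op_leP S T : op_le ip S T <-> ole S T.
Proof. by rewrite /op_le -bopfB; exact: positive_operatorP. Qed.

Lemma invertible_operatorP T :
  invertible_operator T <-> exists S, S * T = 1 /\ T * S = 1.
Proof.
split=> [[g [gP Tg gT]]|[S [ST TS]]].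
  exists (Bop gP); split; apply: bopf_inj.
    exact: gT.
  exact: Tg.
exists S; split; first exact: bopP.
  by rewrite -[RHS]/((1 : bop H) : H -> H) -TS.
by rewrite -[RHS]/((1 : bop H) : H -> H) -ST.
Qed.

Lemma bb_left_inverse S T : S * T = 1 -> bounded_below T.
Proof.
move=> ST; have [d d0 Sd] := bop_bound S; have d1 : 0 < d + 1 by rewrite ltr_wpDl.
exists (d + 1)^-1 => [|x]; first by rewrite invr_gt0.
rewrite mulrC ler_pdivrMr // mulrC -[x in nr x <= _]/((1 : bop H) x) -ST bopM.
by rewrite (le_trans (Sd _)) // ler_wpM2r ?nr_ge0 // lerDl.
Qed.

Lemma pos_invertibleP T : pos_invertible ip T <-> pinv T.
Proof.
split=> [[/positive_operatorP pT /invertible_operatorP[S [ST _]]]|pT].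
  by apply: psd_bb => //; exact: bb_left_inverse ST.
split; first exact/positive_operatorP/pinv_psd.
by apply/invertible_operatorP; have [S [_ ST TS]] := pinv_inv pT; exists S.
Qed.

Lemma spectrumE T (z : R[i]) :
  spectrum T z <-> ~ exists S, S * (T - z *: (1 : bop H)) = 1 /\ (T - z *: (1 : bop H)) * S = 1.
Proof.
rewrite /spectrum /= -bopfO -bopfB.
by split=> h1 h2; apply: h1; apply/invertible_operatorP.
Qed.

Lemma nbb_spectrum T (t : R) : ~ bounded_below (T - t%:O) -> spectrum T t%:C.
Proof. by move=> nb; apply/spectrumE => -[S [ST _]]; exact/nb/(bb_left_inverse ST). Qed.

Lemma spectrum_itv (a b : R) T (t : R) : op_itv a b T -> spectrum T t%:C -> a <= t <= b.
Proof.
move=> [aT Tb] /spectrumE nT; apply/andP; split; rewrite leNgt; apply/negP => lt; apply: nT.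
  have [|S [_ ST TS]] := @pinv_inv (T - t%:O); last by exists S.
  exists (a - t); first by rewrite subr_gt0.
  by rewrite rmorphB scalerBl; apply: oleD => //; exact: ole_refl.
have [|S [_ ST TS]] := @pinv_inv (t%:O - T).
  exists (t - b); first by rewrite subr_gt0.
  by rewrite rmorphB scalerBl; apply: oleD; [exact: ole_refl|exact: oleN].
by exists (- S); rewrite -[T - _]opprK opprB !mulrNN.
Qed.

(** For z = a + i b with b nonzero, put U = T - a and J = i b: (U - J)(U + J) = U^2 + b^2 is at
    least b^2, hence invertible, and the factors commute. *)
Lemma spectrum_real T (z : R[i]) : selfadj T -> spectrum T z -> z = (complex.Re z)%:C.
Proof.
move=> sT /spectrumE nT; apply: contrapT => zr; apply: nT.
set a := complex.Re z in zr; pose b := complex.Im z.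
have zE : z = a%:C + b%:C * 'i%C by rewrite mulrC -complexE.
have b0 : b != 0 by apply: contra_notN zr => /eqP b0; rewrite zE b0 mul0r addr0.
pose U := T - a%:O; have sU : selfadj U by apply: saB => //; exact: saO.
pose J := (b%:C * 'i%C) *: (1 : bop H).
have zU : T - z *: (1 : bop H) = U - J.
  by rewrite zE scalerDl opprD addrA.
have JJ : J * J = - (b ^+ 2)%:O.
  rewrite /J bop_scalerAl mul1r scalerA -scaleNr; congr (_ *: _).
  by rewrite mulrACA -expr2 -expr2 sqr_i mulrN1 -rmorphXn.
have UJ : U * J = J * U by rewrite /J bop_scalerAr bop_scalerAl mulr1 mul1r.
clearbody U J.
have V1 : (U - J) * (U + J) = U * U + (b ^+ 2)%:O.
  by rewrite mulrBl !mulrDr UJ opprD -[LHS]addrA addNKr JJ opprK.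
have V2 : (U + J) * (U - J) = U * U + (b ^+ 2)%:O.
  by rewrite mulrBr !mulrDl UJ opprD -[LHS]addrA addNKr JJ opprK.
have [W [_ WV VW]] : exists W, [/\ pinv W, W * (U * U + (b ^+ 2)%:O) = 1 &
    (U * U + (b ^+ 2)%:O) * W = 1].
  apply: pinv_inv; exists (b ^+ 2); first by rewrite exprn_even_gt0.
  by rewrite -[X in ole X _]add0r; apply: oleD; [exact/ole0/psdS|exact: ole_refl].
have l1 : W * (U + J) * (U - J) = 1 by rewrite -mulrA V2.
have r1 : (U - J) * ((U + J) * W) = 1 by rewrite mulrA V1.
by rewrite zU; exists (W * (U + J)); split=> //; rewrite (inverse_unique l1 r1).
Qed.

(** The best scalar lower bound of X lies in its real spectrum and below all of it, so the default
    value in [lambda_min] is not taken. *)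
Lemma lambda_minP X : pinv X -> 0 < lambda_min X /\ ole (lambda_min X)%:O X.
Proof.
move=> pX; have sX := pinv_sa pX; have [l [lX nl]] := sa_lower_bound sX.
have [K K0 XK] := sa_ubound sX.
have lmin : spectrum X l%:C /\ forall z : R[i], spectrum X z -> l%:C <= z.
  split=> [|z zX]; first exact: nbb_spectrum.
  have zr := spectrum_real sX zX; rewrite zr in zX *.
  by rewrite lecR; have /andP[] := spectrum_itv (conj lX XK) zX.
have [h1 h2] : [set l : R | spectrum X l%:C /\ forall z : R[i], spectrum X z -> l%:C <= z]
    (lambda_min X) by apply: xgetPex; exists l.
have [a [b [a0 _ iX]]] := pinv_itv pX.
have /andP[al _] := spectrum_itv iX h1.
split; first exact: lt_le_trans al.
by apply: ole_trans lX; apply: oleO; rewrite -lecR; apply: h2; case: lmin.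
Qed.

Lemma op_norm_has_sup T :
  has_sup [set complex.Re `|T x| | x in [set x : H | `|x| <= 1]].
Proof.
have [c c0 Tc] := bop_bound T; split.
  by exists (complex.Re `|T 0|); exists 0 => //=; rewrite normr0 ler01.
exists c => _ [x /= x1 <-]; rewrite -[leLHS]/(nr (T x)) (le_trans (Tc x)) //.
by rewrite -[leRHS]mulr1 ler_wpM2l // -lecR -nrE.
Qed.

Lemma op_norm_ub T x : nr (T x) <= op_norm T * nr x.
Proof.
have [->|x0] := eqVneq x 0; first by rewrite linear0 nr0 mulr0.
have nx : 0 < nr x by rewrite nr_gt0.
rewrite -ler_pdivrMr // mulrC.
have -> : (nr x)^-1 * nr (T x) = nr (T ((nr x)^-1%:C *: x)).
  by rewrite linearZ nrZr ger0_norm // invr_ge0 ltW.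
apply: (ub_le_sup (proj2 (op_norm_has_sup T))); exists ((nr x)^-1%:C *: x) => //=.
by rewrite nrE nrZr ger0_norm ?invr_ge0 ?(ltW nx) // mulVf ?gt_eqF.
Qed.

Lemma op_norm_le T (c : R) : 0 <= c -> (forall x, nr (T x) <= c * nr x) ->
  op_norm T <= c.
Proof.
move=> c0 Tc; apply: ge_sup; first by case: (op_norm_has_sup T).
move=> _ [x /= x1 <-]; rewrite -[leLHS]/(nr (T x)) (le_trans (Tc x)) //.
by rewrite -[leRHS]mulr1 ler_wpM2l // -lecR -nrE.
Qed.

Lemma op_normP X : pinv X -> 0 < op_norm X /\ ole X (op_norm X)%:O.
Proof.
move=> pX; have [_ h] := nr_ole (pinv_sa pX) (op_norm_ub X).
by split=> //; case: pX => c c0 cX; apply: lt_le_trans c0 _; apply: oleO_le;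
  exact: ole_trans cX h.
Qed.

(** One calculus approximates on the spectrum, the other on [a, b]. The point t at which
    [rhorner_spectral_bound] evaluates the difference of two approximants lies in both sets. *)
Lemma op_pow_bpow (a b r : R) T : 0 < a -> 0 <= r <= 1 -> op_itv a b T ->
  op_pow T r = bpow a b T r.
Proof.
move=> a0 r01 iT; have ap : approximable a b (fun t => t `^ r) by exact: apx_powR.
have sT := itv_sa iT; set S := bpow a b T r.
have fcS : functional_calculus (fun t => t `^ r) T S.
  split=> [|e e0]; first exact: bopP.
  have [p [pg pS]] := fcP ap iT e0; exists p; split=> [t tT|].
    by apply: pg; exact: spectrum_itv tT.
  by rewrite horner_operatorE -bopfB; apply: op_norm_le; [exact: ltW|exact: pS].
have [gP h] : functional_calculus (fun t => t `^ r) T (op_pow T r).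
  by apply: (xgetPex 0 (P := [set S | functional_calculus (fun t => t `^ r) T S]));
    exists (bopf S).
move: h; rewrite -(tobopK gP); move: (tobop _) => U h; congr bopf.
apply: bop_ext => x; apply/eqP; rewrite -subr_eq0; apply/eqP.
apply: (@nr_eps _ (4 * nr x)) => [|e e0]; first by rewrite mulr_ge0 ?nr_ge0.
have [p [pg pU]] := h e e0; have [q [qg qS]] := fcP ap iT e0.
have h1 : nr (rhorner p T x - U x) <= e * nr x.
  rewrite -bopB; apply: le_trans (op_norm_ub _ x) _.
  by rewrite ler_wpM2r ?nr_ge0 // bopfB -horner_operatorE.
have h2 : nr (rhorner p T x - rhorner q T x) <= (e + e) * nr x.
  rewrite -bopB -rhornerB; have [t [nt ht]] := rhorner_spectral_bound (p - q) sT.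
  apply: le_trans (ht x) _; rewrite ler_wpM2r ?nr_ge0 // hornerD hornerN.
  have -> : p.[t] - q.[t] = (p.[t] - t `^ r) - (q.[t] - t `^ r) by ring.
  rewrite (le_trans (ler_normB _ _)) // lerD //.
    by apply: pg; exact: nbb_spectrum.
  by apply: qg; exact: itv_nbb nt.
have h3 := qS x.
apply: (le_trans (nr_dist _ (rhorner p T x) _)); rewrite nr_distC.
have h4 := nr_dist (rhorner p T x) (rhorner q T x) (S x).
by rewrite -/(bpow a b T r) -/S in h3; lra.
Qed.

Lemma adjoint_sa T : selfadj T -> adjoint ip T = T.
Proof.
move=> sT; have h x y : ip (T x) y = ip x (T y).
  apply/eqP; rewrite eq_complex; apply/andP; split; apply/eqP; first exact: sT.
  by rewrite -!rip_iZr sT linearZ.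
have [_ h'] : [set g | bounded_operator g /\ forall x y, ip (T x) y = ip x (g y)]
    (adjoint ip T).
  by apply: xgetPex; exists (bopf T); split=> //; exact: bopP.
apply/funext => y; apply: rip_inj => z.
by rewrite ripC [RHS]ripC /rip -h' h.
Qed.

Lemma lift_operator_mean sigma : operator_mean ip sigma ->
  opmean (fun A B => tobop (sigma A B)) /\
  forall A B, psd A -> psd B -> (tobop (sigma A B) : H -> H) = sigma A B.
Proof.
move=> sM.
have K A B : psd A -> psd B -> (tobop (sigma A B) : H -> H) = sigma A B.
  move=> /positive_operatorP pA /positive_operatorP pB.
  by apply: tobopK; case: (mean_positive sM pA pB).
split=> //; split=> [A B pA pB|A B C D pA pB pC pD AC BD|A B C pA pB pC||].
- apply/positive_operatorP; rewrite K //.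
  by apply: (mean_positive sM); exact/positive_operatorP.
- apply/op_leP; rewrite !K //.
  by apply: (mean_mono sM); first [exact/positive_operatorP|exact/op_leP].
- have sC : selfadj C by case: pC.
  apply/op_leP; rewrite !K //; try exact: psdJ.
  have := mean_transformer sM (proj2 (positive_operatorP A) pA)
    (proj2 (positive_operatorP B) pB) (proj2 (positive_operatorP C) pC).
  have E : (C * tobop (sigma A B) * C : H -> H) = C \o sigma A B \o C.
    by apply/funext => x; rewrite !bopM K.
  by rewrite E.
- move=> A_ B_ A B pA_ pB_ pA pB dA dB cA cB x.
  have dto (T_ : nat -> bop H) T : (forall k, ole (T_ k.+1) (T_ k)) ->
      (forall x, cv (fun k => T_ k x) (T x)) -> decreases_to ip (fun k => bopf (T_ k)) T.
    by move=> dT cT; split=> [k|y]; [exact/op_leP|exact/cvP].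
  have [_ h] := mean_cvg sM (fun k => proj2 (positive_operatorP _) (pA_ k))
    (fun k => proj2 (positive_operatorP _) (pB_ k)) (proj2 (positive_operatorP _) pA)
    (proj2 (positive_operatorP _) pB) (dto _ _ dA cA) (dto _ _ dB cB).
  have /cvP := h x; rewrite K //.
  by under [X in _ -> cv X _]eq_fun do rewrite K //.
- by apply: bopf_inj; rewrite K; [exact: mean_id sM|exact: psd1|exact: psd1].
Qed.

Lemma lift_representing_function sigma f : representing_function sigma f ->
  rep_fun (fun A B => tobop (sigma A B)) f.
Proof. by move=> h t t0; rewrite bopfO -[bopf 1]/(id : H -> H) h // -bopfO bopK. Qed.

Lemma lift_nvar_operator_mean n (M : ('I_n -> H -> H) -> (H -> H)) :
  nvar_operator_mean ip M -> nmean (fun A => tobop (M (fun j => bopf (A j)))) /\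
  forall A, (forall j, pinv (A j)) ->
    (tobop (M (fun j => bopf (A j))) : H -> H) = M (fun j => bopf (A j)).
Proof.
move=> MM.
have K A : (forall j, pinv (A j)) ->
    (tobop (M (fun j => bopf (A j))) : H -> H) = M (fun j => bopf (A j)).
  move=> pA; apply: tobopK.
  have [[]] // := nmean_pos_invertible MM (fun j => proj2 (pos_invertibleP _) (pA j)).
split=> //; split=> [A pA|A B pA pB AB|c A c0 pA|A_ A pA_ pA dA cA x|].
- apply/pos_invertibleP; rewrite K //.
  by apply: (nmean_pos_invertible MM) => j; exact/pos_invertibleP.
- apply/op_leP; rewrite !K //; apply: (nmean_mono MM) => j;
    by first [exact/pos_invertibleP|exact/op_leP].
(* Positive homogeneity is congruence invariance under the scalar operator sqrt(c). *)
- have s0 : 0 < Num.sqrt c by rewrite sqrtr_gt0.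
  pose S : bop H := (Num.sqrt c)%:O.
  have pS : pinv S by exact: pinvO.
  have SUS U : S * U * S = c%:C *: U.
    by rewrite scalarO scalarOr scalerA -rmorphM -expr2 sqr_sqrtr // ltW.
  have pcA j : pinv (c%:C *: A j) by exact: pinvZ.
  apply: bopf_inj; rewrite K // -SUS.
  have := nmean_congruence MM (fun j => proj2 (pos_invertibleP _) (pA j)) (bopP S)
    (proj2 (proj2 (pos_invertibleP _) pS)).
  rewrite (adjoint_sa (pinv_sa pS)) => h.
  transitivity (M (fun j => (S \o A j) \o S)).
    by congr M; apply/funext => j; rewrite -SUS.
  by rewrite -h; apply/funext => x; rewrite !bopM K.
- have h := nmean_cvg MM (fun k j => proj2 (pos_invertibleP _) (pA_ k j))
    (fun j => proj2 (pos_invertibleP _) (pA j)).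
  have /cvP : M (fun j => bopf (A_ k j)) x @[k --> \oo] --> M (fun j => bopf (A j)) x.
    by apply: h; left=> j; split=> [k|y]; [exact/op_leP|exact/cvP].
  by rewrite K //; under [X in _ -> cv X _]eq_fun do rewrite K //.
- by apply: bopf_inj; rewrite K; [exact: nmean_id MM|move=> _; exact: pinv1].
Qed.

Lemma pos_invertible_lift (g : H -> H) : pos_invertible ip g ->
  exists2 T : bop H, g = T & pinv T.
Proof.
move=> pg; have [[gP _] _] := pg; exists (Bop gP) => //; exact/pos_invertibleP.
Qed.

Lemma deformed_mean_lift n (M : ('I_n -> H -> H) -> (H -> H)) sigma
    (A : 'I_n -> bop H) : nvar_operator_mean ip M -> operator_mean ip sigma ->
  (forall j, pinv (A j)) ->
  exists2 X : bop H, deformed_mean ip M sigma (fun j => bopf (A j)) = X &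
    pinv X /\ X = tobop (M (fun j => bopf (tobop (sigma X (A j))))).
Proof.
move=> MM sM pA; have [MM' MK] := lift_nvar_operator_mean MM.
have [sM' sK] := lift_operator_mean sM.
have E X : pinv X -> (tobop (M (fun j => bopf (tobop (sigma X (A j))))) : H -> H) =
    M (fun j => sigma X (A j)).
  move=> pX; rewrite MK; last by move=> j; exact: (om_pinv sM').
  by congr M; apply/funext => j; rewrite sK //; exact: pinv_psd.
have [X0 [pX0 X0E]] := fixed_point_exists MM' sM' pA.
have [pX XE] : [set X | pos_invertible ip X /\ X = M (fun j => sigma X (A j))]
    (deformed_mean ip M sigma (fun j => bopf (A j))).
  apply: xgetPex; exists (bopf X0); split; first exact/pos_invertibleP.
  by rewrite -E // -X0E.
have [X XX pX'] := pos_invertible_lift pX; exists X => //; split=> //.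
by apply: bopf_inj; rewrite E // -XX.
Qed.

End Hilbert.

(** * Use of infinite dimension, and the inequality itself *)

Lemma infinite_dimensional_neq0 (R : realType) (H : completeNormedModType R[i]) :
  infinite_dimensional H -> exists x : H, x != 0.
Proof.
move=> Hinf; apply: contrapT => H0; apply: Hinf; exists 0%N, (fun=> 0) => x.
exists (fun=> 0); rewrite big_ord0; apply: contrapT => x0; apply: H0; exists x.
exact/eqP.
Qed.

(** One Gram-Schmidt step: if no y left a remainder orthogonal to e1, the space would be spanned by
    e1. *)
Lemma infinite_dimensional_orthonormal (R : realType) (H : completeNormedModType R[i])
    (ip : {dot H for Num.conj}) (ip_norm : induces_norm ip) :
  infinite_dimensional H ->
  exists e1 e2 : H, [/\ nr e1 = 1, nr e2 = 1 & ip e1 e2 = 0].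
Proof.
move=> Hinf; have [x x0] := infinite_dimensional_neq0 Hinf.
have unit (y : H) : y != 0 -> nr ((nr y)^-1%:C *: y) = 1.
  move=> y0; rewrite nrZr ger0_norm ?invr_ge0 ?nr_ge0 // mulVf //.
  by rewrite nr_eq0.
pose e1 := (nr x)^-1%:C *: x; have e1n : nr e1 = 1 by exact: unit.
have [y yn] : exists y : H, y - ip y e1 *: e1 != 0.
  apply: contrapT => ny; apply: Hinf; exists 1%N, (fun=> e1) => y.
  exists (fun=> ip y e1); rewrite big_ord1; apply: contrapT => yE; apply: ny; exists y.
  by rewrite subr_eq0; exact/eqP.
pose z := y - ip y e1 *: e1.
have ze : ip z e1 = 0.
  by rewrite /z linearBl linearZl_LR /= ipxx // e1n expr1n mulr1 subrr.
exists e1, ((nr z)^-1%:C *: z); split=> //; first exact: unit.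
by rewrite ipC linearZl_LR /= ze mulr0 conjc0.
Qed.

Theorem theorem4p2 (R : realType) (H : completeNormedModType R[i])
    (ip : {dot H for Num.conj})
    (ip_norm : induces_norm ip) (H_infdim : infinite_dimensional H)
    (n : nat) (M : ('I_n -> H -> H) -> (H -> H))
    (M_mean : nvar_operator_mean ip M)
    (sigma : (H -> H) -> (H -> H) -> (H -> H))
    (sigma_mean : operator_mean ip sigma)
    (sigma_nontriv : ~ is_left_trivial ip sigma)
    (f : R -> R) (f_sigma : representing_function sigma f)
    (A : 'I_n -> H -> H) (A_pos : forall j, pos_invertible ip (A j))
    (r : R) (r_gt0 : 0 < r) (r_le1 : r <= 1)
    (sigma_r : (H -> H) -> (H -> H) -> (H -> H))
    (sigma_r_mean : operator_mean ip sigma_r)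
    (f_sigma_r : representing_function sigma_r (fun x => f (x `^ r))) :
  let X := deformed_mean ip M sigma_r A in
  let Y := deformed_mean ip M sigma (fun j => op_pow (A j) r) in
  op_le ip ((op_norm X `^ (r - 1))%:C *: X) Y /\
  op_le ip Y ((lambda_min X `^ (r - 1))%:C *: X).
Proof.
have H0 := infinite_dimensional_neq0 H_infdim.
have orth := infinite_dimensional_orthonormal ip_norm H_infdim.
have r01 : 0 <= r <= 1 by rewrite ltW.
have [sM sK] := lift_operator_mean ip_norm sigma_mean.
have [srM srK] := lift_operator_mean ip_norm sigma_r_mean.
have sf := lift_representing_function f_sigma.
have srf := lift_representing_function f_sigma_r.
have [MM MK] := lift_nvar_operator_mean ip_norm H0 M_mean.
have fnc : exists u v, [/\ 0 < u, 0 < v & f u != f v].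
  apply: contrapT => nf; apply: sigma_nontriv => C D pC pD.
  have [[CP _] [DP _]] := (pC, pD).
  have pC' := proj1 (positive_operatorP ip (Bop CP)) pC.
  have pD' := proj1 (positive_operatorP ip (Bop DP)) pD.
  rewrite -[LHS](sK (Bop CP) (Bop DP)) //.
  rewrite (om_trivial ip_norm H0 sM sf) // => u v u0 v0.
  by apply: contrapT => fuv; apply: nf; exists u, v; split=> //; exact/eqP.
have /choice[A' A'P] : forall j, exists T : bop H, A j = T /\ pinv ip T.
  by move=> j; have [T] := pos_invertible_lift ip_norm H0 (A_pos j); exists T.
have AE : A = (fun j => bopf (A' j)) by apply/funext => j; case: (A'P j).
have pA' j : pinv ip (A' j) by case: (A'P j).
(* One interval for all A_j lets a single calculus [bpow c K] represent all the powers. *)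
have [c [K [c0 K0 cK iA]]] := common_bounds ip_norm pA'.
have pE : (fun j => op_pow (A j) r) = (fun j => bopf (bpow c K (A' j) r)).
  by apply/funext => j; rewrite AE (op_pow_bpow ip_norm H0 c0 r01 (iA j)).
have pAr j : pinv ip (bpow c K (A' j) r).
  exact: itv_pinv (powR_gt0 r c0) (bpow_bounds ip_norm H0 c0 r01 (iA j)).
rewrite /= pE AE.
have [X -> [pX XE]] := deformed_mean_lift ip_norm H0 M_mean sigma_r_mean pA'.
have [Y -> [pY YE]] := deformed_mean_lift ip_norm H0 M_mean sigma_mean pAr.
have [l0 lX] := lambda_minP ip_norm H0 pX.
have [m0 Xm] := op_normP ip_norm H0 pX.
rewrite -!bopfZ; split; apply/(op_leP ip).
  exact: (deformed_mean_ge ip_norm H0 MM sM srM sf srf fnc orth r01 c0 iA pX pY XE YE).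
exact: (deformed_mean_le ip_norm H0 MM sM srM sf srf fnc orth r01 c0 iA pX pY XE YE).
Qed.
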